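(* Let $n=1$ and let $\hbar\in\,]-\infty,-1[$. For signature $s=2$, the only linear functional $\phi:\mathcal A(\mathbb{CP}^1)\to\mathbb C$ which is positive for the product $\star^{(2)}_{\mathrm{red},\hbar}$ is $\phi=0$. But for signature $s=1$, the evaluation functionals $\delta_{[\rho]}:\mathcal A(\mathbb D^1)\to\mathbb C$, $f\mapsto f([\rho])$, with $[\rho]\in M^{(1)}_{\mathrm{red}}\cong\mathbb D^1$, are non-trivial positive linear functionals for the product $\star^{(1)}_{\mathrm{red},\hbar}$ on $\mathcal A(\mathbb D^1)$. As a consequence, the $^*$-algebra $\mathcal A(\mathbb D^1)$ with product $\star^{(1)}_{\mathrm{red},\hbar}$ and pointwise complex conjugation as $^*$-involution is not $^*$-isomorphic to the $^*$-algebra $\mathcal A(\mathbb{CP}^1)$ with product $\star^{(2)}_{\mathrm{red},\hbar}$ and pointwise complex conjugation as $^*$-involution.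
   Context: Here $n=1$ and $s\in\{1,2\}$; $\nu_k=+1$ for $0\le k\le s-1$ and $\nu_k=-1$ for $s\le k\le n$. On $\mathbb C^{1+n}$ put $J^{(s)}=\sum_{k=0}^n\nu_k z^k\bar z^k$, $Z^{(s)}=(J^{(s)})^{-1}(\{1\})$ and $M^{(s)}_{\mathrm{red}}=Z^{(s)}/U(1)$, identified with the open subset $\{[\rho]: J^{(s)}(\rho)>0\}$ of $\mathbb{CP}^n$. So $M^{(2)}_{\mathrm{red}}\cong\mathbb{CP}^1$ and $M^{(1)}_{\mathrm{red}}\cong\mathbb D^1$, the open unit disc in $\mathbb C$ (via $[\rho]\mapsto\rho^1/\rho^0$). Let $\hat J^{(s)}(\xi,\eta)=\sum_{k=0}^n\nu_k\xi^k\eta^k$ on $\mathbb C^{1+n}\times\mathbb C^{1+n}$, $\hat Z^{(s)}=(\hat J^{(s)})^{-1}(\{1\})$ and $\hat M^{(s)}_{\mathrm{red}}=\hat Z^{(s)}/\mathbb C^*$, where $\alpha\in\mathbb C^*$ acts by $(\xi,\eta)\mapsto(\alpha\xi,\alpha^{-1}\eta)$; this is a complex manifold. $\mathcal A(M^{(s)}_{\mathrm{red}})$ is the algebra of functions $g$ on $M^{(s)}_{\mathrm{red}}$ of the form $g([\rho])=\hat g([(\rho,\bar\rho)])$, $\rho\in Z^{(s)}$, with (unique) $\hat g\in\mathcal O(\hat M^{(s)}_{\mathrm{red}})$ holomorphic, with the Fréchet topology of locally uniform convergence of the extensions $\hat g$; $\mathcal A(\mathbb{CP}^1)=\mathcal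 A(M^{(2)}_{\mathrm{red}})$, $\mathcal A(\mathbb D^1)=\mathcal A(M^{(1)}_{\mathrm{red}})$. For $P,Q\in\mathbb N_0^{1+n}$ with $|P|=|Q|$ let $b^{(s)}_{P,Q;\mathrm{red}}([\rho])=\rho^P\bar\rho^Q$ for $\rho\in Z^{(s)}$; these span a dense subalgebra $\mathcal P(M^{(s)}_{\mathrm{red}})$ of $\mathcal A(M^{(s)}_{\mathrm{red}})$. With $(x)_{\downarrow,m}=\prod_{j=0}^{m-1}(x-j)$ and $\mathrm{sgn}^{(s)}(T)=\prod_{k=0}^n\nu_k^{T_k}$, for $\hbar\in\Omega=\mathbb C\setminus(\{1/k:k\ge1\}\cup\{0\})$ the product $\star^{(s)}_{\mathrm{red},\hbar}$ is the unique continuous bilinear product on $\mathcal A(M^{(s)}_{\mathrm{red}})$ with $$b^{(s)}_{P,Q;\mathrm{red}}\star^{(s)}_{\mathrm{red},\hbar}b^{(s)}_{R,S;\mathrm{red}}=\sum_{T=0}^{\min\{Q,R\}}\mathrm{sgn}^{(s)}(T)\frac{(1/\hbar)_{\downarrow,|Q+R-T|}}{(1/\hbar)_{\downarrow,|Q|}(1/\hbar)_{\downarrow,|R|}}T!\binom QT\binom RT\,b^{(s)}_{P+R-T,Q+S-T;\mathrm{red}}$$ (sum over multiindices $0\le T\le\min\{Q,R\}$, elementwise). It is associative with unit $1$, and for real $\hbar\in\Omega$ it gives a $^*$-algebra with pointwise complex conjugation. A linear functional $\phi$ on $\mathcal A(M^{(s)}_{\mathrm{red}})$ is positive for $\star^{(s)}_{\mathrm{red},\hbar}$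 if $\phi(\bar f\star^{(s)}_{\mathrm{red},\hbar}f)\ge0$ for all $f\in\mathcal A(M^{(s)}_{\mathrm{red}})$ (no continuity is required). *)

(* Defs.v *)
From HB Require Import structures.
From mathcomp Require Import all_boot all_order all_algebra.
From mathcomp Require Import generic_quotient complex.
From mathcomp Require Import all_classical all_reals all_analysis.

Set Implicit Arguments.
Unset Strict Implicit.
Unset Printing Implicit Defensive.

Import Order.TTheory GRing.Theory Num.Theory.
Import numFieldNormedType.Exports.
Local Open Scope classical_set_scope.
Local Open Scope quotient_scope.
Local Open Scope ring_scope.

(* Seen as a numClosedFieldType, R[i] inherits the topology and the normed module
   structure (over itself) that the library puts on abstract numeric fields. *)
Definition Cplx (R : realType) : numClosedFieldType := R[i].

Section Spaces.
Context (R : realType).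
Local Notation C := (Cplx R).
Local Notation V := 'rV[C]_2.

Definition nu (s : nat) (k : 'I_2) : C := if (k < s)%N then 1 else -1.

Definition Jform (s : nat) (rho : V) : C :=
  \sum_(k < 2) nu s k * (rho 0 k * (rho 0 k)^*).

Definition Z (s : nat) : set V := [set rho | Jform s rho = 1].

Definition Jhat (s : nat) (z : V * V) : C :=
  \sum_(k < 2) nu s k * (z.1 0 k * z.2 0 k).

Definition Zhat (s : nat) : set (V * V) := [set z | Jhat s z = 1].

Definition U1_rel (s : nat) (x y : Z s) : bool :=
  `[< exists2 u : C, `|u| = 1 & val y = u *: val x >].

Fact U1_equiv s : equiv_class_of (@U1_rel s).
Proof.
split=> [x|x y|y x z].
- by apply/asboolP; exists 1; rewrite ?normr1 ?scale1r.
- apply: asbool_equiv_eq; split=> -[u u1 e]; exists u^-1; rewrite ?normfV ?u1 ?invr1//.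
  + by rewrite e scalerA mulVf ?scale1r// -normr_eq0 u1 oner_eq0.
  + by rewrite e scalerA mulVf ?scale1r// -normr_eq0 u1 oner_eq0.
- move=> /asboolP[u u1 e] /asboolP[v v1 f]; apply/asboolP; exists (v * u).
    by rewrite normrM u1 v1 mulr1.
  by rewrite f e scalerA.
Qed.
Canonical U1_equiv_rel s := EquivRelPack (@U1_equiv s).

Definition Mred (s : nat) := {eq_quot @U1_rel s}.

Definition Cstar_rel (s : nat) (x y : Zhat s) : bool :=
  `[< exists2 a : C, a != 0 & val y = (a *: (val x).1, a^-1 *: (val x).2) >].

Fact Cstar_equiv s : equiv_class_of (@Cstar_rel s).
Proof.
have sym (x y : Zhat s) : Cstar_rel x y -> Cstar_rel y x.
  move=> /asboolP[a a0 e]; apply/asboolP; exists a^-1; rewrite ?invr_eq0//.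
  by rewrite e /= invrK !scalerA mulVf// mulfV// !scale1r; case: (val x).
split=> [x|x y|y x z].
- by apply/asboolP; exists 1; rewrite ?oner_eq0// invr1 !scale1r; case: (val x).
- by apply/idP/idP; apply: sym.
- move=> /asboolP[a a0 e] /asboolP[b b0 f]; apply/asboolP; exists (b * a).
    by rewrite mulf_neq0.
  by rewrite f e /= !scalerA invfM.
Qed.
Canonical Cstar_equiv_rel s := EquivRelPack (@Cstar_equiv s).

Definition Mhat (s : nat) := quotient_topology {eq_quot @Cstar_rel s}.

(* Complex differentiability on the submanifold Zhat s of C^4 means that the
   function extends, near each point, to a complex differentiable function on an
   open subset of C^4.  The projection Zhat s -> Mhat s is a holomorphic
   submersion, so f is holomorphic on Mhat s iff its pullback to Zhat s is. *)
Definition holomorphic (s : nat) (f : Mhat s -> C) : Prop :=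
  forall z : Zhat s, exists F : V * V -> C,
    (\forall w \near val z, differentiable F w) /\
    (\forall w \near z, F (val w) = f (\pi_(Mhat s) w)).

Definition conjV (rho : V) : V := map_mx Num.conj rho.

Fact antidiag_subproof s (rho : Z s) : (val rho, conjV (val rho)) \in Zhat s.
Proof.
apply/mem_set; rewrite /Zhat /Jhat /=.
by rewrite -[RHS](set_mem (valP rho)); apply: eq_bigr => k _; rewrite mxE.
Qed.

Definition antidiag s (rho : Z s) : Zhat s :=
  exist _ (val rho, conjV (val rho)) (antidiag_subproof rho).

Definition extends (s : nat) (g : Mred s -> C) (ghat : Mhat s -> C) : Prop :=
  holomorphic ghat /\
  forall rho : Z s, g (\pi_(Mred s) rho) = ghat (\pi_(Mhat s) (antidiag rho)).

Definition in_Ared (s : nat) : {pred (Mred s -> C)} :=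
  fun g => `[< exists ghat, extends g ghat >].

Fact in_Ared_submod_closed s : submod_closed (@in_Ared s).
Proof.
split.
  apply/asboolP; exists (fun=> 0); split=> // z; exists (fun=> 0).
  by split; near=> w => //; exact: differentiable_cst.
move=> a g h /asboolP[gh [holg extg]] /asboolP[hh [holh exth]]; apply/asboolP.
exists (fun x => a * gh x + hh x); split=> [z|rho]; last first.
  by rewrite -extg -exth.
have [F [dF eF]] := holg z; have [G [dG eG]] := holh z.
exists (fun w => a *: F w + G w); split.
- near=> w; apply: differentiableD; first by apply: differentiableZ; near: w.
  by near: w.
- near=> w.
  have -> : F (val w) = gh (\pi w) by near: w.
  by have -> : G (val w) = hh (\pi w) by near: w.
Unshelve. all: by end_near. Qed.

HB.instance Definition _ s :=
  GRing.isSubmodClosed.Build C (Mred s -> C) (@in_Ared s) (@in_Ared_submod_closed s).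

Record Ared (s : nat) := MkAred {
  fun_of_Ared :> Mred s -> C;
  Ared_prop : fun_of_Ared \in @in_Ared s }.
HB.instance Definition _ s := [isSub for @fun_of_Ared s].
HB.instance Definition _ s := [Choice of Ared s by <:].
HB.instance Definition _ s := [SubChoice_isSubLmodule of Ared s by <:].

(* The holomorphic function extending g is unique, so the choice made here
   plays no role. *)
Definition extension (s : nat) (g : Ared s) : {family compact, Mhat s -> C} :=
  projT1 (cid (asboolP _ (Ared_prop g))).

(* If ghat extends g then z |-> (ghat (swap_conj z))^* extends the pointwise
   conjugate of g. *)
Definition swap_conj (z : V * V) : V * V := (conjV z.2, conjV z.1).

Fact norm_conjV (v : V) : `|conjV v| = `|v|.
Proof.
rewrite /Num.norm /= !mx_normE; congr (_%:num); apply: eq_bigr => i _.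
by apply/eqP; rewrite -num_eq /= mxE norm_conjC.
Qed.

Fact norm_swap_conj z : `|swap_conj z| = `|z|.
Proof.
rewrite !prod_normE /= !norm_conjV; apply: comparable_maxC.
by apply: real_comparable; rewrite normr_real.
Qed.

Fact swap_conj_linear (a : C) (x y : V * V) :
  swap_conj (a *: x + y) = a^* *: swap_conj x + swap_conj y.
Proof.
by rewrite /swap_conj; congr pair; apply/matrixP => i j; rewrite !mxE rmorphD rmorphM.
Qed.

Fact swap_conjK : involutive swap_conj.
Proof. by case=> x y; congr pair; apply/matrixP => i j; rewrite !mxE conjCK. Qed.

Fact swap_conj_continuous : continuous swap_conj.
Proof.
move=> z; apply/cvgrPdist_lt => e e0; near=> w.
have -> : swap_conj z - swap_conj w = swap_conj (z - w).
  by congr pair; apply/matrixP => i j; rewrite !mxE rmorphB.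
rewrite norm_swap_conj; near: w.
by apply: (@cvgr_dist_lt _ _ _ (nbhs z) _ id z) => //; exact: cvg_id.
Unshelve. all: by end_near. Qed.

Fact differentiable_conj (F : V * V -> C) (w : V * V) :
  differentiable F (swap_conj w) ->
  differentiable (fun v => (F (swap_conj v))^* : C) w.
Proof.
move=> dF; have /diff_locallyP[dFc dFo] := dF.
pose L (h : V * V) : C := ('d F (swap_conj w) (swap_conj h))^*.
have Llin : linear L.
  by move=> a x y; rewrite /L swap_conj_linear linearP rmorphD rmorphM /= conjCK.
pose LL := GRing.isLinear.Build _ _ _ _ L Llin.
pose df : {linear (V * V)%type -> C} := HB.pack L LL.
have dfc : continuous df.
  have gc : continuous (fun h => 'd F (swap_conj w) (swap_conj h)).
    move=> z; apply: (@continuous_comp _ _ _ swap_conj ('d F (swap_conj w))).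
      exact: swap_conj_continuous.
    exact: dFc.
  move=> z; apply/cvgrPdist_lt => e e0.
  have /cvgrPdist_lt/(_ e e0) := gc z.
  by apply: filterS => y; rewrite /= /L -rmorphB norm_conjC.
pose G : V * V -> C := fun v => (F (swap_conj v))^*.
apply/diff_locallyP; rewrite -/G.
suff dfo : forall dG : {linear (V * V)%type -> C}, dG = df :> (V * V -> C) ->
    G \o shift w = cst (G w) + dG +o_ (0 : V * V) id.
  have Gdf := diff_unique dfc (dfo df erefl).
  split; last exact: (dfo _ Gdf).
  by rewrite Gdf; exact: dfc.
move=> dG ->.
apply/eqaddoP => e e0.
have /eqaddoP/(_ _ e0) := dFo.
have s0 : swap_conj (0 : V * V) = 0.
  by apply/eqP; rewrite -normr_eq0 norm_swap_conj normr0.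
have c0 : swap_conj z @[z --> (0 : V * V)] --> (0 : V * V).
  by have := @swap_conj_continuous (0 : V * V); rewrite /continuous_at s0.
move=> H; have {H} := c0 _ H; rewrite nearE !nbhs_simpl => H.
apply: (@filterS _ (nbhs (0 : V * V)) _ _ _ _ H) => h /=.
rewrite norm_swap_conj -[X in X <= _ -> _]norm_conjC.
congr (is_true (`|_| <= _)).
rewrite -[LHS]/((_ - (_ + _))^*) -[RHS]/(_ - (_ + _)) rmorphB rmorphD.
rewrite /G /=; congr (_ ^* - _); congr F.
by congr pair; apply/matrixP => i j; rewrite !mxE rmorphD.
Qed.

Fact swap_conj_Zhat s (z : Zhat s) : swap_conj (val z) \in Zhat s.
Proof.
apply/mem_set; rewrite /Zhat /Jhat /=.
have := congr1 Num.conj (set_mem (valP z)); rewrite rmorph1 /Jhat rmorph_sum /=; apply: etrans.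
apply: eq_bigr => k _; rewrite !mxE !rmorphM /=; congr (_ * _); last exact: mulrC.
by rewrite /nu; case: ifP => _; rewrite ?rmorphN ?rmorph1.
Qed.

Definition swap_conjZ s (z : Zhat s) : Zhat s :=
  exist _ (swap_conj (val z)) (swap_conj_Zhat z).

Fact swap_conjZ_continuous s : continuous (@swap_conjZ s).
Proof.
apply: continuous_comp_initial => z.
apply: (@continuous_comp (Zhat s) (V * V)%type (V * V)%type set_val swap_conj).
  exact: initial_continuous.
exact: swap_conj_continuous.
Qed.

Fact pi_MhatP s (x y : Zhat s) :
  (\pi_(Mhat s) x = \pi_(Mhat s) y) <-> Cstar_rel x y.
Proof.
have E : \pi_({eq_quot @Cstar_rel s}) x = \pi y <-> Cstar_rel x y.
  by split=> /eqmodP.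
exact: E.
Qed.

Fact pi_swap_conjZ s (x y : Zhat s) : \pi_(Mhat s) x = \pi_(Mhat s) y ->
  \pi_(Mhat s) (swap_conjZ x) = \pi_(Mhat s) (swap_conjZ y).
Proof.
move=> /pi_MhatP/asboolP[a a0 e]; apply/pi_MhatP/asboolP.
exists (a^-1)^*; first by rewrite conjC_eq0 invr_eq0.
have -> : val (swap_conjZ y) = swap_conj (val y) by [].
have -> : val (swap_conjZ x) = swap_conj (val x) by [].
rewrite e; congr pair; apply/matrixP => i j; rewrite !mxE rmorphM//.
by rewrite -fmorphV invrK.
Qed.

Definition hat_conj s (f : Mhat s -> C) : Mhat s -> C :=
  fun x => (f (\pi_(Mhat s) (swap_conjZ (repr x))))^*.

Fact near_swap_conj (z : V * V) (P : set (V * V)) :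
  nbhs (swap_conj z) P -> nbhs z (P \o swap_conj).
Proof. exact: swap_conj_continuous. Qed.

Fact near_swap_conjZ s (z : Zhat s) (P : set (Zhat s)) :
  nbhs (swap_conjZ z) P -> nbhs z (P \o @swap_conjZ s).
Proof. exact: swap_conjZ_continuous. Qed.

Fact hat_conjE s (f : Mhat s -> C) (z : Zhat s) :
  hat_conj f (\pi_(Mhat s) z) = (f (\pi_(Mhat s) (swap_conjZ z)))^*.
Proof. by congr ((f _)^* ); exact: (pi_swap_conjZ (reprK _)). Qed.

Fact antidiag_fixed s (rho : Z s) : swap_conjZ (antidiag rho) = antidiag rho.
Proof.
apply/val_inj; rewrite [LHS]/= /swap_conj; congr pair.
by apply/matrixP=> i j; rewrite !mxE conjCK.
Qed.

Fact holomorphic_conj s (f : Mhat s -> C) : holomorphic f -> holomorphic (hat_conj f).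
Proof.
move=> holf z; have [F [dF eF]] := holf (swap_conjZ z).
exists (fun v => (F (swap_conj v))^* ); split.
  apply: filterS (near_swap_conj dF) => w; exact: differentiable_conj.
apply: filterS (near_swap_conjZ eF) => w Fw; rewrite hat_conjE -[RHS]/((f _)^* ).
by rewrite -Fw.
Qed.

Fact conj_in_Ared s (g : Ared s) : (fun x => (g x)^* : C) \in @in_Ared s.
Proof.
have /asboolP[gh [holg extg]] := Ared_prop g; apply/asboolP.
exists (hat_conj gh); split; first exact: holomorphic_conj.
by move=> rho; rewrite extg hat_conjE antidiag_fixed.
Qed.

Definition conjA s (g : Ared s) : Ared s := MkAred (conj_in_Ared g).
(* Mhat s is locally compact, so locally uniform convergence of the extensions
   is their convergence in {family compact, Mhat s -> C}. *)
HB.instance Definition _ s :=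
  Topological.copy (Ared s) (initial_topology (@extension s)).

Definition mdeg (P : 'I_2 -> nat) : nat := (\sum_(k < 2) P k)%N.

Definition monomial (P Q : 'I_2 -> nat) (z : V * V) : C :=
  (\prod_(k < 2) z.1 0 k ^+ P k) * (\prod_(k < 2) z.2 0 k ^+ Q k).

Fact monomial_Cstar P Q (a : C) (z : V * V) : mdeg P = mdeg Q -> a != 0 ->
  monomial P Q (a *: z.1, a^-1 *: z.2) = monomial P Q z.
Proof.
move=> e a0; rewrite /monomial.
under eq_bigr do rewrite !mxE !exprMn.
under [X in _ * X]eq_bigr do rewrite !mxE !exprMn.
rewrite !big_split /= !prodrXr -/(mdeg P) -/(mdeg Q) e exprVn.
by rewrite mulrACA mulfV ?mul1r// expf_neq0.
Qed.

Fact differentiable_monomial P Q (z : V * V) : differentiable (monomial P Q) z.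
Proof.
have d1 k : differentiable (fun z : V * V => z.1 0 k : C) z.
  apply: (@differentiable_comp _ _ _ _ fst (fun v : V => v 0 k : C)).
    by apply: linear_differentiable => x; exact: cvg_fst.
  exact: differentiable_coord.
have d2 k : differentiable (fun z : V * V => z.2 0 k : C) z.
  apply: (@differentiable_comp _ _ _ _ snd (fun v : V => v 0 k : C)).
    by apply: linear_differentiable => x; exact: cvg_snd.
  exact: differentiable_coord.
have -> : monomial P Q = (fun z : V * V =>
    (z.1 0 ord0 ^+ P ord0 * z.1 0 (lift ord0 ord0) ^+ P (lift ord0 ord0)) *
    (z.2 0 ord0 ^+ Q ord0 * z.2 0 (lift ord0 ord0) ^+ Q (lift ord0 ord0))).
  by apply/funext => w; rewrite /monomial !big_ord_recl !big_ord0 !mulr1.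
have dX f n : differentiable (f : V * V -> C) z -> differentiable (fun w => f w ^+ n) z.
  move=> df; elim: n => [|n IH]; first exact: differentiable_cst.
  under eq_fun do rewrite exprS.
  exact: differentiableM.
by apply: differentiableM; apply: differentiableM; exact: dX.
Qed.

Definition bred_hat s (P Q : 'I_2 -> nat) : Mhat s -> C :=
  fun x => monomial P Q (val (repr x)).

Fact bred_hat_pi s P Q (z : Zhat s) : mdeg P = mdeg Q ->
  bred_hat P Q (\pi_(Mhat s) z) = monomial P Q (val z).
Proof.
move=> e; have /esym/pi_MhatP/asboolP[a a0 E] := reprK (\pi_(Mhat s) z).
by rewrite -[LHS]/(monomial P Q (val (repr (\pi_(Mhat s) z)))) E monomial_Cstar.
Qed.

Fact holomorphic_bred_hat s P Q : mdeg P = mdeg Q -> holomorphic (@bred_hat s P Q).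
Proof.
move=> e z; exists (monomial P Q); split.
  by apply: filterE => w; exact: differentiable_monomial.
by apply: filterE => w; rewrite bred_hat_pi.
Qed.

Fact pi_MredP s (x y : Z s) :
  (\pi_(Mred s) x = \pi_(Mred s) y) <-> U1_rel x y.
Proof. by split=> /eqmodP. Qed.

Fact pi_antidiag s (x y : Z s) : \pi_(Mred s) x = \pi_(Mred s) y ->
  \pi_(Mhat s) (antidiag x) = \pi_(Mhat s) (antidiag y).
Proof.
move=> /pi_MredP/asboolP[u u1 e]; apply/pi_MhatP/asboolP; exists u.
  by rewrite -normr_eq0 u1 oner_eq0.
have -> : val (antidiag y) = (val y, conjV (val y)) by [].
have -> : val (antidiag x) = (val x, conjV (val x)) by [].
rewrite e; congr pair; apply/matrixP => i j; rewrite !mxE rmorphM /=.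
by rewrite [u^-1]invC_norm u1 expr1n invr1 mul1r.
Qed.

(* Independent of the representative only when mdeg P = mdeg Q, see bred_fun_pi. *)
Definition bred_fun s (P Q : 'I_2 -> nat) : Mred s -> C :=
  fun x => monomial P Q (val (repr x), conjV (val (repr x))).

Fact bred_fun_bred_hat s P Q (rho : Z s) : mdeg P = mdeg Q ->
  bred_fun P Q (\pi_(Mred s) rho) = bred_hat P Q (\pi_(Mhat s) (antidiag rho)).
Proof. by move=> e; rewrite -(pi_antidiag (reprK _)) bred_hat_pi. Qed.

Fact bred_fun_pi s P Q (rho : Z s) : mdeg P = mdeg Q ->
  bred_fun P Q (\pi_(Mred s) rho) = monomial P Q (val rho, conjV (val rho)).
Proof. by move=> e; rewrite bred_fun_bred_hat// bred_hat_pi. Qed.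

Fact bred_fun_in_Ared s P Q : mdeg P = mdeg Q -> @bred_fun s P Q \in @in_Ared s.
Proof.
move=> e; apply/asboolP; exists (bred_hat P Q); split; first exact: holomorphic_bred_hat.
by move=> rho; exact: bred_fun_bred_hat.
Qed.

Definition bred s P Q (e : mdeg P = mdeg Q) : Ared s := MkAred (bred_fun_in_Ared s e).

Definition falling (x : C) (m : nat) : C := \prod_(j < m) (x - j%:R).

Definition sgn s (T : 'I_2 -> nat) : C := \prod_(k < 2) nu s k ^+ T k.

Definition mfact (T : 'I_2 -> nat) : nat := (\prod_(k < 2) (T k)`!)%N.

Definition mbin (Q T : 'I_2 -> nat) : nat := (\prod_(k < 2) 'C(Q k, T k))%N.

Definition star_coef s (hbar : C) (Q R' T : 'I_2 -> nat) : C :=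
  sgn s T
  * (falling hbar^-1 (mdeg (fun k => Q k + R' k - T k)%N)
     / (falling hbar^-1 (mdeg Q) * falling hbar^-1 (mdeg R')))
  * (mfact T * mbin Q T * mbin R' T)%N%:R.

(* The continuous bilinear product with the given structure constants; since
   the bred span a dense subspace there is at most one. *)
Definition is_star s (hbar : C) (star : Ared s -> Ared s -> Ared s) : Prop :=
  [/\ forall f, linear (star f),
      forall g, linear (star ^~ g),
      continuous (fun p : Ared s * Ared s => star p.1 p.2) &
      forall (P Q R' S : 'I_2 -> nat)
        (ePQ : mdeg P = mdeg Q) (eRS : mdeg R' = mdeg S) (x : Mred s),
        star (bred s ePQ) (bred s eRS) x =
        \sum_(T : {dffun forall k : 'I_2, 'I_(minn (Q k) (R' k)).+1})
          star_coef s hbar Q R' (fun k => T k) *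
          bred_fun (fun k => P k + R' k - T k)%N (fun k => Q k + S k - T k)%N x].

(* On C the order x <= y means that y - x is real and nonnegative. *)
Definition is_positive s (star : Ared s -> Ared s -> Ared s) (phi : Ared s -> C) : Prop :=
  forall f : Ared s, 0 <= phi (star (conjA f) f).

Definition delta s (p : Mred s) : Ared s -> C := fun f => f p.

Definition star_isomorphic s t (star_s : Ared s -> Ared s -> Ared s)
    (star_t : Ared t -> Ared t -> Ared t) : Prop :=
  exists Phi : Ared s -> Ared t,
    [/\ linear Phi, bijective Phi,
        forall f g, Phi (star_s f g) = star_t (Phi f) (Phi g) &
        forall f, Phi (conjA f) = conjA (Phi f)].
End Spaces.

(* Main.v *)
(* Put x = 1/hbar, which lies in ]-1, 0[, so that (-1)^m (x)_m > 0 for the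
   falling factorials (x)_m.

   Signature 2: with b_kl = rho_k conj(rho_l), the sum of conj(b_kl) * b_kl over
   all k, l is (1 + hbar) times the unit.  As 1 + hbar < 0, a positive functional
   is zero at the unit, hence everywhere by the Cauchy-Schwarz argument.

   Signature 1: evaluate conj(f) * g at (a, b), where |a|^2 - |b|^2 = 1, for
   monomials f, g.  A generating function and the Vandermonde identity for
   falling factorials diagonalise the resulting kernel as
   sum_s (-1)^s s!/(x)_s conj(v_s(f)) v_s(g), where v_s is read off the
   coefficients of (a + b T)^(m-s) (conj b + conj a T)^s; all weights are
   nonnegative.

   Passing from polynomials to the whole algebra rests on their density.  A
   holomorphic function on the complexified space is a gauge-invariant function
   on the quadric a c + nu b d = 1.  There w = nu b d is invariant under the
   torus (a, t b, c, d / t), and the function expands in a Laurent series in t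
   whose coefficients are entire in w, with uniform remainders given by Cauchy's
   theorem; the points where b c or a d vanish are reached by continuity.

   An isomorphism would carry an evaluation functional of signature 1 to a
   nonzero positive functional of signature 2. *)
Require Import Defs.
From HB Require Import structures.
From mathcomp Require Import all_boot all_order all_algebra.
From mathcomp Require Import complex generic_quotient ring lra zify.
From mathcomp Require Import all_classical all_reals all_analysis.

Set Implicit Arguments.
Unset Strict Implicit.
Unset Printing Implicit Defensive.

Import Order.TTheory GRing.Theory Num.Theory.
Import numFieldNormedType.Exports.
Local Open Scope classical_set_scope.
Local Open Scope quotient_scope.
Local Open Scope ring_scope.

(** The formula for the product covers monomials only; even that the unit acts as a unit has to be
    extended from them, so density serves both signatures. Cauchy theory is set up in the
    logarithmic coordinate: composed with [cexp], a function on the punctured plane becomes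
    periodic, circles become vertical segments, and Goursat's theorem on rectangles of height [2 pi]
    shows that circle means do not depend on the radius. Two normal forms of a gauge orbit are
    needed. In the coordinate t = b c alone, the negative Laurent terms carry inverse powers of b c,
    unbounded near b c = 0; expressed through a d they carry positive powers, bounded wherever the
    four products of coordinates are. The same tools prove that a holomorphic extension is unique,
    which is what makes the topology of the algebra computable: for 0 < s < 1 and w = nu s, the
    points (a, b, conj a, conj b) already cover a whole circle in t. *)

Lemma exists_exp2_gt (R : realType) (x : R) : exists k, x < 2 ^+ k.
Proof.
exists (Num.bound `|x|).
rewrite (le_lt_trans (ler_norm x))// (lt_le_trans (archi_boundP (normr_ge0 x)))//.
by rewrite -natrX ler_nat ltnW// ltn_expl.
Qed.

(** * Moduli and limits of complex numbers *)

Section Modulus.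
Import Normc.
Context {R : realType}.
Local Notation C := (Cplx R).

(** The norm of a complex number is itself an element of [C]. Estimates are carried out with its
    real value [cmod], and limits are reduced to real ones through [cre] and [cim]. *)
Definition mkC (a b : R) : C := (a +i* b)%C.
Definition rc (x : R) : C := (x%:C)%C.
Definition cre (z : C) : R := complex.Re (z : R[i]).
Definition cim (z : C) : R := complex.Im (z : R[i]).
Definition cmod (z : C) : R := normc (z : R[i]).

Lemma rcD : {morph rc : x y / x + y}. Proof. exact: (rmorphD (real_complex R)). Qed.
Lemma rcB : {morph rc : x y / x - y}. Proof. exact: (rmorphB (real_complex R)). Qed.
Lemma rcN : {morph rc : x / - x}. Proof. exact: (rmorphN (real_complex R)). Qed.
Lemma rcM : {morph rc : x y / x * y}. Proof. exact: (rmorphM (real_complex R)). Qed.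
Lemma rcX n : {morph rc : x / x ^+ n}. Proof. exact: (rmorphXn (real_complex R)). Qed.
Lemma rcV : {morph rc : x / x^-1}. Proof. exact: (fmorphV (real_complex R)). Qed.
Lemma rc1 : rc 1 = 1. Proof. by []. Qed.
Lemma rc0 : rc 0 = 0. Proof. by []. Qed.
Lemma rc_nat n : rc n%:R = n%:R. Proof. exact: (rmorph_nat (real_complex R)). Qed.

Lemma rc_inj : injective rc. Proof. by move=> x y []. Qed.
Lemma rc_lt x y : (rc x < rc y) = (x < y). Proof. exact: ltcR. Qed.

Lemma normE (z : C) : `|z| = rc (cmod z). Proof. by []. Qed.
Lemma cmodE (z : C) : cmod z = Num.sqrt (cre z ^+ 2 + cim z ^+ 2).
Proof. by case: z. Qed.
Lemma cmod_ge0 z : 0 <= cmod z. Proof. by rewrite cmodE sqrtr_ge0. Qed.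
Lemma cmod0 : cmod 0 = 0. Proof. exact: normc0. Qed.
Lemma cmod1 : cmod 1 = 1. Proof. exact: normc1. Qed.
Lemma cmodM (x y : C) : cmod (x * y) = cmod x * cmod y. Proof. exact: normcM. Qed.
Lemma cmodV (x : C) : cmod x^-1 = (cmod x)^-1. Proof. exact: normcV. Qed.
Lemma cmodN z : cmod (- z) = cmod z. Proof. exact: normcN. Qed.
Lemma cmodD x y : cmod (x + y) <= cmod x + cmod y. Proof. exact: le_normcD. Qed.
Lemma cmodB x y : cmod (x - y) <= cmod x + cmod y.
Proof. by rewrite (le_trans (cmodD _ _))// cmodN. Qed.
Lemma cmodBC x y : cmod (x - y) = cmod (y - x).
Proof. by rewrite -cmodN opprB. Qed.
Lemma cmodX n : {morph cmod : x / x ^+ n}.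
Proof. by elim: n => [|n IH] x; rewrite ?expr0 ?cmod1// !exprS cmodM IH. Qed.
Lemma cmod_eq0 z : (cmod z == 0) = (z == 0).
Proof. by apply/eqP/eqP => [/eq0_normc//|->]; exact: cmod0. Qed.
Lemma cmod_gt0 z : (0 < cmod z) = (z != 0).
Proof. by rewrite lt_def cmod_eq0 cmod_ge0 andbT. Qed.
Lemma cmod_rc x : cmod (rc x) = `|x|.
Proof. by rewrite cmodE /= expr0n addr0 sqrtr_sqr. Qed.
Lemma cmod_nat n : cmod n%:R = n%:R.
Proof. by rewrite -rc_nat cmod_rc normr_nat. Qed.

Lemma creD : {morph cre : x y / x + y}. Proof. by move=> [a b] [c d]. Qed.
Lemma cimD : {morph cim : x y / x + y}. Proof. by move=> [a b] [c d]. Qed.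
Lemma creB : {morph cre : x y / x - y}. Proof. by move=> [a b] [c d]. Qed.
Lemma cimB : {morph cim : x y / x - y}. Proof. by move=> [a b] [c d]. Qed.
Lemma creM x y : cre (x * y) = cre x * cre y - cim x * cim y.
Proof. by case: x y => [a b] [c d]. Qed.
Lemma cimM x y : cim (x * y) = cre x * cim y + cim x * cre y.
Proof. by case: x y => [a b] [c d]. Qed.
Lemma creMrc z x : cre (z * rc x) = cre z * x.
Proof. by rewrite creM /= mulr0 subr0. Qed.
Lemma cimMrc z x : cim (z * rc x) = cim z * x.
Proof. by rewrite cimM /= mulr0 add0r. Qed.
Lemma mkC_eta z : mkC (cre z) (cim z) = z. Proof. by case: z. Qed.
Lemma creimP (x y : C) : cre x = cre y -> cim x = cim y -> x = y.
Proof. by case: x y => [a b] [c d] /= -> ->. Qed.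

Lemma cre_le z : `|cre z| <= cmod z.
Proof.
rewrite cmodE -sqrtr_sqr ler_wsqrtr// lerDl; exact: sqr_ge0.
Qed.
Lemma cim_le z : `|cim z| <= cmod z.
Proof.
rewrite cmodE -sqrtr_sqr ler_wsqrtr// lerDr; exact: sqr_ge0.
Qed.
Lemma cmod_le z : cmod z <= `|cre z| + `|cim z|.
Proof.
rewrite cmodE -[leRHS]ger0_norm ?addr_ge0// -sqrtr_sqr ler_wsqrtr//.
rewrite sqrrD !real_normK ?num_real// lerD2r lerDl.
by rewrite mulrn_wge0// mulr_ge0.
Qed.

Lemma rc_gt0P (e : C) : 0 < e -> exists2 d : R, 0 < d & e = rc d.
Proof.
case: e => a b; rewrite ltcE /= => /andP[/eqP -> a0]; exists a => //.
Qed.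

Lemma nearCP (z : C) (P : set C) :
  (\forall w \near z, P w) <->
  exists2 d : R, 0 < d & forall w, cmod (w - z) < d -> P w.
Proof.
split.
  move=> /nbhs_ballP[e /= /rc_gt0P[d d0 ->]] H; exists d => // w wz.
  by apply: H; rewrite /ball /= normE rc_lt cmodBC.
move=> [d d0 H]; apply/nbhs_ballP; exists (rc d) => /=; first by rewrite -rc0 rc_lt.
by move=> w; rewrite /ball /= normE rc_lt cmodBC; exact: H.
Qed.

Lemma nearRP (z : R) (P : set R) :
  (\forall w \near z, P w) <->
  exists2 d : R, 0 < d & forall w, `|w - z| < d -> P w.
Proof.
split.
  move=> /nbhs_ballP[d /= d0] H; exists d => // w wz.
  by apply: H; rewrite /ball /= distrC.
move=> [d d0 H]; apply/nbhs_ballP; exists d => //= w.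
by rewrite /ball /= distrC; exact: H.
Qed.

Lemma cvgCP (T : Type) (F : set_system T) (FF : Filter F) (f : T -> C) (l : C) :
  f @ F --> l <-> forall e : R, 0 < e -> \forall x \near F, cmod (f x - l) < e.
Proof.
split.
  move=> /cvgrPdist_lt H e e0.
  have /H : 0 < rc e by rewrite -rc0 rc_lt.
  by apply: filterS => x /=; rewrite normE rc_lt cmodBC.
move=> H; apply/cvgrPdist_lt => e /rc_gt0P[d d0 ->].
by have := H _ d0; apply: filterS => x /=; rewrite normE rc_lt cmodBC.
Qed.

Lemma cre_cvg (T : Type) (F : set_system T) (FF : Filter F) (f : T -> C) (l : C) :
  f @ F --> l -> cre (f x) @[x --> F] --> cre l.
Proof.
move=> /cvgCP H; apply/cvgrPdist_lt => e /H; apply: filterS => x.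
by rewrite -creB; apply: le_lt_trans; rewrite cmodBC cre_le.
Qed.
Lemma cim_cvg (T : Type) (F : set_system T) (FF : Filter F) (f : T -> C) (l : C) :
  f @ F --> l -> cim (f x) @[x --> F] --> cim l.
Proof.
move=> /cvgCP H; apply/cvgrPdist_lt => e /H; apply: filterS => x.
by rewrite -cimB; apply: le_lt_trans; rewrite cmodBC cim_le.
Qed.

Lemma mkC_cvg (T : Type) (F : set_system T) (FF : Filter F) (f g : T -> R) (a b : R) :
  f @ F --> a -> g @ F --> b -> mkC (f x) (g x) @[x --> F] --> mkC a b.
Proof.
move=> /cvgrPdist_lt fa /cvgrPdist_lt gb; apply/cvgCP => e e0.
have e2 : 0 < e / 2 by rewrite divr_gt0.
near=> x; rewrite (le_lt_trans (cmod_le _))// creB cimB /= (splitr e) ltrD//.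
  by rewrite distrC; near: x; exact: fa.
by rewrite distrC; near: x; exact: gb.
Unshelve. all: by end_near. Qed.

(** The non-strict bound holds at [w = z] too, so no punctured neighbourhood is involved. This form
    feeds Goursat's theorem and transfers between functions that agree near a point. *)
Lemma diffCP (h : C -> C) (z : C) : differentiable h z <->
  exists l : C, forall e : R, 0 < e -> \forall w \near z,
    cmod (h w - h z - l * (w - z)) <= e * cmod (w - z).
Proof.
split.
  move=> /derivable1_diffP dh.
  exists ('D_1 h z) => e e0.
  have := dh; rewrite /derivable => /cvgCP/(_ e e0) H.
  have {}H : \forall w \near (0 : C), w != 0 -> cmod (w^-1 *: (h (w + z) - h z) - 'D_1 h z) < e.
    move: H; rewrite near_withinE; apply: filterS => x xx /xx /=.
    by rewrite [x *: 1]mulr1.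
  have [d d0 {}H] := (nearCP _ _).1 H.
  apply/nearCP; exists d => // w wz.
  have [->|nwz] := eqVneq w z; first by rewrite !subrr mulr0 subrr cmod0 mulr0.
  have wz0 : w - z != 0 by rewrite subr_eq0.
  have := H (w - z); rewrite subr0 subrK => /(_ wz wz0) /ltW.
  have p0 : 0 < cmod (w - z) by rewrite cmod_gt0.
  move=> /(ler_wpM2r (ltW p0)) /=; rewrite -cmodM mulrBl.
  by rewrite -[_ *: _]/(_ * _) mulrAC mulVf// mul1r.
move=> [l H]; apply/derivable1_diffP; apply/cvg_ex; exists l; apply/cvgCP => e e0.
rewrite near_withinE.
have e2 : 0 < e / 2 by rewrite divr_gt0.
have [d d0 {}H] := (nearCP _ _).1 (H _ e2).
apply/nearCP; exists d => // w; rewrite subr0 => wd w0 /=.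
have := H (w + z); rewrite addrK => /(_ wd) H1.
rewrite [w *: 1]mulr1 -[_ *: _]/(_ * _).
have -> : w^-1 * (h (w + z) - h z) - l = w^-1 * (h (w + z) - h z - l * w).
  by rewrite [RHS]mulrBr [w^-1 * (l * w)]mulrC mulfK.
have p0 : 0 < cmod w by rewrite cmod_gt0.
rewrite cmodM cmodV mulrC ltr_pdivrMr// (le_lt_trans H1)// ltr_pM2r//.
by rewrite ltr_pdivrMr// mulr_natr mulr2n ltrDl.
Qed.

End Modulus.

(** * Integrals along segments *)

Section RealIntegral.
Context {R : realType}.
Local Notation mu := (@lebesgue_measure R).

Lemma primitive_unique (g F G : R -> R) :
  (forall x : R, is_derive x (1 : R) F (g x)) -> (forall x : R, is_derive x (1 : R) G (g x)) ->
  forall a b, F b - F a = G b - G a.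
Proof.
move=> dF dG.
have dH (x : R) : is_derive x (1 : R) (F - G) (cst 0 x).
  by apply: (is_derive_eq (is_deriveB (dF x) (dG x))); rewrite subrr.
have key a b : a <= b -> F b - F a = G b - G a.
  move=> ab.
  have cH : {within `[a, b], continuous (F - G)}.
    apply: continuous_subspaceT => x; apply: differentiable_continuous.
    by apply/derivable1_diffP; case: (dH x).
  have [c _] := MVT_segment ab (fun x _ => dH x) cH.
  by rewrite /= mul0r !fctE; lra.
move=> a b. have [/key//|/ltW/key] := leP a b. lra.
Qed.

Lemma primitive_exists (g : R -> R) : continuous g ->
  exists G, forall x : R, is_derive x (1 : R) G (g x).
Proof.
move=> cg.
have ig a b : mu.-integrable `[a, b] (EFin \o g).
  apply: continuous_compact_integrable; first exact: segment_compact.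
  exact: continuous_subspaceT.
have igo a b : mu.-integrable `]a, b] (EFin \o g).
  by apply: integrableS (ig a b) => //; exact: subset_itv_oc_cc.
pose G (x : R) : R := if 0 <= x then (\int[mu]_(t in `[0, x]) g t)%R
            else - (\int[mu]_(t in `[x, 0]) g t)%R.
exists G => x.
(* The point [- m] lies to the left of 0 and of [x]. Near [x], therefore, [G] differs by a constant
   from the integral with fixed lower end [- m], to which the fundamental theorem applies. *)
pose m : R := `|x| + 1.
have xm : - m < x by rewrite /m; have := ler_norm (- x); rewrite normrN; lra.
have m0 : - m <= 0 by rewrite /m; have := normr_ge0 x; lra.
pose F (y : R) : R := (\int[mu]_(t in `[- m, y]) g t)%R.
have [dF F'] : derivable F x (1 : R) /\ (F^`())%classic x = g x.
  apply: (@continuous_FTC1_closed _ _ _ _ (x + 1)) => //; last exact: cg.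
  by rewrite ltrDl.
have GF : \forall y \near x, F y - F 0 = G y.
  near=> y.
  have ym : - m < y by near: y; exact: lt_nbhsr.
  rewrite /G; case: ifPn => y0.
    have := @Rintegral_itvB R g (BLeft (- m)) (BRight y) 0.
    rewrite /F => ->//.
    by rewrite Rintegral_itv_obnd_cbnd//; exact: igo.
  rewrite -ltNge in y0.
  have := @Rintegral_itvB R g (BLeft (- m)) (BRight 0) y.
  rewrite /F => E; rewrite -opprB E//; rewrite ?bnd_simp ?ltW//.
  by rewrite Rintegral_itv_obnd_cbnd//; exact: igo.
have D : is_derive x (1 : R) F (g x).
  by apply: DeriveDef; [exact: dF|rewrite -derive1E].
have D' : is_derive x (1 : R) (F - cst (F 0)) (g x).
  by have := is_deriveB D (is_derive_cst (F 0) x (1 : R)); rewrite subr0.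
by apply: near_eq_is_derive D'.
Unshelve. all: by end_near. Qed.

(* Only continuous integrands occur, so that increments of primitives do for
   integrals; rprim is the junk value 0 when there is no primitive. *)
Definition primitive_of (g : R -> R) : set (R -> R) :=
  [set G | forall x : R, is_derive x (1 : R) G (g x)].
Definition rprim (g : R -> R) : R -> R :=
  xget (fun=> 0) (primitive_of g).
Definition rint (g : R -> R) (a b : R) : R := rprim g b - rprim g a.

Lemma rprimP g : continuous g -> forall x : R, is_derive x (1 : R) (rprim g) (g x).
Proof.
move=> /primitive_exists [G GP].
exact: (@xgetPex _ (fun=> 0) (primitive_of g) (ex_intro _ G GP)).
Qed.

Lemma rintE g G a b : (forall x : R, is_derive x (1 : R) G (g x)) -> rint g a b = G b - G a.
Proof.
move=> dG; apply: (primitive_unique _ dG).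
exact: (@xgetPex _ (fun=> 0) (primitive_of g) (ex_intro _ G dG)).
Qed.

Lemma rint_chasles g a b c : rint g a b + rint g b c = rint g a c.
Proof. by rewrite /rint; ring. Qed.

Lemma rintD (f g : R -> R) (a b : R) : continuous f -> continuous g ->
  rint (fun x => f x + g x) a b = rint f a b + rint g a b.
Proof.
move=> cf cg; have D (x : R) : is_derive x (1 : R) (rprim f + rprim g) (f x + g x).
  by apply: is_deriveD; exact: rprimP.
by rewrite (rintE a b D) /rint !fctE; ring.
Qed.

Lemma rintZ (k : R) (f : R -> R) (a b : R) : continuous f ->
  rint (fun x => k * f x) a b = k * rint f a b.
Proof.
move=> cf; have D (x : R) : is_derive x (1 : R) (k \*: rprim f) (k * f x).
  by apply: is_deriveZ; exact: rprimP.
by rewrite (rintE a b D) /rint -mulrBr.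
Qed.

Lemma rint_le (f : R -> R) (M a b : R) : continuous f -> a <= b ->
  (forall x, a <= x <= b -> f x <= M) -> rint f a b <= M * (b - a).
Proof.
move=> cf ab fM.
have cF : {within `[a, b], continuous (rprim f)}.
  apply: continuous_subspaceT => x; apply: differentiable_continuous.
  by apply/derivable1_diffP; case: (rprimP cf x).
have [c] := MVT_segment ab (fun x _ => rprimP cf x) cF.
by rewrite in_itv /= => /fM fc; rewrite /rint => ->; rewrite ler_wpM2r// subr_ge0.
Qed.

Lemma rint_shift (f : R -> R) (a b c : R) : continuous f ->
  rint (fun x => f (x + c)) a b = rint f (a + c) (b + c).
Proof.
move=> cf; have D (x : R) : is_derive x (1 : R) (rprim f \o shift c) (f (x + c)).
  have := @is_derive1_comp R (rprim f) (shift c) x (f (x + c)) 1.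
  by rewrite mulr1; apply; [exact: rprimP|exact: is_derive_shift].
by rewrite (rintE a b D).
Qed.

End RealIntegral.

(** * Complex-valued integrals over real segments *)

Section ComplexIntegral.
Context {R : realType}.
Local Notation C := (Cplx R).
Implicit Types (phi psi : R -> C) (a b c : R).

Definition cint phi a b : C :=
  mkC (rint (fun x => cre (phi x)) a b) (rint (fun x => cim (phi x)) a b).

Lemma continuous_cre phi : continuous phi -> continuous (fun x => cre (phi x)).
Proof. by move=> cp x; apply: cre_cvg; exact: cp. Qed.
Lemma continuous_cim phi : continuous phi -> continuous (fun x => cim (phi x)).
Proof. by move=> cp x; apply: cim_cvg; exact: cp. Qed.

Lemma cint_chasles phi a b c : cint phi a b + cint phi b c = cint phi a c.
Proof. by apply: creimP; rewrite ?creD ?cimD /= rint_chasles. Qed.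

Lemma cintD phi psi a b : continuous phi -> continuous psi ->
  cint (fun x => phi x + psi x) a b = cint phi a b + cint psi a b.
Proof.
move=> cf cg; apply: creimP; rewrite ?creD ?cimD /=.
- under [X in rint X]eq_fun do rewrite creD.
  by apply: rintD; exact: continuous_cre.
- under [X in rint X]eq_fun do rewrite cimD.
  by apply: rintD; exact: continuous_cim.
Qed.

Lemma cintZ (k : C) phi a b : continuous phi ->
  cint (fun x => k * phi x) a b = k * cint phi a b.
Proof.
move=> cf.
have cr := continuous_cre cf; have ci := continuous_cim cf.
have cZ (r : R) (f : R -> R) : continuous f -> continuous (fun x => r * f x).
  by move=> cf' x; apply: cvgMr; exact: cf'.
apply: creimP; rewrite ?creM ?cimM /=.
- under [X in rint X]eq_fun do rewrite creM -mulNr.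
  by rewrite rintD ?rintZ ?mulNr//; exact: cZ.
- under [X in rint X]eq_fun do rewrite cimM.
  by rewrite rintD ?rintZ//; exact: cZ.
Qed.

Lemma cint_le phi (M : R) a b : continuous phi -> a <= b ->
  (forall x, a <= x <= b -> cmod (phi x) <= M) -> cmod (cint phi a b) <= M * (b - a).
Proof.
move=> cf ab fM; set I := cint phi a b.
have [I0|nI0] := eqVneq I 0.
  rewrite I0 cmod0 mulr_ge0 ?subr_ge0//.
  by rewrite (le_trans (cmod_ge0 (phi a)))// fM// lexx ab.
(* Multiplication by the unimodular [u] makes the integral real and nonnegative, so the bound for
   real integrands applies to the real part. *)
pose u : C := rc (cmod I) / I.
have u1 : cmod u = 1.
  by rewrite cmodM cmodV cmod_rc ger0_norm ?cmod_ge0// mulfV// cmod_eq0.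
have uI : u * I = rc (cmod I) by rewrite /u mulfVK.
have cuf : continuous (fun x => u * phi x).
  by move=> x; apply: cvgMr; exact: cf.
rewrite -[leLHS]/(cre (rc (cmod I))) -uI -cintZ// /=.
apply: rint_le => //; first exact: continuous_cre.
move=> x /fM xM; rewrite (le_trans (ler_norm _))// (le_trans (cre_le _))//.
by rewrite cmodM u1 mul1r.
Qed.

Lemma cint_shift phi a b c : continuous phi ->
  cint (fun x => phi (x + c)) a b = cint phi (a + c) (b + c).
Proof.
by move=> cf; apply: creimP; rewrite /= -rint_shift//;
  [exact: continuous_cre|exact: continuous_cim].
Qed.

Lemma rint_affine (p q : R) a b :
  rint (fun x => p + q * x) a b = p * (b - a) + q * ((b ^+ 2 - a ^+ 2) / 2).
Proof.
have D (x : R) : is_derive x (1 : R) (p \*: id + (q / 2) \*: (id * id)) (p + q * x).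
  have I := is_derive_id x (1 : R).
  apply: (is_derive_eq (is_deriveD (is_deriveZ p I) (is_deriveZ (q / 2) (is_deriveM I I)))).
  by rewrite -![_ *: _]/(_ * _) /=; field.
rewrite (rintE a b D) !fctE /= -![p *: _]/(_ * _) -![(q / 2) *: _]/(_ * _).
by field.
Qed.

Lemma cint_affine (p q : C) a b :
  cint (fun x => p + q * rc x) a b = p * rc (b - a) + q * rc ((b ^+ 2 - a ^+ 2) / 2).
Proof.
apply: creimP.
- rewrite creD !creMrc /= -rint_affine.
  by congr rint; apply/funext => x; rewrite creD creMrc.
- rewrite cimD !cimMrc /= -rint_affine.
  by congr rint; apply/funext => x; rewrite cimD cimMrc.
Qed.

End ComplexIntegral.

(** * Goursat's theorem on rectangles *)

Section Goursat.
Context {R : realType}.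
Local Notation C := (Cplx R).
Implicit Types (H G : C -> C) (a b c d : R).

Lemma continuous_hor H c : continuous H -> continuous (fun x : R => H (mkC x c)).
Proof.
move=> cH x; apply: (@continuous_comp _ _ _ (fun x : R => mkC x c) H); last exact: cH.
by apply: mkC_cvg; [exact: cvg_id|exact: cvg_cst].
Qed.

Lemma continuous_ver H a : continuous H -> continuous (fun y : R => H (mkC a y)).
Proof.
move=> cH x; apply: (@continuous_comp _ _ _ (fun x : R => mkC a x) H); last exact: cH.
by apply: mkC_cvg; [exact: cvg_cst|exact: cvg_id].
Qed.

(** The counterclockwise contour integral over the boundary of the rectangle; [mkC 0 1] is the
    direction of the vertical sides. *)
Definition crect H a b c d : C :=
  cint (fun x => H (mkC x c)) a b - cint (fun x => H (mkC x d)) a b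
  + mkC 0 1 * (cint (fun y => H (mkC b y)) c d - cint (fun y => H (mkC a y)) c d).

Lemma crect_splith H a m b c d : crect H a b c d = crect H a m c d + crect H m b c d.
Proof. by rewrite /crect -!(cint_chasles _ a m b); ring. Qed.

Lemma crect_splitv H a b c m d : crect H a b c d = crect H a b c m + crect H a b m d.
Proof. by rewrite /crect -!(cint_chasles _ c m d); ring. Qed.

Lemma continuous_affine (p q : C) : continuous (fun s : C => p + q * s).
Proof.
move=> z; apply: (@continuousD _ _ _ (cst p) ( *%R q) z); first exact: cst_continuous.
exact: mulrl_continuous.
Qed.

Lemma crectD H G a b c d : continuous H -> continuous G ->
  crect (fun s => H s + G s) a b c d = crect H a b c d + crect G a b c d.
Proof.
move=> cH cG; rewrite /crect !cintD; try exact: continuous_hor; try exact: continuous_ver.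
by ring.
Qed.

Lemma crect_affine (p q : C) a b c d : crect (fun s => p + q * s) a b c d = 0.
Proof.
have hor (y : R) : (fun x => p + q * mkC x y) = (fun x => (p + q * mkC 0 y) + q * rc x).
  by apply/funext => x; rewrite -addrA -mulrDr; congr (_ + _ * _);
    apply: creimP; rewrite /= ?add0r ?addr0.
have ver (x : R) : (fun y => p + q * mkC x y) = (fun y => (p + q * rc x) + (q * mkC 0 1) * rc y).
  apply/funext => y; rewrite -addrA -mulrA -mulrDr; congr (_ + _ * _).
  by apply: creimP; rewrite ?creD ?cimD ?creM ?cimM /=; ring.
have i2 : mkC 0 1 * mkC 0 1 = -1 :> C.
  by apply: creimP; rewrite ?creM ?cimM /=; ring.
have iE (x : R) : mkC 0 x = mkC 0 1 * rc x.
  by apply: creimP; rewrite ?creM ?cimM /=; ring.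
rewrite /crect !hor !ver !cint_affine ![mkC 0 c]iE ![mkC 0 d]iE !rcB !rcM.
have : mkC 0 1 * mkC 0 1 + 1 = 0 :> C by rewrite i2 addrC subrr.
move: (mkC 0 1) => i ii; ring: ii.
Qed.

Lemma crect_le H (M : R) a b c d : continuous H -> a <= b -> c <= d ->
  (forall x y, a <= x <= b -> c <= y <= d -> cmod (H (mkC x y)) <= M) ->
  cmod (crect H a b c d) <= 2 * M * ((b - a) + (d - c)).
Proof.
move=> cH ab cd HM.
have h1 y : c <= y <= d -> cmod (cint (fun x => H (mkC x y)) a b) <= M * (b - a).
  by move=> ?; apply: cint_le => //; [exact: continuous_hor|move=> x ?; exact: HM].
have h2 x : a <= x <= b -> cmod (cint (fun y => H (mkC x y)) c d) <= M * (d - c).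
  by move=> ?; apply: cint_le => //; [exact: continuous_ver|move=> y ?; exact: HM].
have ci : cmod (mkC 0 1 : C) = 1 by rewrite cmodE /= expr0n expr1n add0r sqrtr1.
rewrite /crect (le_trans (cmodD _ _))// cmodM ci mul1r.
have A := h1 c _; have B := h1 d _; have D := h2 a _; have E := h2 b _.
rewrite !lexx ab cd /= in A B D E.
have -> : 2 * M * (b - a + (d - c)) =
  (M * (b - a) + M * (b - a)) + (M * (d - c) + M * (d - c)) by ring.
rewrite lerD// (le_trans (cmodB _ _))// lerD//.
- exact: A.
- exact: B.
- exact: E.
- exact: D.
Qed.

Lemma cmod_sum4_lt (z1 z2 z3 z4 : C) (M : R) : cmod z1 < M -> cmod z2 < M ->
  cmod z3 < M -> cmod z4 < M -> cmod (z1 + z3 + (z2 + z4)) < 4 * M.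
Proof.
move=> A1 A2 A3 A4.
rewrite (le_lt_trans (cmodD _ _))// (le_lt_trans (lerD (cmodD _ _) (cmodD _ _)))//.
have -> : 4 * M = (M + M) + (M + M) by ring.
by rewrite !ltrD.
Qed.

(* Goursat: halving the sides, some quarter carries at least a quarter of the
   contour integral; the quarters shrink to a point of differentiability. *)
Lemma goursat H a b c d : continuous H -> a <= b -> c <= d ->
  (forall x y, a <= x <= b -> c <= y <= d -> differentiable H (mkC x y)) ->
  crect H a b c d = 0.
Proof.
move=> cH ab cd dH; apply/eqP; rewrite -cmod_eq0; apply/eqP.
apply: contrapT => /eqP D0.
set D := cmod (crect H a b c d) in D0.
have {D0}Dgt0 : 0 < D by rewrite lt_def D0 cmod_ge0.
pose w k := (b - a) / 2 ^+ k; pose h k := (d - c) / 2 ^+ k.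
have w2 k : w k = w k.+1 + w k.+1.
  by rewrite /w exprS; field; rewrite expf_neq0.
have h2 k : h k = h k.+1 + h k.+1.
  by rewrite /h exprS; field; rewrite expf_neq0.
have w0 k : 0 <= w k by rewrite divr_ge0 ?exprn_ge0// subr_ge0.
have h0 k : 0 <= h k by rewrite divr_ge0 ?exprn_ge0// subr_ge0.
pose bad k (p : R * R) :=
  D / 4 ^+ k <= cmod (crect H p.1 (p.1 + w k) p.2 (p.2 + h k)).
have step k p : bad k p -> exists q : R * R, [/\ bad k.+1 q,
    p.1 <= q.1, q.1 + w k.+1 <= p.1 + w k, p.2 <= q.2 & q.2 + h k.+1 <= p.2 + h k].
  rewrite {1}/bad => bp; have := w2 k; have := h2 k; have := w0 k.+1; have := h0 k.+1.
  set u := w k.+1; set v := h k.+1 => v0 u0 vE uE.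
  (* If no quarter were bad, the four contour integrals, which add up to that of the whole
     rectangle, would be too small. *)
  apply: contrapT => /forallNP nq.
  have small q1 q2 : p.1 <= q1 -> q1 + u <= p.1 + w k -> p.2 <= q2 ->
      q2 + v <= p.2 + h k -> cmod (crect H q1 (q1 + u) q2 (q2 + v)) < D / 4 ^+ k.+1.
    move=> *; rewrite ltNge; apply/negP => B; apply: (nq (q1, q2)); by split.
  have A1 : cmod (crect H p.1 (p.1 + u) p.2 (p.2 + v)) < D / 4 ^+ k.+1
    by apply: small => /=; move: vE uE v0 u0; clear; lra.
  have A2 : cmod (crect H (p.1 + u) (p.1 + u + u) p.2 (p.2 + v)) < D / 4 ^+ k.+1
    by apply: small => /=; move: vE uE v0 u0; clear; lra.
  have A3 : cmod (crect H p.1 (p.1 + u) (p.2 + v) (p.2 + v + v)) < D / 4 ^+ k.+1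
    by apply: small => /=; move: vE uE v0 u0; clear; lra.
  have A4 : cmod (crect H (p.1 + u) (p.1 + u + u) (p.2 + v) (p.2 + v + v)) < D / 4 ^+ k.+1
    by apply: small => /=; move: vE uE v0 u0; clear; lra.
  have E4 : D / 4 ^+ k = 4 * (D / 4 ^+ k.+1).
    by rewrite exprS; field; rewrite expf_neq0.
  move: bp; rewrite uE vE !addrA (crect_splith _ _ (p.1 + u)).
  rewrite (crect_splitv _ _ (p.1 + u) _ (p.2 + v)).
  rewrite (crect_splitv _ (p.1 + u) _ _ (p.2 + v)).
  by apply/negP; rewrite -ltNge E4; exact: (cmod_sum4_lt A1 A2 A3 A4).
(* To be iterated, the choice of a bad quarter has to be a function of all pairs; where the pair is
   not bad its value is arbitrary. *)
have {step} [g gP] : exists g : nat -> R * R -> R * R, forall k p, bad k p ->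
    [/\ bad k.+1 (g k p), p.1 <= (g k p).1, (g k p).1 + w k.+1 <= p.1 + w k,
      p.2 <= (g k p).2 & (g k p).2 + h k.+1 <= p.2 + h k].
  have /choice[f fP] : forall kp : nat * (R * R), exists q : R * R, bad kp.1 kp.2 ->
    [/\ bad kp.1.+1 q, kp.2.1 <= q.1, q.1 + w kp.1.+1 <= kp.2.1 + w kp.1,
      kp.2.2 <= q.2 & q.2 + h kp.1.+1 <= kp.2.2 + h kp.1].
    move=> [k p] /=; have [/step[q qP]|nb] := pselect (bad k p); first by exists q.
    by exists p => /nb.
  by exists (fun k p => f (k, p)) => k p; exact: (fP (k, p)).
pose fix s k := if k is k'.+1 then g k' (s k') else (a, c).
have sbad k : bad k (s k).
  elim: k => [|k IH]; last by have [] := gP _ _ IH.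
  by rewrite /bad /= /w /h !expr0 !divr1 [a + _]addrC [c + _]addrC !subrK.
pose X k := (s k).1; pose Y k := (s k).2.
have sP k := gP _ _ (sbad k).
have mono (f : nat -> R) : (forall k, f k <= f k.+1) -> forall j k, (j <= k)%N -> f j <= f k.
  by move=> f1 j k jk; exact: (@homo_leq _ f <=%R (@lexx _ _) (@le_trans _ _) f1).
have Xm j k : (j <= k)%N -> X j <= X k.
  by apply: (mono X) => i; have [] := sP i.
have Ym j k : (j <= k)%N -> Y j <= Y k.
  by apply: (mono Y) => i; have [] := sP i.
have Xw j k : (j <= k)%N -> X k + w k <= X j + w j.
  move=> jk; rewrite -lerN2; apply: (mono (fun i => - (X i + w i))) => // i.
  by rewrite lerN2; have [] := sP i.
have Yh j k : (j <= k)%N -> Y k + h k <= Y j + h j.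
  move=> jk; rewrite -lerN2; apply: (mono (fun i => - (Y i + h i))) => // i.
  by rewrite lerN2; have [] := sP i.
(* Nested intervals: the supremum of the left ends lies in all of them. *)
have lim (f v : nat -> R) : (forall j k, (j <= k)%N -> f j <= f k) ->
    (forall j k, (j <= k)%N -> f k + v k <= f j + v j) -> (forall k, 0 <= v k) ->
    exists p, forall k, f k <= p <= f k + v k.
  move=> fm fv v0.
  have fub k : ubound (range f) (f k + v k).
    move=> _ [j _ <-]; have [jk|/ltnW kj] := leqP j k.
      by rewrite (le_trans (fm _ _ jk))// lerDl.
    by rewrite (le_trans _ (fv _ _ kj))// lerDl.
  exists (sup (range f)) => k; apply/andP; split.
    by apply: ub_le_sup; [exists (f 0 + v 0); exact: fub|exists k].
  by apply: ge_sup; [exists (f 0); exists 0|exact: fub].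
have [p1 p1P] := lim X w Xm Xw w0.
have [p2 p2P] := lim Y h Ym Yh h0.
have X0 : X 0 = a by []. have Y0 : Y 0 = c by [].
have w00 : w 0 = b - a by rewrite /w expr0 divr1.
have h00 : h 0 = d - c by rewrite /h expr0 divr1.
have := dH p1 p2; have := p1P 0; have := p2P 0.
rewrite X0 Y0 w00 h00 ![_ + (_ - _)]addrC !subrK => -> -> /(_ isT isT) /diffCP[l lP].
pose L := (b - a) + (d - c).
have L0 : 0 <= L by rewrite addr_ge0 ?subr_ge0.
(* The contour integral of the remainder will be at most [2 * e * L ^+ 2 / 4 ^+ k]; this [e] brings
   it below [D / 4 ^+ k]. *)
pose e := D / (4 * (L ^+ 2 + 1)).
have e0 : 0 < e by rewrite divr_gt0// mulr_gt0// ltr_pwDr// sqr_ge0.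
have [r r0 rP] := (nearCP _ _).1 (lP e e0).
have [k kr] : exists k, L / 2 ^+ k < r.
  have [k] := exists_exp2_gt (L / r).
  by rewrite ltr_pdivrMr// mulrC -ltr_pdivrMr ?exprn_gt0//; exists k.
have wh : w k + h k = L / 2 ^+ k by rewrite /w /h /L; ring.
pose p := mkC p1 p2.
(* Affine functions have zero contour integral, so [H] may be replaced by its remainder [E] after
   first-order approximation at [p]. *)
pose E s := H s + ((l * p - H p) + (- l) * s).
have cE : continuous E.
  by move=> z; apply: (continuousD (cH z)); exact: continuous_affine.
have Ew : forall x y, X k <= x <= X k + w k -> Y k <= y <= Y k + h k ->
    cmod (E (mkC x y)) <= e * (L / 2 ^+ k).
  move=> x y xX yY.
  have B : cmod (mkC x y - p) <= L / 2 ^+ k.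
    rewrite (le_trans (cmod_le _))// creB cimB /= -wh lerD//.
      by have := p1P k; move: xX; rewrite ler_norml; lra.
    by have := p2P k; move: yY; rewrite ler_norml; lra.
  have -> : E (mkC x y) = H (mkC x y) - H p - l * (mkC x y - p) by rewrite /E; ring.
  rewrite (le_trans (rP _ _))//; first exact: le_lt_trans B kr.
  by rewrite ler_wpM2l// ltW.
have HE : crect H (X k) (X k + w k) (Y k) (Y k + h k) =
    crect E (X k) (X k + w k) (Y k) (Y k + h k).
  rewrite -[RHS]addr0 -(crect_affine (H p - l * p) l (X k) (X k + w k) (Y k) (Y k + h k)).
  rewrite -(crectD _ _ _ _ cE (@continuous_affine (H p - l * p) l)); congr crect.
  by apply/funext => z; rewrite /E; ring.
have := sbad k; rewrite /bad -/(X k) -/(Y k) HE.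
have Xk : X k <= X k + w k by rewrite lerDl.
have Yk : Y k <= Y k + h k by rewrite lerDl.
have := crect_le cE Xk Yk Ew.
rewrite [X k + w k - _]addrC addKr [Y k + h k - _]addrC addKr wh => B1 B2.
have := le_trans B2 B1; apply/negP; rewrite -ltNge.
have -> : 2 * (e * (L / 2 ^+ k)) * (L / 2 ^+ k) = 2 * e * L ^+ 2 / 4 ^+ k.
  have -> : 4 = 2 * 2 :> R by ring.
  by rewrite exprMn; field; rewrite expf_neq0.
rewrite ltr_pM2r ?invr_gt0 ?exprn_gt0//.
rewrite /e mulrA mulrAC ltr_pdivrMr ?mulr_gt0// ?ltr_pwDr// ?sqr_ge0//.
have := sqr_ge0 L. nra.
Qed.
End Goursat.

(** * The complex exponential *)

Section ComplexExp.
Context {R : realType}.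
Local Notation C := (Cplx R).

Definition cexp (s : C) : C := mkC (expR (cre s) * cos (cim s)) (expR (cre s) * sin (cim s)).
Definition period : R := pi *+ 2.
Definition cis (t : R) : C := cexp (mkC 0 t).

Lemma period_gt0 : 0 < period.
Proof. by rewrite pmulrn_rgt0// pi_gt0. Qed.

Lemma cexpD s t : cexp (s + t) = cexp s * cexp t.
Proof.
by apply: creimP; rewrite ?creM ?cimM /= creD cimD ?cosD ?sinD expRD; ring.
Qed.

Lemma cmod_cexp s : cmod (cexp s) = expR (cre s).
Proof.
rewrite cmodE /= !exprMn -mulrDr cos2Dsin2 mulr1 sqrtr_sqr.
by rewrite ger0_norm// expR_ge0.
Qed.

Lemma cexp_neq0 s : cexp s != 0.
Proof. by rewrite -cmod_gt0 cmod_cexp expR_gt0. Qed.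

Lemma cexp_period s : cexp (s + mkC 0 period) = cexp s.
Proof. by apply: creimP; rewrite /= cimD creD addr0 /period ?cosD2pi ?sinD2pi. Qed.

Lemma cmod_cis t : cmod (cis t) = 1.
Proof. by rewrite cmod_cexp expR0. Qed.

Lemma cexp_surj z : z != 0 -> exists2 s, cexp s = z & cre s = ln (cmod z).
Proof.
rewrite -cmod_gt0 => z0.
pose r := cmod z; pose x := cre z / r; pose y := cim z / r.
have rE : expR (ln r) = r by rewrite lnK.
have r0 : r != 0 by rewrite gt_eqF.
have xy : x ^+ 2 + y ^+ 2 = 1.
  have r2 : r ^+ 2 = cre z ^+ 2 + cim z ^+ 2.
    by rewrite /r cmodE sqr_sqrtr// addr_ge0// sqr_ge0.
  by rewrite !expr_div_n -mulrDl -r2 divff// expf_neq0.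
have x1 : -1 <= x <= 1.
  by rewrite -ler_norml -(@expr_le1 _ 2)// real_normK ?num_real// -xy lerDl sqr_ge0.
have sE : Num.sqrt (1 - x ^+ 2) = `|y|.
  by rewrite -xy addrC addKr sqrtr_sqr.
(* The values of [acos] are arguments of points in the closed upper half-plane; below it the sign is
   changed. *)
have [y0|/ltW y0] := leP 0 y.
  exists (mkC (ln r) (acos x)) => //; apply: creimP; rewrite /= rE.
    by rewrite acosK ?in_itv// /x mulrC divfK.
  by rewrite sin_acos// sE ger0_norm// /y mulrC divfK.
exists (mkC (ln r) (- acos x)) => //; apply: creimP; rewrite /= rE.
  by rewrite cosN acosK ?in_itv// /x mulrC divfK.
by rewrite sinN sin_acos// sE ler0_norm// opprK /y mulrC divfK.
Qed.

Lemma is_derive_near0 (f : R -> R) (l : R) : is_derive (0 : R) (1 : R) f l ->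
  forall e : R, 0 < e -> \forall x \near (0 : R), `|f x - f 0 - l * x| <= e * `|x|.
Proof.
move=> [df <-] e e0.
have := df; rewrite /derivable => /cvgrPdist_lt/(_ e e0).
rewrite near_withinE; apply: filterS => x /=.
have [->|x0] := eqVneq x 0; first by rewrite subrr mulr0 subrr normr0 mulr0.
move=> /(_ isT); rewrite [x *: 1]mulr1 addr0.
set k := lim _; rewrite -[_ *: _]/(_ * _) => kl.
have -> : f x - f 0 - 'D_1 f 0 * x = - ((k - x^-1 * (f x - f 0)) * x).
  by rewrite mulrBl -/k mulrAC mulVf//; rewrite /derive -/k; ring.
by rewrite normrN normrM ler_wpM2r// ltW.
Qed.

Lemma cexp_near0 (e : R) : 0 < e -> \forall w \near (0 : C),
  cmod (cexp w - 1 - w) <= e * cmod w.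
Proof.
(* Real and imaginary part will each be off by at most [3 * (d * m)], and 7 leaves room for both.
   The radius [d / 2] below absorbs the quadratic error [2 * m * m]. *)
move=> e0; pose d := Num.min e 1 / 7.
have d0 : 0 < d by rewrite divr_gt0// lt_min e0 ltr01.
have d7 : 7 * d <= e.
  by rewrite mulrC divfK// ge_min lexx.
have d1 : d <= 1 / 7 by rewrite ler_wpM2r// ge_min lexx orbT.
have [r1 r10 H1] := (nearRP _ _).1 (is_derive_near0 (is_derive_expR 0) d0).
have [r2 r20 H2] := (nearRP _ _).1 (is_derive_near0 (is_derive_sin 0) d0).
have [r3 r30 H3] := (nearRP _ _).1 (is_derive_near0 (is_derive_cos 0) d0).
apply/nearCP; exists (Num.min (d / 2) (Num.min r1 (Num.min r2 r3))).
  by rewrite !lt_min r10 r20 r30 divr_gt0.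
move=> w; rewrite subr0 !lt_min => /and4P[wd w1 w2 w3].
set m := cmod w in wd w1 w2 w3 *.
have sm : `|cre w| <= m := cre_le w.
have tm : `|cim w| <= m := cim_le w.
have := H1 (cre w); have := H2 (cim w); have := H3 (cim w).
rewrite !subr0 expR0 sin0 cos0 oppr0 mul0r !(subr0, addr0) !mul1r.
move=> /(_ (le_lt_trans tm w3)) A3 /(_ (le_lt_trans tm w2)) A2 /(_ (le_lt_trans sm w1)) A1.
rewrite (le_trans (cmod_le _))// !creB !cimB /= subr0 .
set s := cre w in sm A1 *; set t := cim w in tm A2 A3 *.
set E := expR s in A1 *.
have m0 : 0 <= m by exact: cmod_ge0.
have {}A1 : `|E - 1 - s| <= d * m by rewrite (le_trans A1)// ler_wpM2l// ltW.
have {}A2 : `|sin t - t| <= d * m by rewrite (le_trans A2)// ler_wpM2l// ltW.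
have {}A3 : `|cos t - 1| <= d * m by rewrite (le_trans A3)// ler_wpM2l// ltW.
have c1 := cos_max t.
have dm : d * m <= m by rewrite ler_piMl//; move: d1; lra.
have s1 : `|1 + s| <= 2.
  rewrite (le_trans (ler_normD _ _))// normr1; move: sm wd d1; lra.
have E1 : `|E - 1| <= 2 * m.
  have -> : E - 1 = (E - 1 - s) + s by ring.
  rewrite (le_trans (ler_normD _ _))//; move: A1 dm sm; lra.
have E3 : `|E| <= 2.
  have -> : E = (E - 1) + 1 by ring.
  rewrite (le_trans (ler_normD _ _))// normr1; move: E1 wd d1; lra.
have re : `|E * cos t - 1 - s| <= 3 * (d * m).
  have -> : E * cos t - 1 - s = (E - 1 - s) * cos t + (1 + s) * (cos t - 1) by ring.
  rewrite (le_trans (ler_normD _ _))// !normrM.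
  have : `|E - 1 - s| * `|cos t| <= d * m * 1 by rewrite ler_pM.
  have : `|1 + s| * `|cos t - 1| <= 2 * (d * m) by rewrite ler_pM.
  lra.
have im : `|E * sin t - t| <= 3 * (d * m).
  have -> : E * sin t - t = E * (sin t - t) + (E - 1) * t by ring.
  rewrite (le_trans (ler_normD _ _))// !normrM.
  have : `|E| * `|sin t - t| <= 2 * (d * m) by rewrite ler_pM.
  have : `|E - 1| * `|t| <= 2 * m * m by rewrite ler_pM.
  have : 2 * m * m <= d * m by rewrite ler_wpM2r//; move: wd; lra.
  lra.
have : 7 * (d * m) <= e * m by rewrite mulrA ler_wpM2r.
have : 0 <= d * m by rewrite mulr_ge0// ltW.
move: re im; lra.
Qed.

Lemma cexp_differentiable s : differentiable cexp s.
Proof.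
apply/diffCP; exists (cexp s) => e e0.
have k0 : 0 < cmod (cexp s) by rewrite cmod_gt0 cexp_neq0.
have [r r0 H] := (nearCP _ _).1 (cexp_near0 (divr_gt0 e0 k0)).
apply/nearCP; exists r => // w ws.
have := H (w - s); rewrite subr0 => /(_ ws) B.
have -> : cexp w - cexp s - cexp s * (w - s) = cexp s * (cexp (w - s) - 1 - (w - s)).
  by rewrite !mulrBr mulr1 -cexpD [s + (w - s)]addrC subrK; ring.
by rewrite cmodM mulrC -ler_pdivlMr// mulrAC.
Qed.

Lemma cexp_continuous : continuous cexp.
Proof. by move=> s; apply: differentiable_continuous; exact: cexp_differentiable. Qed.

End ComplexExp.

(** * Means over circles *)

Section Mean.
Context {R : realType}.
Local Notation C := (Cplx R).
Local Notation period := (@period R).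
Implicit Types (H G : C -> C) (s : C).

(** For [H = h \o cexp] this is the mean of [h] over the circle of radius [expR (cre s)]. *)
Definition cmean H s : C := cint (fun t => H (s + mkC 0 t)) 0 period * rc period^-1.

Lemma continuous_cmul (T : topologicalType) (k : C) (f : T -> C) :
  continuous f -> continuous (fun x => k * f x).
Proof. by move=> cf x; apply: cvgMr; exact: cf. Qed.

Lemma continuous_line H s : continuous H -> continuous (fun t : R => H (s + mkC 0 t)).
Proof.
move=> cH t; apply: (@continuous_comp _ _ _ (fun t : R => s + mkC 0 t) H); last exact: cH.
by apply: cvgD; [exact: cvg_cst|apply: mkC_cvg; [exact: cvg_cst|exact: cvg_id]].
Qed.

Lemma cmeanD H G s : continuous H -> continuous G ->
  cmean (fun z => H z + G z) s = cmean H s + cmean G s.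
Proof. by move=> cH cG; rewrite /cmean cintD ?mulrDl//; exact: continuous_line. Qed.

Lemma cmeanZ (k : C) H s : continuous H -> cmean (fun z => k * H z) s = k * cmean H s.
Proof. by move=> cH; rewrite /cmean cintZ ?mulrA//; exact: continuous_line. Qed.

Lemma cmean_cst (k : C) s : cmean (fun=> k) s = k.
Proof.
rewrite /cmean; have -> : (fun=> k) = (fun t : R => k + 0 * rc t).
  by apply/funext => t; rewrite mul0r addr0.
by rewrite cint_affine mul0r addr0 subr0 -mulrA -rcM mulfV ?mulr1// gt_eqF// period_gt0.
Qed.

Lemma cmean_sum (F : nat -> C -> C) n s : (forall i, continuous (F i)) ->
  continuous (fun z => \sum_(i < n) F i z) /\
  cmean (fun z => \sum_(i < n) F i z) s = \sum_(i < n) cmean (F i) s.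
Proof.
move=> cF; elim: n => [|n [cS IH]].
  have -> : (fun z => \sum_(i < 0) F i z) = (fun=> 0) by apply/funext => z; rewrite big_ord0.
  by split; [exact: cst_continuous|rewrite cmean_cst big_ord0].
have E : (fun z => \sum_(i < n.+1) F i z) = (fun z => \sum_(i < n) F i z + F n z).
  by apply/funext => z; rewrite big_ord_recr.
rewrite E; split; last by rewrite (cmeanD _ cS (cF n)) IH big_ord_recr.
by move=> z; exact: (continuousD (cS z) (cF n z)).
Qed.

Lemma cmean_le H s M : continuous H -> (forall t, cmod (H (s + mkC 0 t)) <= M) ->
  cmod (cmean H s) <= M.
Proof.
move=> cH HM; have p0 := @period_gt0 R.
rewrite /cmean cmodM cmod_rc ger0_norm ?invr_ge0 ?(ltW p0)// ler_pdivrMr//.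
rewrite -[X in _ * X]subr0; apply: cint_le (ltW p0) _; first exact: continuous_line.
by move=> t _; exact: HM.
Qed.

(** Compactness of the segment makes the continuity in [y] uniform in [t], and then [cint_le] bounds
    the difference of the integrals. *)
Lemma cint_param (T : topologicalType) (g : T -> R -> C) (a b : R) (x : T) : a <= b ->
  continuous (fun p : T * R => g p.1 p.2) ->
  cint (g y) a b @[y --> x] --> cint (g x) a b.
Proof.
move=> ab cg.
have cgx y : continuous (g y).
  move=> t; apply: (@continuous_comp _ _ _ (fun t : R => (y, t)) (fun p : T * R => g p.1 p.2)).
    exact: (@cvg_pair _ _ _ (nbhs t) (nbhs y) (nbhs t) _ _ _ (fun=> y) id (@cvg_cst _ y _ _ _) cvg_id).
  exact: cg.
apply/cvgCP => e e0.
pose d := e / (2 * (b - a + 1)).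
have ba : 0 < b - a + 1 by rewrite ltr_wpDl// subr_ge0.
have d0 : 0 < d by rewrite divr_gt0// mulr_gt0.
have /compact_near_coveringP cpt := @segment_compact R a b.
have : \forall y \near x, `[a, b] `<=` (fun t => cmod (g y t - g x t) < d).
  apply: cpt => t _.
  have d2 : 0 < d / 2 by rewrite divr_gt0.
  have /cvgCP/(_ _ d2) := cg (x, t).
  move=> [[U V] /= [Ux Vt] UV].
  exists (V, U) => // -[t' y] /= [Vt' Uy].
  have B1 := UV (y, t') (conj Uy Vt').
  have B2 := UV (x, t') (conj (nbhs_singleton Ux) Vt').
  rewrite /= in B1 B2.
  have -> : g y t' - g x t' = (g y t' - g x t) - (g x t' - g x t) by ring.
  by rewrite (le_lt_trans (cmodB _ _))// (splitr d) ltrD.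
apply: filterS => y H.
have -> : cint (g y) a b - cint (g x) a b = cint (fun t => g y t + (-1) * g x t) a b.
  rewrite (cintD _ _ (cgx y) (continuous_cmul (k := -1) (cgx x))).
  by rewrite (cintZ _ _ _ (cgx x)) mulN1r.
apply: (@le_lt_trans _ _ (d * (b - a))); last first.
  rewrite /d mulrAC ltr_pdivrMr ?mulr_gt0// ltr_pM2l//; move: ab; lra.
apply: cint_le => //.
  move=> t; apply: (continuousD (cgx y t)).
  exact: (continuous_cmul (k := -1) (cgx x)).
move=> t tab; rewrite mulN1r; apply: ltW; apply: H.
by rewrite /= in_itv.
Qed.

Lemma cmean_continuous H : continuous H -> continuous (cmean H).
Proof.
move=> cH s; apply: (@continuous_comp _ _ _ (fun s => cint (fun t => H (s + mkC 0 t)) 0 period)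
  ( *%R^~ (rc period^-1))); last exact: mulrr_continuous.
apply: (@cint_param _ (fun s t => H (s + mkC 0 t))); first exact: (ltW (@period_gt0 R)).
move=> p; apply: (@continuous_comp _ _ _ (fun p : C * R => p.1 + mkC 0 p.2) H); last exact: cH.
apply: cvgD; first exact: cvg_fst.
by apply: mkC_cvg; [exact: cvg_cst|exact: cvg_snd].
Qed.

Definition periodicC H := forall s, H (s + mkC 0 period) = H s.

Lemma mkC0D (x y : R) : mkC 0 (x + y) = mkC 0 x + mkC 0 y.
Proof. by apply: creimP; rewrite ?creD ?cimD /= ?addr0. Qed.

Lemma cmean_vert H s (t : R) : continuous H -> periodicC H ->
  cmean H (s + mkC 0 t) = cmean H s.
Proof.
move=> cH pH; rewrite /cmean; congr (_ * _).
pose f t := H (s + mkC 0 t).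
have cf : continuous f by exact: continuous_line.
have -> : (fun x => H (s + mkC 0 t + mkC 0 x)) = (fun x => f (x + t)).
  by apply/funext => x; rewrite /f mkC0D [mkC 0 x + _]addrC addrA.
rewrite cint_shift// add0r.
rewrite -(cint_chasles f t 0) -(cint_chasles f 0 period).
have -> : cint f period (period + t) = cint f 0 t.
  rewrite [period + t]addrC -{1}[period]add0r -cint_shift//; congr cint.
  by apply/funext => x; rewrite /f mkC0D addrA pH.
by rewrite addrCA cint_chasles -[RHS]addr0; congr (_ + _); rewrite /cint /rint !subrr.
Qed.

(* The points of the imaginary axis may be singular: there, continuity of the
   mean suffices. *)
Lemma cmean_const H s : continuous H -> periodicC H ->
  (forall z, cre z != 0 -> differentiable H z) -> cmean H s = cmean H 0.
Proof.
move=> cH pH dH.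
have p0 := @period_gt0 R.
(* On a rectangle of height [period] the horizontal sides cancel by periodicity, so Goursat's
   theorem equates the integrals over the vertical sides. *)
have rect (a b : R) : a <= b -> (0 < a) || (b < 0) -> cmean H (rc a) = cmean H (rc b).
  move=> ab ab0.
  have : crect H a b 0 period = 0.
    apply: (goursat cH ab (ltW p0)) => x y /andP[ax xb] _; apply: dH => /=; case/orP: ab0 => [a0|b0].
      by rewrite gt_eqF// (lt_le_trans a0).
    by rewrite lt_eqF// (le_lt_trans xb).
  rewrite /crect.
  have -> : (fun x => H (mkC x period)) = (fun x => H (mkC x 0)).
    apply/funext => x; rewrite -[RHS]pH; congr H.
    by apply: creimP; rewrite ?creD ?cimD /= ?addr0 ?add0r.
  rewrite subrr add0r => /eqP; rewrite mulf_eq0 => /orP[/eqP[]/eqP|].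
    by rewrite oner_eq0.
  rewrite subr_eq0 => /eqP E; rewrite /cmean; congr (_ * _).
  have V (x : R) : (fun t => H (rc x + mkC 0 t)) = (fun t => H (mkC x t)).
    apply/funext => t; congr H.
    by apply: creimP; rewrite ?creD ?cimD /= ?addr0 ?add0r.
  by rewrite !V E.
(* The mean is constant on either side of the axis, and by continuity it is close to its value at 0
   for small abscissas. *)
have zero (a : R) : a != 0 -> cmean H (rc a) = cmean H 0.
  move=> a0; apply/eqP; rewrite -subr_eq0 -cmod_eq0; apply/eqP.
  apply: contrapT => /eqP D0.
  set D := cmod _ in D0.
  have {D0}Dgt0 : 0 < D by rewrite lt_def D0 cmod_ge0.
  have /cvgCP/(_ _ Dgt0) := @cmean_continuous H cH 0 => /nearCP[r r0 rP].
  pose b := Num.min (r / 2) `|a|.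
  have b0 : 0 < b by rewrite lt_min divr_gt0//= normr_gt0.
  have br : b < r by rewrite gt_min; apply/orP; left; lra.
  have ba : b <= `|a| by rewrite ge_min lexx orbT.
  have [a_gt|a_le] := ltP 0 a.
    have := rP (rc b); rewrite subr0 cmod_rc gtr0_norm// => /(_ br).
    rewrite (rect b a) ?b0//; last by rewrite gtr0_norm in ba.
    by rewrite ltxx.
  have a_lt : a < 0 by rewrite lt_neqAle a0.
  have := rP (rc (- b)); rewrite subr0 cmod_rc normrN gtr0_norm// => /(_ br).
  rewrite -(rect a (- b)) ?oppr_lt0 ?b0 ?orbT//; last by rewrite ltr0_norm// in ba; lra.
  by rewrite ltxx.
have -> : s = rc (cre s) + mkC 0 (cim s).
  by apply: creimP; rewrite ?creD ?cimD /= ?addr0 ?add0r.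
rewrite cmean_vert//.
by have [->|/zero] := eqVneq (cre s) 0.
Qed.

End Mean.

(** * Laurent expansions *)

Section Laurent.
Context {R : realType}.
Local Notation C := (Cplx R).
Implicit Types (h g : C -> C) (z s : C) (k : int).

Definition hol0 h := forall z, z != 0 -> differentiable h z.

Lemma eq_cmean (H G : C -> C) s : (forall z, H z = G z) -> cmean H s = cmean G s.
Proof. by move=> /funext ->. Qed.

Lemma differentiable_idC (z : C) : differentiable (fun w : C => w) z.
Proof. by apply/derivable1_diffP; exact: derivable_id. Qed.

Lemma differentiable_pow (z : C) n : differentiable (fun w : C => w ^+ n) z.
Proof.
elim: n => [|n IH]; first exact: differentiable_cst.
under eq_fun do rewrite exprS.
by apply: differentiableM; first exact: differentiable_idC.
Qed.

Lemma hol0_expz k : hol0 (fun w => w ^ k).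
Proof.
move=> z z0; case: k => n; first exact: differentiable_pow.
apply: differentiableV; first exact: differentiable_pow.
by rewrite expf_neq0.
Qed.

Lemma hol0M h g : hol0 h -> hol0 g -> hol0 (fun z => h z * g z).
Proof. by move=> hh hg z z0; apply: differentiableM; [exact: hh|exact: hg]. Qed.

Lemma hol0_cst (a : C) : hol0 (fun=> a).
Proof. by move=> z _; exact: differentiable_cst. Qed.

Lemma hol0B h g : hol0 h -> hol0 g -> hol0 (fun z => h z - g z).
Proof. by move=> hh hg z z0; apply: differentiableB; [exact: hh|exact: hg]. Qed.

Lemma hol0_dil h (t : C) : t != 0 -> hol0 h -> hol0 (fun z => h (t * z)).
Proof.
move=> t0 hh z z0; apply: (@differentiable_comp _ _ _ _ (fun z : C => t * z) h).
  by apply: differentiableM; [exact: differentiable_cst|exact: differentiable_idC].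
by apply: hh; rewrite mulf_neq0.
Qed.

Lemma hol0_comp_cexp h s : hol0 h -> differentiable (h \o cexp) s.
Proof.
move=> hh; apply: differentiable_comp; first exact: cexp_differentiable.
by apply: hh; exact: cexp_neq0.
Qed.

Lemma hol0_continuous_cexp h : hol0 h -> continuous (fun s => h (cexp s)).
Proof.
by move=> hh s; apply: differentiable_continuous; exact: (hol0_comp_cexp s hh).
Qed.

Lemma periodic_cexp h : periodicC (fun s => h (cexp s)).
Proof. by move=> s; rewrite cexp_period. Qed.

Definition circ h s : C := cmean (fun s => h (cexp s)) s.
(** The Laurent coefficient of index [k], on the unit circle. The mean is over the angle, which
    accounts for [dz / z]; hence the exponent [- k] instead of [- k - 1]. *)
Definition lcoef h k : C := circ (fun z => h z * z ^ (- k)) 0.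

Lemma hol0_coef h k : hol0 h -> hol0 (fun z => h z * z ^ (- k)).
Proof. by move=> hh; apply: hol0M => //; exact: hol0_expz. Qed.

Lemma continuous_coef h k : hol0 h -> continuous (fun s => h (cexp s) * cexp s ^ (- k)).
Proof. by move=> hh; exact: (hol0_continuous_cexp (hol0_coef k hh)). Qed.

Lemma circ_const h s : hol0 h -> circ h s = circ h 0.
Proof.
move=> hh; apply: cmean_const; first exact: hol0_continuous_cexp.
  exact: periodic_cexp.
by move=> z _; exact: hol0_comp_cexp.
Qed.

Lemma circ_le h s (M : R) : hol0 h ->
  (forall z, cmod z = expR (cre s) -> cmod (h z) <= M) -> cmod (circ h s) <= M.
Proof.
move=> hh hM; apply: cmean_le; first exact: hol0_continuous_cexp.
by move=> t; apply: hM; rewrite cmod_cexp creD addr0.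
Qed.

Lemma lcoefB h g k : hol0 h -> hol0 g -> lcoef (fun z => h z - g z) k = lcoef h k - lcoef g k.
Proof.
move=> hh hg; rewrite /lcoef /circ -[X in _ = _ - X]mul1r -mulNr -cmeanZ; last first.
  exact: continuous_coef.
rewrite -cmeanD; last 2 first.
- exact: continuous_coef.
- apply: continuous_cmul.
  exact: continuous_coef.
by apply: eq_cmean => s; rewrite mulrBl mulN1r.
Qed.

Lemma lcoefZ h (a : C) k : hol0 h -> lcoef (fun z => a * h z) k = a * lcoef h k.
Proof.
move=> hh; rewrite /lcoef /circ -cmeanZ; last first.
  exact: continuous_coef.
by apply: eq_cmean => s; rewrite mulrA.
Qed.

(** Writing [t = cexp s0], the dilation is a translation by [s0] in the logarithmic coordinate,
    under which [circ] is constant. *)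
Lemma lcoef_dil h (t : C) k : t != 0 -> hol0 h ->
  lcoef (fun z => h (t * z)) k = t ^ k * lcoef h k.
Proof.
move=> t0 hh; have [s0 s0E _] := cexp_surj t0.
have hc := hol0_coef k hh.
rewrite /lcoef -(circ_const s0 hc) /circ -cmeanZ; last exact: continuous_coef.
rewrite /cmean; congr (cint _ _ _ * _); apply/funext => x.
rewrite add0r cexpD s0E exprzMl ?unitfE ?cexp_neq0//.
by rewrite [RHS]mulrCA [t ^ k * _]mulrA -exprzDr ?unitfE// subrr expr0z mul1r.
Qed.

Lemma lcoef_le h (r M : R) k : 0 < r -> hol0 h ->
  (forall z, cmod z = r -> cmod (h z) <= M) -> cmod (lcoef h k) <= M * r ^ (- k).
Proof.
move=> r0 hh hM.
have hc := hol0_coef k hh.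
rewrite /lcoef -(circ_const (rc (ln r)) hc).
apply: circ_le => // z /=; rewrite lnK// => zr.
have cz : forall j : int, cmod (z ^ j) = r ^ j.
  by case=> n; rewrite ?NegzE -?exprnN ?cmodV /= cmodX zr.
by rewrite cmodM cz ler_wpM2r ?hM// exprz_ge0// ltW.
Qed.

(** Dilation by 2 fixes a constant function but multiplies its coefficient by [2 ^ k], so that this
    coefficient is zero for [k != 0]. No integral of an exponential is computed. *)
Lemma lcoef1 k : lcoef (fun=> 1) k = (k == 0)%:R.
Proof.
have [->|k0] := eqVneq k 0.
  by rewrite /lcoef /circ; under [X in cmean X]eq_fun do rewrite oppr0 expr0z mulr1;
    rewrite cmean_cst.
have t0 : (2 : C) != 0 by rewrite pnatr_eq0.
have := @lcoef_dil (fun=> 1) 2 k t0 (@hol0_cst 1).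
set c := lcoef _ _; move=> E; apply/eqP; rewrite -cmod_eq0; apply/eqP.
have : cmod c = 2 ^ k * cmod c.
  rewrite {1}E cmodM; congr (_ * _).
  by case: (k) => n; rewrite ?NegzE -?exprnN ?cmodV /= cmodX cmod_nat.
move=> /eqP; rewrite -subr_eq0 -{1}[cmod c]mul1r -mulrBl mulf_eq0 => /orP[|/eqP//].
rewrite subr_eq0 eq_sym => /eqP e1; exfalso; move/eqP: k0; apply.
apply: (@ieexprIz R 2) => //; by rewrite gt_eqF// ltr1n.
Qed.

Lemma lcoef_cst (a : C) k : lcoef (fun=> a) k = a * (k == 0)%:R.
Proof.
by rewrite -lcoef1 -lcoefZ ?mulr1//; exact: hol0_cst.
Qed.

(* Partial sums of the Laurent series at the point 1 only: the other points are
   reached by dilations, see lcoef_dil. *)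
Definition laurent h N : C := \sum_(i < N) (lcoef h i%:Z + lcoef h (- i.+1%:Z)).

Lemma continuous_sum_coef h (j : nat -> int) N : hol0 h ->
  continuous (fun s => \sum_(i < N) (h (cexp s) * cexp s ^ (- j i))) /\
  cmean (fun s => \sum_(i < N) (h (cexp s) * cexp s ^ (- j i))) 0 = \sum_(i < N) lcoef h (j i).
Proof.
move=> hh.
exact: (@cmean_sum _ (fun i s => h (cexp s) * cexp s ^ (- j i)) N 0
  (fun i => continuous_coef (k := j i) hh)).
Qed.

Lemma cmean_sum_coef h (j : nat -> int) N s : hol0 h ->
  cmean (fun s => \sum_(i < N) (h (cexp s) * cexp s ^ (- j i))) s = \sum_(i < N) lcoef h (j i).
Proof.
move=> hh; have [_ ->] := @cmean_sum _ (fun i s => h (cexp s) * cexp s ^ (- j i)) N s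
  (fun i => continuous_coef (k := j i) hh).
by apply: eq_bigr => i _; exact: (circ_const s (hol0_coef (j i) hh)).
Qed.

(** Cauchy's formula at the point 1, as a difference of means over the circles of radii 2 and 1/2.
    The kernel [z / (z - 1)] has modulus at most 2 on the first and at most 1 on the second, whence
    the constant 3. The zero of [g] at 1 removes the pole. *)
Lemma laurent_pole g (B : R) N : hol0 g -> g 1 = 0 ->
  (forall z, 1 / 2 <= cmod z <= 2 -> cmod (g z) <= B) ->
  cmod (laurent g N) <= 3 * B / 2 ^+ N.
Proof.
move=> hg g1 gB.
have /diffCP[l lP] := hg 1 (oner_neq0 _).
(* At 1 only continuity of [q] is established, with the derivative as value. Since [cexp s = 1]
   forces [s] onto the imaginary axis, [cmean_const] still applies. *)
pose q z := if z == 1 then l else z * (g z / (z - 1)).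
have qE z : z != 1 -> q z = z * (g z / (z - 1)) by rewrite /q => /negPf ->.
have dq z : z != 0 -> z != 1 -> differentiable q z.
  move=> z0 z1.
  have D : differentiable (fun z => z * (g z / (z - 1))) z.
    apply: differentiableM; first exact: differentiable_idC.
    apply: differentiableM; first exact: hg.
    apply: differentiableV; last by rewrite subr_eq0.
    by apply: differentiableB; [exact: differentiable_idC|exact: differentiable_cst].
  have /diffCP[m mP] := D; apply/diffCP; exists m => e e0.
  have := mP e e0; have z1' : 0 < cmod (z - 1) by rewrite cmod_gt0 subr_eq0.
  have : \forall w \near z, w != 1.
    apply/nearCP; exists (cmod (z - 1)) => // w wz; apply: contraTneq wz => ->.
    by rewrite cmodBC ltxx.
  by apply: filterS2 => w w1; rewrite !qE.
have cq : continuous (fun s => q (cexp s)).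
  move=> s; have [e1|n1] := eqVneq (cexp s) 1; last first.
    apply: (@continuous_comp _ _ _ cexp q); first exact: cexp_continuous.
    by apply: differentiable_continuous; apply: dq => //; exact: cexp_neq0.
  apply: (@continuous_comp _ _ _ cexp q); first exact: cexp_continuous.
  rewrite e1; apply/(@cvgCP R _ (nbhs (1 : C)) (nbhs_filter (1 : C))) => e e0.
  pose d := Num.min 1 (e / (2 * (1 + cmod l) + 2)).
  have den : 0 < 2 * (1 + cmod l) + 2 by rewrite ltr_wpDl// mulr_ge0// addr_ge0// cmod_ge0.
  have d0 : 0 < d by rewrite lt_min ltr01 divr_gt0.
  have [r r0 rP] := (nearCP _ _).1 (lP _ d0).
  apply/nearCP; exists (Num.min d r); first by rewrite lt_min d0 r0.
  move=> w; rewrite lt_min => /andP[wd wr].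
  have := rP w wr; rewrite g1 subr0 => gw.
  have {1}-> : q 1 = l by rewrite /q eqxx.
  have [->|w1] := eqVneq w 1; first by rewrite /q eqxx subrr cmod0.
  have w10 : w - 1 != 0 by rewrite subr_eq0.
  have m0 : 0 < cmod (w - 1) by rewrite cmod_gt0.
  rewrite qE//.
  have -> : w * (g w / (w - 1)) - l = w * ((g w - l * (w - 1)) / (w - 1)) + l * (w - 1).
    by field.
  have A : cmod ((g w - l * (w - 1)) / (w - 1)) <= d.
    by rewrite cmodM cmodV ler_pdivrMr.
  have d1 : d <= 1 by rewrite ge_min lexx.
  have W : cmod w <= 2.
    have -> : w = (w - 1) + 1 by ring.
    rewrite (le_trans (cmodD _ _))// cmod1; move: wd d1; lra.
  have de : d * (2 * (1 + cmod l) + 2) <= e by rewrite -ler_pdivlMr// ge_min lexx orbT.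
  rewrite (le_lt_trans (cmodD _ _))// !cmodM.
  have P1 : cmod w * cmod ((g w - l * (w - 1)) / (w - 1)) <= 2 * d.
    by rewrite ler_pM// cmod_ge0.
  have P2 : cmod l * cmod (w - 1) <= cmod l * d by rewrite ler_wpM2l ?cmod_ge0// ltW.
  rewrite cmodM in P1.
  have l0 := cmod_ge0 l; have P3 : 0 <= d * cmod l by rewrite mulr_ge0// ltW.
  move: P1 P2 P3 de d0; clear; set a := cmod l; set b := cmod w; set c := cmod _ * _.
  nra.
have qconst s : cmean (fun s => q (cexp s)) s = cmean (fun s => q (cexp s)) 0.
  apply: (@cmean_const R (fun s => q (cexp s)) s cq).
    by move=> z; rewrite cexp_period.
  move=> z z0; apply: (@differentiable_comp _ _ _ _ cexp q); first exact: cexp_differentiable.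
  apply: dq; first exact: cexp_neq0.
  apply: contraNneq z0 => e1.
  by rewrite -(expRK (cre z)) -cmod_cexp e1 cmod1 ln1.
have [cF1 _] := continuous_sum_coef (fun i => i%:Z) N hg.
have [cF2 _] := continuous_sum_coef (fun i => - i.+1%:Z) N hg.
pose F1 s := \sum_(i < N) (g (cexp s) * cexp s ^ (- i%:Z)).
pose F2 s := \sum_(i < N) (g (cexp s) * cexp s ^ (- - i.+1%:Z)).
(* Both subtract from [q] a partial sum of the geometric series of [z / (z - 1)], in [z^-1] for [R1]
   and in [z] for [R2]. They are small on the circles of radius 2 and 1/2 respectively, while the
   means of the sums are sums of coefficients. *)
pose R1 s := q (cexp s) + (-1) * F1 s.
pose R2 s := q (cexp s) + F2 s.
have cR1 : continuous R1.
  by move=> s; exact: (continuousD (cq s) (continuous_cmul (k := -1) cF1 (x := s))).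
have cR2 : continuous R2 by move=> s; exact: (continuousD (cq s) (cF2 s)).
have E1 s : cmean R1 s = cmean (fun s => q (cexp s)) 0 - \sum_(i < N) lcoef g i%:Z.
  rewrite /R1 (cmeanD _ cq (continuous_cmul (k := -1) cF1)) (cmeanZ _ _ cF1) qconst.
  by rewrite (cmean_sum_coef (fun i => i%:Z)) ?mulN1r.
have E2 s : cmean R2 s = cmean (fun s => q (cexp s)) 0 + \sum_(i < N) lcoef g (- i.+1%:Z).
  rewrite /R2 (cmeanD _ cq cF2) qconst.
  by rewrite (cmean_sum_coef (fun i => - i.+1%:Z)).
have -> : laurent g N = cmean R2 (rc (- ln 2)) - cmean R1 (rc (ln 2)).
  by rewrite E1 E2 /laurent big_split /=; ring.
have B0 : 0 <= B.
  by rewrite (le_trans (cmod_ge0 (g 1)))// gB// cmod1; lra.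
have P0 : 0 <= B / 2 ^+ N by rewrite divr_ge0// exprn_ge0.
have b1 : cmod (cmean R1 (rc (ln 2))) <= 2 * (B / 2 ^+ N).
  apply: (cmean_le cR1) => t; rewrite /R1 /F1.
  set z := cexp _.
  have z2 : cmod z = 2 by rewrite cmod_cexp creD /= addr0 lnK ?posrE.
  have z0 : z != 0 by rewrite -cmod_gt0 z2.
  have zm : 1 <= cmod (z - 1).
    have := cmodD (z - 1) 1; rewrite subrK cmod1 z2; lra.
  have z1 : z != 1 by rewrite -subr_eq0 -cmod_gt0; lra.
  have z10 : z - 1 != 0 by rewrite subr_eq0.
  rewrite qE// mulN1r.
  have -> : z * (g z / (z - 1)) - \sum_(i < N) g z * z ^ (- i%:Z)
      = g z * (z^-1 ^+ N * (z / (z - 1))).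
    elim: N {cF1 cF2 F1 F2 R1 R2 cR1 cR2 E1 E2 P0} => [|N IH].
      by rewrite big_ord0 expr0 subr0; ring.
    rewrite big_ord_recr /= opprD addrA IH -exprnN -exprVn exprS.
    by field; rewrite z10 z0.
  have gz : cmod (g z) <= B by apply: gB; rewrite z2; lra.
  rewrite cmodM [2 * _]mulrC -mulrA ler_pM ?cmod_ge0// !cmodM cmodX !cmodV z2 exprVn.
  rewrite ler_pM2l ?invr_gt0 ?exprn_gt0// ler_pdivrMr; last by lra.
  lra.
have b2 : cmod (cmean R2 (rc (- ln 2))) <= B / 2 ^+ N.
  apply: (cmean_le cR2) => t; rewrite /R2 /F2.
  set z := cexp _.
  have z2 : cmod z = 2^-1 by rewrite cmod_cexp creD /= addr0 expRN lnK ?posrE.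
  have z0 : z != 0 by rewrite -cmod_gt0 z2 invr_gt0.
  have zm : 1 / 2 <= cmod (z - 1).
    have := cmodD (1 - z) z; rewrite subrK cmod1 [cmod (1 - z)]cmodBC z2; lra.
  have z1 : z != 1 by rewrite -subr_eq0 -cmod_gt0; lra.
  have z10 : z - 1 != 0 by rewrite subr_eq0.
  rewrite qE//.
  have -> : z * (g z / (z - 1)) + \sum_(i < N) g z * z ^ (- - i.+1%:Z)
      = g z * (z ^+ N * (z / (z - 1))).
    elim: N {cF1 cF2 F1 F2 R1 R2 cR1 cR2 E1 E2 P0 b1} => [|N IH].
      by rewrite big_ord0 expr0 addr0; ring.
    rewrite big_ord_recr /= addrA IH opprK -exprnP !exprS.
    by field.
  have gz : cmod (g z) <= B by apply: gB; rewrite z2; lra.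
  rewrite cmodM ler_pM ?cmod_ge0// !cmodM cmodX cmodV z2 exprVn.
  rewrite ler_piMr ?invr_ge0 ?exprn_ge0// ler_pdivrMr; last by lra.
  lra.
rewrite (le_trans (cmodB _ _))//.
have -> : 3 * B / 2 ^+ N = B / 2 ^+ N + 2 * (B / 2 ^+ N) by ring.
exact: lerD.
Qed.

(** Subtracting [h 1] gives a function to which [laurent_pole] applies and doubles the bound. The
    constant affects the coefficient of index 0 only; with [N.+1] terms this index is always
    present. *)
Lemma laurent_approx h (B : R) N : hol0 h ->
  (forall z, 1 / 2 <= cmod z <= 2 -> cmod (h z) <= B) ->
  cmod (h 1 - laurent h N.+1) <= 6 * B / 2 ^+ N.+1.
Proof.
move=> hh hB.
have := @laurent_pole (fun z => h z - h 1) (B + B) N.+1.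
have -> : laurent (fun z => h z - h 1) N.+1 = laurent h N.+1 - h 1.
  have Lk k : lcoef (fun z => h z - h 1) k = lcoef h k - h 1 * (k == 0)%:R.
    by rewrite lcoefB// ?lcoef_cst//; exact: hol0_cst.
  rewrite /laurent; under eq_bigr do rewrite !Lk.
  under eq_bigr => i _.
    have -> : (- (i.+1)%:Z == 0) = false by [].
    rewrite mulr0 subr0 addrAC; over.
  rewrite sumrB; congr (_ - _).
  rewrite big_ord_recl big1 ?addr0 ?mulr1// => i _.
  by rewrite /= mulr0.
rewrite cmodBC => H.
have -> : 6 * B / 2 ^+ N.+1 = 3 * (B + B) / 2 ^+ N.+1 by ring.
apply: H => [|| z zB].
- by apply: hol0B => //; exact: hol0_cst.
- by rewrite subrr.
- by rewrite (le_trans (cmodB _ _))// lerD// hB// cmod1; lra.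
Qed.

End Laurent.

(** * Entire functions *)

Section Compactness.
Context {R : realType}.
Local Notation C := (Cplx R).

Lemma compact_cmod_bounded (T : topologicalType) (K : set T) (f : T -> C) :
  compact K -> (forall x, K x -> {for x, continuous f}) ->
  exists2 B : R, 0 <= B & forall x, K x -> cmod (f x) <= B.
Proof.
move=> /compact_near_coveringP cK cf.
have : \forall B \near +oo, K `<=` (fun x => cmod (f x) <= B).
  apply: cK => x Kx.
  have /cvgCP/(_ _ ltr01) := cf x Kx => H.
  exists ([set y | cmod (f y - f x) < 1], [set B | cmod (f x) + 1 <= B]).
    by split => //=; apply: nbhs_pinfty_ge; rewrite num_real.
  move=> [y B] /= [yx xB]; rewrite (le_trans _ xB)//.
  by rewrite -lerBlDl (le_trans _ (ltW yx))// lerBlDl -[X in cmod X <= _](subrK (f x)) addrC cmodD.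
move=> [B [_ HB]]; exists (Num.max 0 (B + 1)); first by rewrite le_max lexx.
move=> x Kx; rewrite le_max; apply/orP; right.
by apply: (HB (B + 1)) Kx; rewrite ltrDl.
Qed.

Lemma closed_cmod_le (r : R) : closed [set z : C | cmod z <= r].
Proof.
rewrite -openC openE => z /= /negP; rewrite -ltNge => zr.
apply/nearCP; exists (cmod z - r); first by rewrite subr_gt0.
move=> w wz; apply/negP; rewrite -ltNge.
have := cmodD w (z - w); rewrite [w + _]addrC subrK [cmod (z - _)]cmodBC; move: wz; lra.
Qed.

Lemma closed_cmod_ge (r : R) : closed [set z : C | r <= cmod z].
Proof.
rewrite -openC openE => z /= /negP; rewrite -ltNge => zr.
apply/nearCP; exists (r - cmod z); first by rewrite subr_gt0.
move=> w wz; apply/negP; rewrite -ltNge.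
have := cmodD (w - z) z; rewrite subrK; move: wz; lra.
Qed.

Lemma disc_compact (r : R) : compact [set z : C | cmod z <= r].
Proof.
have -> : [set z : C | cmod z <= r] =
    ((fun p : R * R => mkC p.1 p.2) @` (`[- r, r] `*` `[- r, r])) `&` [set z | cmod z <= r].
  apply/seteqP; split=> [z /= zr|z []//]; split=> //.
  exists (cre z, cim z) => /=; last exact: mkC_eta.
  by rewrite !in_itv /= -!ler_norml (le_trans (cre_le z))// (le_trans (cim_le z)).
apply: compact_closedI.
  apply: continuous_compact.
    apply: continuous_subspaceT => p.
    by apply: mkC_cvg; [exact: cvg_fst|exact: cvg_snd].
  by apply: compact_setX; exact: segment_compact.
exact: closed_cmod_le.
Qed.

(** This carries estimates from generic points over to the exceptional ones. *)
Lemma cmod_le_adherent (G : C -> C) (e : R) (z : C) : {for z, continuous G} ->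
  (forall d : R, 0 < d -> exists2 w, cmod (w - z) < d & cmod (G w) <= e) -> cmod (G z) <= e.
Proof.
move=> cG H; rewrite leNgt; apply/negP => eG.
have /cvgCP/(_ (cmod (G z) - e)) := cG; rewrite subr_gt0 => /(_ eG) /nearCP[d d0 dP].
have [w /dP wz we] := H d d0.
have := cmodD (G w) (G z - G w); rewrite [G w + _]addrC subrK [cmod (G z - _)]cmodBC.
move: wz we; lra.
Qed.

Lemma cmod_small_eq0 (z : C) (B : R) :
  (forall N, cmod z <= B / 2 ^+ N.+1) -> z = 0.
Proof.
move=> H; apply/eqP; rewrite -cmod_eq0; apply/eqP; apply: contrapT => /eqP z0.
have zp : 0 < cmod z by rewrite lt_def z0 cmod_ge0.
have [n] := exists_exp2_gt (B / cmod z).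
rewrite ltr_pdivrMr// => nB.
have := H n; rewrite ler_pdivlMr ?exprn_gt0// exprS; move: nB.
have : 0 <= 2 ^+ n * cmod z by rewrite mulr_ge0 ?exprn_ge0// ltW.
lra.
Qed.

End Compactness.

(** * Cauchy estimates, Taylor sums and zeros *)

Section Taylor.
Context {R : realType}.
Local Notation C := (Cplx R).
Implicit Types (g h : C -> C).

Lemma hol0_bounded h (a b : R) : hol0 h -> 0 < a ->
  exists2 B : R, 0 <= B & forall z, a <= cmod z <= b -> cmod (h z) <= B.
Proof.
move=> hh a0.
have cK : compact ([set z : C | cmod z <= b] `&` [set z | a <= cmod z]).
  apply: compact_closedI; first exact: disc_compact.
  exact: closed_cmod_ge.
have ch z : ([set z : C | cmod z <= b] `&` [set z | a <= cmod z]) z -> {for z, continuous h}.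
  move=> [_ /= az]; apply: differentiable_continuous; apply: hh.
  by rewrite -cmod_gt0 (lt_le_trans a0).
have [B B0 HB] := compact_cmod_bounded cK ch.
by exists B => // z /andP[? ?]; apply: HB.
Qed.

Definition entire g := forall z, differentiable g z.

Lemma entire_hol0 g : entire g -> hol0 g.
Proof. by move=> eg z _; exact: eg. Qed.

Lemma entire_bounded g (r : R) : entire g ->
  exists2 B : R, 0 <= B & forall z, cmod z <= r -> cmod (g z) <= B.
Proof.
move=> eg; apply: (compact_cmod_bounded (@disc_compact R r)) => z _.
by apply: differentiable_continuous; exact: eg.
Qed.

Lemma lcoef_neg g i : entire g -> lcoef g (- i.+1%:Z) = 0.
Proof.
move=> eg.
have [B B0 HB] := entire_bounded 1 eg.
apply/eqP; rewrite -cmod_eq0; apply/eqP; apply: contrapT => /eqP c0.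
have cp : 0 < cmod (lcoef g (- i.+1%:Z)) by rewrite lt_def c0 cmod_ge0.
set c := cmod _ in cp.
(* On the circle of this radius the Cauchy estimate yields [c <= B * r], whereas
   [r * (B + 1) <= c]. *)
pose r := Num.min 1 (c / (B + 1)).
have r0 : 0 < r by rewrite lt_min ltr01 divr_gt0// ltr_wpDl.
have r1 : r <= 1 by rewrite ge_min lexx.
have : c <= B * r ^ (- - i.+1%:Z).
  apply: (lcoef_le _ r0 (entire_hol0 eg)) => z zr.
  by apply: HB; rewrite zr.
rewrite opprK -exprnP exprS.
have : r * r ^+ i <= r by rewrite ler_piMr ?exprn_ile1// ltW.
have rc : r * (B + 1) <= c by rewrite -ler_pdivlMr ?ltr_wpDl// ge_min lexx orbT.
move=> ri; apply/negP; rewrite -ltNge.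
by rewrite (le_lt_trans (ler_wpM2l B0 ri))//; move: rc r0; lra.
Qed.

Lemma continuous_poly_sum (c : nat -> C) N : continuous (fun w : C => \sum_(i < N) c i * w ^+ i).
Proof.
elim: N => [|N IH].
  by under eq_fun do rewrite big_ord0; exact: cst_continuous.
under eq_fun do rewrite big_ord_recr /=.
move=> w; apply: (continuousD (IH w)); apply: continuous_cmul => {}w.
by apply: differentiable_continuous; exact: differentiable_pow.
Qed.

(** This is [laurent_approx] for the dilate [z |-> g (v * z)], whose coefficients are the Taylor
    terms of [g] at [v]. Dilations need [v != 0], so the origin is reached by continuity. *)
Lemma taylor_approx g (r B : R) N w : entire g ->
  (forall z, cmod z <= 2 * r -> cmod (g z) <= B) -> cmod w <= r -> 0 < r ->
  cmod (g w - \sum_(i < N.+1) lcoef g i%:Z * w ^+ i) <= 6 * B / 2 ^+ N.+1.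
Proof.
move=> eg gB wr r0.
have main v : v != 0 -> cmod v <= r ->
    cmod (g v - \sum_(i < N.+1) lcoef g i%:Z * v ^+ i) <= 6 * B / 2 ^+ N.+1.
  move=> v0 vr.
  have hg : hol0 (fun z => g (v * z)) by apply: hol0_dil => //; exact: entire_hol0.
  have := @laurent_approx _ _ B N hg; rewrite mulr1 => H.
  have -> : \sum_(i < N.+1) lcoef g i%:Z * v ^+ i = laurent (fun z => g (v * z)) N.+1.
    apply: eq_bigr => i _; rewrite !lcoef_dil//; try exact: entire_hol0.
    by rewrite lcoef_neg// mulr0 addr0 mulrC.
  apply: H => z /andP[_ z2]; apply: gB; rewrite cmodM mulrC.
  by rewrite ler_pM// cmod_ge0.
have [->|w0] := eqVneq w 0; last exact: main.
apply: (@cmod_le_adherent _ (fun w => g w - \sum_(i < N.+1) lcoef g i%:Z * w ^+ i)).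
  apply: continuousB; first exact: differentiable_continuous (eg 0).
  exact: (continuous_poly_sum (c := fun i => lcoef g i%:Z)).
move=> d d0; pose m := Num.min (d / 2) r.
have m0 : 0 < m by rewrite lt_min r0 divr_gt0.
exists (rc m).
  by rewrite subr0 cmod_rc gtr0_norm// gt_min; apply/orP; left; lra.
apply: main; last by rewrite cmod_rc gtr0_norm// ge_min lexx orbT.
by rewrite -cmod_gt0 cmod_rc gtr0_norm.
Qed.

(** The Cauchy estimate on the given circle kills every coefficient of [h], hence of each dilate;
    the value at a point is then bounded by the remainder alone. *)
Lemma hol0_eq0_circle h (r : R) : hol0 h -> 0 < r ->
  (forall z, cmod z = r -> h z = 0) -> forall z, z != 0 -> h z = 0.
Proof.
move=> hh r0 hz z z0.
have c0 k : lcoef h k = 0.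
  apply/eqP; rewrite -cmod_eq0 eq_le cmod_ge0 andbT -(mul0r (r ^ (- k))).
  by apply: lcoef_le => // w wr; rewrite hz// cmod0.
have hd : hol0 (fun w => h (z * w)) by exact: hol0_dil.
have [B B0 HB] := hol0_bounded (a := 1 / 2) 2 hd ltac:(lra).
apply: (@cmod_small_eq0 _ _ (6 * B)) => N.
have := laurent_approx N hd HB; rewrite mulr1.
have -> : laurent (fun w => h (z * w)) N.+1 = 0.
  by rewrite /laurent big1// => i _; rewrite !lcoef_dil// !c0 !mulr0 addr0.
by rewrite subr0.
Qed.

(* At a zero w close to 0, the first nonzero Taylor term c_i w^i is dominated
   by the tail, which is O(w^i+1). *)
Lemma entire_eq0 g : entire g ->
  (forall d : R, 0 < d -> exists w, [/\ w != 0, cmod w < d & g w = 0]) ->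
  forall w, g w = 0.
Proof.
move=> eg gz.
have bounded (r : R) := entire_bounded r eg.
have [B B0 HB] := bounded 2.
have cB i : cmod (lcoef g i%:Z) <= B.
  have := @lcoef_le _ g 1 B i%:Z ltr01 (entire_hol0 eg); rewrite exp1rz mulr1; apply.
  by move=> z z1; apply: HB; rewrite z1; lra.
have c0 i : lcoef g i%:Z = 0.
  have [n] := ubnP i; elim: n i => // n IH i; rewrite ltnS => i_n.
  apply/eqP; rewrite -cmod_eq0; apply/eqP; apply: contrapT => /eqP ci0.
  set c := cmod _ in ci0.
  have cp : 0 < c by rewrite lt_def ci0 cmod_ge0.
  have B1 : 0 < 2 * B + 1 by rewrite ltr_wpDl// mulr_ge0.
  have [w [w0 wd gw]] : exists w, [/\ w != 0, cmod w < Num.min (1 / 2) (c / (2 * B + 1)) & g w = 0].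
    by apply: gz; rewrite lt_min !divr_gt0.
  have [w2 wc] : cmod w < 1 / 2 /\ cmod w * (2 * B + 1) < c.
    by move: wd; rewrite lt_min => /andP[-> /=]; rewrite ltr_pdivlMr.
  set m := cmod w in wd w2 wc.
  have mp : 0 < m by rewrite cmod_gt0.
  have tail N : cmod (\sum_(j < N) lcoef g (i.+1 + j)%:Z * w ^+ (i.+1 + j)) <= 2 * B * m ^+ i.+1.
    have -> : 2 * B * m ^+ i.+1 = B * m ^+ i.+1 * 2 by ring.
    (* The term [- 2 * m ^+ N] strengthens the claim so that the induction closes, thanks to
       [m < 1 / 2]. *)
    have : cmod (\sum_(j < N) lcoef g (i.+1 + j)%:Z * w ^+ (i.+1 + j)) <=
        B * m ^+ i.+1 * (2 - 2 * m ^+ N).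
      elim: N => [|N IHN].
        by rewrite big_ord0 cmod0 expr0 mulr1 subrr mulr0.
      rewrite big_ord_recr /= (le_trans (cmodD _ _))//.
      have : cmod (lcoef g (i.+1 + N)%:Z * w ^+ (i.+1 + N)) <= B * (m ^+ i.+1 * m ^+ N).
        by rewrite cmodM cmodX -exprD ler_wpM2r// exprn_ge0// ltW.
      have K0 : 0 <= B * m ^+ i.+1 * m ^+ N by rewrite !mulr_ge0 ?exprn_ge0// ltW.
      have : B * m ^+ i.+1 * m ^+ N * m <= B * m ^+ i.+1 * m ^+ N * (1 / 2).
        by rewrite ler_wpM2l// ltW.
      move: IHN; rewrite [m ^+ N.+1]exprS !mulrA.
      set S := cmod _; set T := cmod _; set a := B * m ^+ i.+1; lra.
    move=> H; apply: (le_trans H); apply: ler_wpM2l.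
      by rewrite mulr_ge0// exprn_ge0// ltW.
    by rewrite lerBlDr lerDl mulr_ge0// exprn_ge0// ltW.
  (* Taylor sum up to order [i + N]: below [i] the terms vanish by induction, above [i] they are the
     tail. *)
  have approx N : cmod (lcoef g i%:Z * w ^+ i) <= 2 * B * m ^+ i.+1 + 6 * B / 2 ^+ (i + N).+1.
    have H := @taylor_approx g 1 B (i + N) w eg.
    have {H} := H _ _ ltr01; rewrite mulr1 gw sub0r cmodN => H.
    have {H} := H HB; have w1 : cmod w <= 1 by move: w2; rewrite -/m; lra.
    move=> /(_ w1); rewrite -addSn big_split_ord /= big_ord_recr /= big1 ?add0r; last first.
      by move=> j _; rewrite IH ?mul0r// (leq_trans (ltn_ord j)).
    set S := \sum_(_ < _) _; move=> H.
    have -> : lcoef g i%:Z * w ^+ i = (lcoef g i%:Z * w ^+ i + S) - S by ring.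
    rewrite (le_trans (cmodB _ _))// addrC lerD//; exact: tail.
  have key : cmod (lcoef g i%:Z * w ^+ i) <= 2 * B * m ^+ i.+1.
    rewrite leNgt; apply/negP; rewrite -subr_gt0; set D := _ - _ => D0.
    have [n' ] := exists_exp2_gt (6 * B / D); rewrite ltr_pdivrMr// => nD.
    have := approx n'; rewrite -lerBlDl -/D ler_pdivlMr ?exprn_gt0// => H.
    have : 2 ^+ n' <= 2 ^+ (i + n').+1 :> R by rewrite ler_weXn2l ?ler1n// leqW// leq_addl.
    move=> H2; have := ler_wpM2l (ltW D0) H2; move: H nD.
    rewrite [2 ^+ n' * D]mulrC; lra.
  move: key; rewrite cmodM cmodX -/m -/c exprS mulrA ler_pM2r ?exprn_gt0//.
  by move: wc mp; lra.
move=> w.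
have r0 : 0 < cmod w + 1 by rewrite ltr_wpDl// cmod_ge0.
have [B' B'0 HB'] := bounded (2 * (cmod w + 1)).
apply: (@cmod_small_eq0 _ _ (6 * B')) => N.
have wr : cmod w <= cmod w + 1 by rewrite lerDl.
have := taylor_approx N eg HB' wr r0.
by rewrite big1 ?subr0// => i _; rewrite c0 mul0r.
Qed.

(* Exchanging the two expansions: the coefficient functional in the first
   variable is applied termwise to the Taylor sums in the second one. *)
Lemma lcoef_param_approx (phi : C -> C -> C) (r B : R) (k : int) N : 0 < r ->
  (forall w, hol0 (phi ^~ w)) -> (forall t, t != 0 -> entire (phi t)) ->
  continuous (fun p : C * C => phi (cexp p.1) p.2) ->
  (forall t w, cmod t = 1 -> cmod w <= 2 * r -> cmod (phi t w) <= B) ->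
  exists c : nat -> C, forall w, cmod w <= r ->
    cmod (lcoef (phi ^~ w) k - \sum_(l < N.+1) c l * w ^+ l) <= 6 * B / 2 ^+ N.+1.
Proof.
move=> r0 h1 h2 cphi phiB.
(* The Taylor coefficients in the second variable, as functions of the logarithm of the first.
   Continuity is needed for their circle means to be linear. *)
pose a (l : nat) s := lcoef (phi (cexp s)) l%:Z.
have ca l : continuous (a l).
  have cg : continuous (fun p : C * R =>
      phi (cexp p.1) (cexp (0 + mkC 0 p.2)) * cexp (0 + mkC 0 p.2) ^ (- l%:Z)).
    have c2 (p : C * R) : (0 + mkC 0 q.2 : C) @[q --> p] --> (0 + mkC 0 p.2 : C).
      apply: cvgD; first exact: cvg_cst.
      by apply: mkC_cvg; [exact: cvg_cst|exact: cvg_snd].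
    move=> p; apply: cvgM.
      apply: (@continuous_comp _ _ _ (fun p : C * R => (p.1, cexp (0 + mkC 0 p.2)) : C * C)
        (fun p : C * C => phi (cexp p.1) p.2)); last exact: cphi.
      apply: (@cvg_pair _ _ _ (nbhs p) (nbhs p.1) (nbhs (cexp (0 + mkC 0 p.2))) _ _ _
        fst (fun p => cexp (0 + mkC 0 p.2)) cvg_fst).
      apply: (@continuous_comp _ _ _ (fun p : C * R => 0 + mkC 0 p.2 : C) cexp).
        exact: c2.
      exact: cexp_continuous.
    apply: (@continuous_comp _ _ _ (fun p : C * R => 0 + mkC 0 p.2 : C)
      (fun s => cexp s ^ (- l%:Z))); first exact: c2.
    exact: (hol0_continuous_cexp (hol0_expz (- l%:Z))).
  move=> s; apply: (@cvgMl _ _ (nbhs s) _ (fun s => cint _ 0 period)).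
  exact: (@cint_param R _ (fun s t => phi (cexp s) (cexp (0 + mkC 0 t)) *
    cexp (0 + mkC 0 t) ^ (- l%:Z)) 0 period s (ltW (@period_gt0 R)) cg).
have cak l : continuous (fun s => a l s * cexp s ^ (- k)).
  move=> s.
  exact: (@continuousM _ _ (a l) (fun s => cexp s ^ (- k)) s (ca l s)
    (hol0_continuous_cexp (hol0_expz (- k)) (x := s))).
exists (fun l => cmean (fun s => a l s * cexp s ^ (- k)) 0) => w wr.
have [cS ES] := @cmean_sum R (fun l s => w ^+ l * (a l s * cexp s ^ (- k))) N.+1 0
  (fun l => continuous_cmul (k := w ^+ l) (cak l)).
have -> : \sum_(l < N.+1) cmean (fun s => a l s * cexp s ^ (- k)) 0 * w ^+ l =
    cmean (fun s => \sum_(l < N.+1) w ^+ l * (a l s * cexp s ^ (- k))) 0.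
  rewrite ES; apply: eq_bigr => l _.
  by rewrite (cmeanZ _ _ (cak l)) mulrC.
have c1 := continuous_coef (k := k) (h1 w).
rewrite -[X in cmod (_ + X)]mulN1r -(cmeanZ _ _ cS) /lcoef /circ.
rewrite -(cmeanD _ c1 (continuous_cmul (k := -1) cS)).
apply: cmean_le.
  by move=> s; exact: (continuousD (c1 s) (continuous_cmul (k := -1) cS (x := s))).
move=> t; rewrite add0r; set z := cexp _.
have z1 : cmod z = 1 by exact: cmod_cis.
have z0 : z != 0 by exact: cexp_neq0.
have zk : cmod (z ^ (- k)) = 1.
  by case: (- k) => n; rewrite ?NegzE -?exprnN ?cmodV /= cmodX z1 expr1n ?invr1.
have -> : phi z w * z ^ (- k) + -1 * (\sum_(l < N.+1) w ^+ l * (a l (mkC 0 t) * z ^ (- k))) =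
   (phi z w - \sum_(l < N.+1) lcoef (phi z) l%:Z * w ^+ l) * z ^ (- k).
  rewrite mulN1r mulrBl mulr_suml; congr (_ - _); apply: eq_bigr => l _.
  by rewrite mulrCA mulrA mulrAC.
rewrite cmodM zk mulr1.
apply: taylor_approx wr r0; first exact: h2.
by move=> v vr; exact: phiB.
Qed.

End Taylor.

(** * Gauge-invariant functions on the quadric *)

Section Quadric.
Context {R : realType}.
Local Notation C := (Cplx R).

Section Pointwise.
Context {T : topologicalType}.
Implicit Types (f g : T -> C) (x : T).

Lemma cts_mul f g x : {for x, continuous f} -> {for x, continuous g} ->
  {for x, continuous (fun y => f y * g y)}.
Proof. exact: continuousM. Qed.
Lemma cts_add f g x : {for x, continuous f} -> {for x, continuous g} ->
  {for x, continuous (fun y => f y + g y)}.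
Proof. exact: continuousD. Qed.
Lemma cts_sub f g x : {for x, continuous f} -> {for x, continuous g} ->
  {for x, continuous (fun y => f y - g y)}.
Proof. exact: continuousB. Qed.
Lemma cts_cst (a : C) x : {for x, continuous (fun=> a : C)}.
Proof. exact: cst_continuous. Qed.
Lemma cts_exp f n x : {for x, continuous f} -> {for x, continuous (fun y => f y ^+ n)}.
Proof.
move=> cf; elim: n => [|n IH]; first exact: cts_cst.
have -> : (fun y => f y ^+ n.+1) = (fun y => f y * f y ^+ n).
  by apply/funext => y; rewrite exprS.
exact: (cts_mul cf IH).
Qed.
Lemma cts_sum (F : nat -> T -> C) n x : (forall i, {for x, continuous (F i)}) ->
  {for x, continuous (fun y => \sum_(i < n) F i y)}.
Proof.
move=> cF; elim: n => [|n IH].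
  have -> : (fun y => \sum_(i < 0) F i y) = (fun=> 0 : C).
    by apply/funext => y; rewrite big_ord0.
  exact: cts_cst.
have -> : (fun y => \sum_(i < n.+1) F i y) = (fun y => \sum_(i < n) F i y + F n y).
  by apply/funext => y; rewrite big_ord_recr.
exact: (cts_add IH (cF n)).
Qed.
End Pointwise.

Lemma lin_neq0_near (p q : C) : (p != 0) || (q != 0) ->
  \forall t \near (0 : C), t != 0 -> p + q * t != 0.
Proof.
have [->|p0] := eqVneq p 0; last first.
  move=> _; have /cvgCP/(_ (cmod p)) := @continuous_affine R p q 0.
  rewrite mulr0 addr0 cmod_gt0 => /(_ p0); apply: filterS => t tp _.
  by apply: contraTneq tp => ->; rewrite sub0r cmodN ltxx.
move=> /= q0; apply: filterE => t t0.
by rewrite add0r mulf_neq0.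
Qed.

Lemma punctured_le (G : C -> C) (e : R) : {for 0, continuous G} ->
  (\forall t \near (0 : C), t != 0 -> cmod (G t) <= e) -> cmod (G 0) <= e.
Proof.
move=> cG /nearCP[r r0 rP]; apply: cmod_le_adherent => // d d0.
pose m := Num.min d r / 2.
have m0 : 0 < m by rewrite divr_gt0// lt_min d0.
have md : m < d.
  by rewrite ltr_pdivrMr// mulr_natr mulr2n (le_lt_trans (_ : _ <= d))// ?ge_min ?lexx// ltrDl.
have mr : m < r.
  by rewrite ltr_pdivrMr// mulr_natr mulr2n (le_lt_trans (_ : _ <= r))// ?ge_min ?lexx ?orbT// ltrDl.
exists (rc m); first by rewrite subr0 cmod_rc gtr0_norm.
apply: rP; first by rewrite subr0 cmod_rc gtr0_norm.
by rewrite -cmod_gt0 cmod_rc gtr0_norm.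
Qed.

Variable nu : C.
Hypothesis nu2 : nu * nu = 1.

Definition onQ (a b c d : C) : Prop := a * c + nu * (b * d) = 1.

(** The quadric is not open in [C ^ 4], so [f] itself cannot be asked to be differentiable;
    regularity is assumed along families of points of the quadric. *)
Variable f : C -> C -> C -> C -> C.
Hypothesis f_gauge : forall t a b c d : C, t != 0 -> onQ a b c d ->
  f (t * a) (t * b) (c / t) (d / t) = f a b c d.
Hypothesis f_hol : forall (a b c d : C -> C) (t : C),
  differentiable a t -> differentiable b t -> differentiable c t -> differentiable d t ->
  (\forall s \near t, onQ (a s) (b s) (c s) (d s)) ->
  differentiable (fun s => f (a s) (b s) (c s) (d s)) t.
Hypothesis f_cts : forall (T : topologicalType) (a b c d : T -> C) x,
  {for x, continuous a} -> {for x, continuous b} ->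
  {for x, continuous c} -> {for x, continuous d} ->
  (\forall y \near x, onQ (a y) (b y) (c y) (d y)) ->
  {for x, continuous (fun y => f (a y) (b y) (c y) (d y))}.

(** The four products are gauge-invariant; boxes play the role of compact sets of gauge orbits. *)
Definition in_box (r : R) (a b c d : C) : Prop :=
  [/\ cmod (a * c) <= r, cmod (a * d) <= r, cmod (b * c) <= r & cmod (b * d) <= r].

(** The gauge brings the larger of [a] and [b] to 1. The other one then lies in the unit disc, and
    the remaining free coordinate is one of the products bounded by [r]. Thus two compact charts
    suffice, [f1] and [f2]. *)
Lemma quadric_bounded r : exists2 B : R, 0 <= B &
  forall a b c d, onQ a b c d -> in_box r a b c d -> cmod (f a b c d) <= B.
Proof.
pose f1 (p : C * C) := f 1 p.1 (1 - nu * (p.1 * p.2)) p.2.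
pose f2 (p : C * C) := f p.1 1 p.2 (nu * (1 - p.1 * p.2)).
have fstc (p : C * C) : {for p, continuous (fun p : C * C => p.1)} by exact: cvg_fst.
have sndc (p : C * C) : {for p, continuous (fun p : C * C => p.2)} by exact: cvg_snd.
have c1 p : {for p, continuous f1}.
  apply: f_cts; [exact: cts_cst|exact: fstc| |exact: sndc|].
    apply: cts_sub; first exact: cts_cst.
    by apply: cts_mul; [exact: cts_cst|exact: (cts_mul (fstc p) (sndc p))].
  by apply: filterE => q; rewrite /onQ; ring.
have c2 p : {for p, continuous f2}.
  apply: f_cts; [exact: fstc|exact: cts_cst|exact: sndc| |].
    apply: cts_mul; first exact: cts_cst.
    by apply: cts_sub; [exact: cts_cst|exact: (cts_mul (fstc p) (sndc p))].
  by apply: filterE => q; rewrite /onQ mul1r mulrA nu2; ring.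
have cK := compact_setX (@disc_compact R 1) (@disc_compact R r).
have [B1 B10 H1] := compact_cmod_bounded cK (fun x _ => c1 x).
have [B2 B20 H2] := compact_cmod_bounded cK (fun x _ => c2 x).
exists (B1 + B2) => [|a b c d Q [ac ad bc bd]]; first exact: addr_ge0.
have [ba|/ltW ab] := leP (cmod b) (cmod a).
  have a0 : a != 0.
    apply/eqP => a0; move: ba; rewrite a0 cmod0 le_eqVlt ltNge cmod_ge0 orbF cmod_eq0.
    move=> /eqP b0; move: Q; rewrite /onQ a0 b0 !mul0r mulr0 addr0 => /eqP.
    by rewrite eq_sym oner_eq0.
  rewrite -(@f_gauge a^-1) ?invr_eq0// invrK mulVf//.
  have E : c * a = 1 - nu * (a^-1 * b * (d * a)).
    by rewrite -Q; field.
  rewrite E (le_trans (H1 (a^-1 * b, d * a) _)) ?lerDl//.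
  split => /=; last by rewrite mulrC.
  by rewrite cmodM cmodV mulrC ler_pdivrMr ?cmod_gt0// mul1r.
have b0 : b != 0.
  apply/eqP => b0; move: ab; rewrite b0 cmod0 le_eqVlt ltNge cmod_ge0 orbF cmod_eq0.
  move=> /eqP a0; move: Q; rewrite /onQ a0 b0 !mul0r mulr0 addr0 => /eqP.
  by rewrite eq_sym oner_eq0.
rewrite -(@f_gauge b^-1) ?invr_eq0// invrK mulVf//.
have E : d * b = nu * (1 - b^-1 * a * (c * b)).
  rewrite -Q -[LHS]mul1r -nu2; field.
  exact: b0.
rewrite E (le_trans (H2 (b^-1 * a, c * b) _)) ?lerDr//.
split => /=; last by rewrite mulrC.
by rewrite cmodM cmodV mulrC ler_pdivrMr ?cmod_gt0// mul1r.
Qed.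

(* Off b c = 0, resp. a d = 0, the gauge moves a point of the quadric to these
   forms, in which t = b c, resp. t^-1 = a d, and w = nu b d. *)
Definition phi (t w : C) := f (1 - w) t 1 (nu * w / t).
Definition psi (t w : C) := f 1 (nu * w * t) (1 - w) t^-1.

Lemma phi_onQ t w : t != 0 -> onQ (1 - w) t 1 (nu * w / t).
Proof. by move=> t0; rewrite /onQ [t * _]mulrC divfK// mulr1 mulrA nu2 mul1r subrK. Qed.

Lemma psi_onQ t w : t != 0 -> onQ 1 (nu * w * t) (1 - w) t^-1.
Proof. by move=> t0; rewrite /onQ mulfK// mulrA nu2 !mul1r subrK. Qed.

Lemma near_neq0 (t : C) : t != 0 -> \forall s \near t, s != 0.
Proof.
move=> t0; apply/nearCP; exists (cmod t); first by rewrite cmod_gt0.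
by move=> s; apply: contraTneq => ->; rewrite sub0r cmodN ltxx.
Qed.

Let dcst (a t : C) : differentiable (fun=> a : C) t. Proof. exact: differentiable_cst. Qed.

Lemma phi_hol0 w : hol0 (phi ^~ w).
Proof.
move=> t t0; apply: f_hol; [exact: dcst|exact: differentiable_idC|exact: dcst| |].
  apply: differentiableM; first exact: dcst.
  by apply: differentiableV => //; exact: differentiable_idC.
by apply: filterS (near_neq0 t0) => s; exact: phi_onQ.
Qed.

Lemma psi_hol0 w : hol0 (psi ^~ w).
Proof.
move=> t t0; apply: f_hol; [exact: dcst| |exact: dcst| |].
- by apply: differentiableM; [exact: dcst|exact: differentiable_idC].
- by apply: differentiableV => //; exact: differentiable_idC.
by apply: filterS (near_neq0 t0) => s; exact: psi_onQ.
Qed.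

Lemma phi_entire t : t != 0 -> entire (phi t).
Proof.
move=> t0 w; apply: f_hol; [|exact: dcst|exact: dcst| |].
- by apply: differentiableB; [exact: dcst|exact: differentiable_idC].
- apply: differentiableM; last exact: dcst.
  by apply: differentiableM; [exact: dcst|exact: differentiable_idC].
by apply: filterE => s; exact: phi_onQ.
Qed.

Lemma psi_entire t : t != 0 -> entire (psi t).
Proof.
move=> t0 w; apply: f_hol; [exact: dcst| | |exact: dcst|].
- apply: differentiableM; last exact: dcst.
  by apply: differentiableM; [exact: dcst|exact: differentiable_idC].
- by apply: differentiableB; [exact: dcst|exact: differentiable_idC].
by apply: filterE => s; exact: psi_onQ.
Qed.

Let cexp_fst (p : C * C) : {for p, continuous (fun p : C * C => cexp p.1)}.
Proof.
apply: (@continuous_comp _ _ _ (fun p : C * C => p.1) cexp); first exact: cvg_fst.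
exact: cexp_continuous.
Qed.
Let cexpV_fst (p : C * C) : {for p, continuous (fun p : C * C => (cexp p.1)^-1)}.
Proof.
apply: (@continuous_comp _ _ _ (fun p : C * C => p.1) (fun s => (cexp s)^-1)).
  exact: cvg_fst.
exact: (hol0_continuous_cexp (hol0_expz (-1))).
Qed.
Let snd_cts (p : C * C) : {for p, continuous (fun p : C * C => p.2)}.
Proof. exact: cvg_snd. Qed.

Lemma phi_continuous : continuous (fun p : C * C => phi (cexp p.1) p.2).
Proof.
move=> p; apply: (@f_cts _ (fun p : C * C => 1 - p.2) (fun p => cexp p.1) (fun=> 1)
  (fun p => nu * p.2 / cexp p.1) p); [|exact: cexp_fst|exact: cts_cst| |].
- by apply: cts_sub; [exact: cts_cst|exact: snd_cts].
- apply: cts_mul; last exact: cexpV_fst.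
  by apply: cts_mul; [exact: cts_cst|exact: snd_cts].
by apply: filterE => q; apply: phi_onQ; exact: cexp_neq0.
Qed.

Lemma psi_continuous : continuous (fun p : C * C => psi (cexp p.1) p.2).
Proof.
move=> p; apply: (@f_cts _ (fun=> 1) (fun p : C * C => nu * p.2 * cexp p.1) (fun p => 1 - p.2)
  (fun p => (cexp p.1)^-1) p); [exact: cts_cst| | |exact: cexpV_fst|].
- apply: cts_mul; last exact: cexp_fst.
  by apply: cts_mul; [exact: cts_cst|exact: snd_cts].
- by apply: cts_sub; [exact: cts_cst|exact: snd_cts].
by apply: filterE => q; apply: psi_onQ; exact: cexp_neq0.
Qed.

(** The torus action by [z] becomes a dilation of the first argument of [phi] and fixes the second
    one. Through [lcoef_dil], this pulls powers of [b c] out of the Laurent coefficients. *)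
Lemma phiE a b c d z : onQ a b c d -> b != 0 -> c != 0 -> z != 0 ->
  f a (z * b) c (d / z) = phi (b * c * z) (nu * (b * d)).
Proof.
move=> Q b0 c0 z0.
rewrite -(@f_gauge c) ?mulfV//; last first.
  by rewrite /onQ -[RHS]Q; field.
rewrite /phi; congr f.
- by rewrite -Q; ring.
- by ring.
- by rewrite [nu * (nu * _)]mulrA nu2 mul1r; field; rewrite z0 c0.
Qed.

Lemma psiE a b c d z : onQ a b c d -> a != 0 -> d != 0 -> z != 0 ->
  f a (z * b) c (d / z) = psi ((a * d)^-1 * z) (nu * (b * d)).
Proof.
move=> Q a0 d0 z0.
rewrite -(@f_gauge a^-1) ?invr_eq0// ?mulVf//; last first.
  by rewrite /onQ -[RHS]Q; field.
rewrite /psi; congr f.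
- by rewrite [nu * (nu * _)]mulrA nu2 mul1r; field; rewrite a0 d0.
- by rewrite -Q; field.
- by field; rewrite a0 d0.
Qed.

Lemma eq_coef (h g : C -> C) (k : int) : (forall z, z != 0 -> h z = g z) -> lcoef h k = lcoef g k.
Proof. by move=> E; apply: eq_cmean => s; rewrite E// cexp_neq0. Qed.

(** The index [k] of [p] belongs to the Laurent coefficient of index [k], that of [q] to index
    [- k.+1]. The product [a c] does not occur because it equals [1 - w] on the quadric. *)
Definition bipoly N L (p q : nat -> nat -> C) (a b c d : C) : C :=
  \sum_(k < N) (\sum_(l < L) p k l * ((b * c) ^+ k * (nu * (b * d)) ^+ l)
              + \sum_(l < L) q k l * ((a * d) ^+ k.+1 * (nu * (b * d)) ^+ l)).

Let cnu : cmod nu = 1.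
Proof.
apply/eqP; rewrite -(@pexpr_eq1 _ _ 2) ?cmod_ge0//.
by rewrite expr2 -cmodM nu2 cmod1.
Qed.

Let nu_neq0 : nu != 0.
Proof. by rewrite -cmod_gt0 cnu. Qed.

Lemma phi_bounded r : 0 <= r -> exists2 B : R, 0 <= B &
  forall t w, cmod t = 1 -> cmod w <= r -> cmod (phi t w) <= B /\ cmod (psi t w) <= B.
Proof.
move=> r0; have [B B0 HB] := quadric_bounded ((1 + r) * (1 + r)).
exists B => // t w t1 wr.
have t0 : t != 0 by rewrite -cmod_gt0 t1.
have w1 : cmod (1 - w) <= 1 + r.
  by rewrite (le_trans (cmodB _ _))// cmod1 lerD2l.
have rr : 0 <= r * r by rewrite mulr_ge0.
have tV : cmod t^-1 = 1 by rewrite cmodV t1 invr1.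
have w1r : cmod (1 - w) * cmod w <= (1 + r) * (1 + r).
  by rewrite ler_pM ?cmod_ge0// (le_trans wr)// lerDr.
split; apply: HB.
- exact: phi_onQ.
- split; rewrite !cmodM ?tV ?t1 ?cmod1 ?cnu ?mulr1 ?mul1r//; move: w1 wr; lra.
- exact: psi_onQ.
- split; rewrite !cmodM ?tV ?t1 ?cmod1 ?cnu ?mulr1 ?mul1r//; move: w1 wr w1r;
    rewrite ?[cmod w * _]mulrC; lra.
Qed.

(** Expand the torus orbit [h] of the point at [z = 1]. Nonnegative indices give [(b c) ^+ k] times
    a function of [w] coming from [phi], negative ones [(a d) ^+ k.+1] times one coming from [psi].
    These powers are bounded on the box, so the functions of [w] may be replaced by Taylor sums. *)
Lemma generic_approx (r e : R) : 1 <= r -> 0 < e -> exists N L p q,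
  forall a b c d, onQ a b c d -> in_box r a b c d -> b * c != 0 -> a * d != 0 ->
  cmod (f a b c d - bipoly N L p q a b c d) <= e.
Proof.
move=> r1 e0; have r0 : 0 < r by apply: lt_le_trans r1.
(* For [1 / 2 <= cmod z <= 2] the torus action at most doubles the products, hence the box of size
   [2 * r]. *)
have [B1 B10 HB1] := quadric_bounded (2 * r).
have [B2 B20 HB2] := @phi_bounded (2 * r) ltac:(by rewrite mulr_ge0// ltW).
have [N NP] := exists_exp2_gt (12 * B1 / e).
(* There are [2 * N.+1] coefficients, each multiplied by a power bounded by [r ^+ N.+1] since
   [1 <= r]. Therefore [L] is chosen after [N], to beat this factor. *)
set K : R := 2 * N.+1%:R * r ^+ N.+1.
have K0 : 0 < K by rewrite !mulr_gt0 ?ltr0n ?exprn_gt0.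
have [L LP] := exists_exp2_gt (12 * (K * B2) / e).
have /choice[p pP] : forall k : nat, exists c : nat -> C, forall w, cmod w <= r ->
    cmod (lcoef (phi ^~ w) k%:Z - \sum_(l < L.+1) c l * w ^+ l) <= 6 * B2 / 2 ^+ L.+1.
  move=> k; exact: (lcoef_param_approx k%:Z L r0 phi_hol0 phi_entire phi_continuous
    (fun t w t1 w1 => proj1 (HB2 t w t1 w1))).
have /choice[q qP] : forall k : nat, exists c : nat -> C, forall w, cmod w <= r ->
    cmod (lcoef (psi ^~ w) (- k.+1%:Z) - \sum_(l < L.+1) c l * w ^+ l) <= 6 * B2 / 2 ^+ L.+1.
  move=> k; exact: (lcoef_param_approx (- k.+1%:Z) L r0 psi_hol0 psi_entire psi_continuous
    (fun t w t1 w1 => proj2 (HB2 t w t1 w1))).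
exists N.+1, L.+1, p, q => a b c d Q [ac ad bc bd] bc0 ad0.
have [b0 c0] : b != 0 /\ c != 0 by move: bc0; rewrite mulf_eq0 negb_or => /andP.
have [a0 d0] : a != 0 /\ d != 0 by move: ad0; rewrite mulf_eq0 negb_or => /andP.
pose h z := f a (z * b) c (d / z).
set w := nu * (b * d).
have wr : cmod w <= r by rewrite cmodM cnu mul1r.
have hphi z : z != 0 -> h z = phi (b * c * z) w by exact: phiE.
have hpsi z : z != 0 -> h z = psi ((a * d)^-1 * z) w by exact: psiE.
have zQ z : z != 0 -> onQ a (z * b) c (d / z) by move=> z0; rewrite /onQ -[RHS]Q; field.
have hh : hol0 h.
  move=> z z0; apply: f_hol; [exact: dcst| |exact: dcst| |].
  - by apply: differentiableM; [exact: differentiable_idC|exact: dcst].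
  - apply: differentiableM; first exact: dcst.
    by apply: differentiableV => //; exact: differentiable_idC.
  by apply: filterS (near_neq0 z0) => s; exact: zQ.
have hB z : 1 / 2 <= cmod z <= 2 -> cmod (h z) <= B1.
  move=> /andP[z1 z2].
  have zp : 0 < cmod z by apply: lt_le_trans z1.
  have z0 : z != 0 by rewrite -cmod_gt0.
  have zV : cmod z^-1 <= 2 by rewrite cmodV -div1r ler_pdivrMr//; move: z1; lra.
  have zn := cmod_ge0 z; have zVn := cmod_ge0 z^-1.
  apply: HB1; first exact: zQ.
  have r2 : r <= 2 * r by rewrite mulr_natl mulr2n lerDl ltW.
  split; first exact: le_trans ac r2.
  - by rewrite mulrA cmodM [2 * r]mulrC ler_pM ?cmod_ge0.
  - by rewrite -mulrA cmodM ler_pM ?cmod_ge0.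
  - have -> : z * b * (d / z) = b * d by field.
    exact: le_trans bd r2.
have := laurent_approx N hh hB.
have -> : h 1 = f a b c d by rewrite /h mul1r divr1.
have cpos k : lcoef h k%:Z = (b * c) ^+ k * lcoef (phi ^~ w) k%:Z.
  rewrite (eq_coef _ hphi).
  exact: (@lcoef_dil R (phi ^~ w) (b * c) k%:Z bc0 (phi_hol0 w)).
have cneg k : lcoef h (- k.+1%:Z) = (a * d) ^+ k.+1 * lcoef (psi ^~ w) (- k.+1%:Z).
  rewrite (eq_coef _ hpsi).
  rewrite (@lcoef_dil R (psi ^~ w) (a * d)^-1 (- k.+1%:Z)) ?invr_eq0//; last exact: psi_hol0.
  by rewrite exprz_inv opprK.
set e2 := 6 * B2 / 2 ^+ L.+1 in pP qP.
have e20 : 0 <= e2 by rewrite divr_ge0 ?exprn_ge0// mulr_ge0.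
have rk (x : C) k : (k <= N.+1)%N -> cmod x <= r -> cmod (x ^+ k) <= r ^+ N.+1.
  move=> kN xr; rewrite cmodX (@le_trans _ _ (r ^+ k))//.
    by rewrite lerXn2r ?nnegrE ?cmod_ge0// ltW.
  by rewrite ler_weXn2l.
have term (x y S : C) k : (k <= N.+1)%N -> cmod x <= r -> cmod (y - S) <= e2 ->
    cmod (x ^+ k * y - x ^+ k * S) <= r ^+ N.+1 * e2.
  by move=> kN xr yS; rewrite -mulrBr cmodM ler_pM ?cmod_ge0// rk.
have P2 : cmod (laurent h N.+1 - bipoly N.+1 L.+1 p q a b c d) <= K * e2.
  have csum n (F : nat -> C) (M : R) : (forall k, (k < n)%N -> cmod (F k) <= M) ->
      cmod (\sum_(k < n) F k) <= n%:R * M.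
    elim: n => [|n IH] FM; first by rewrite big_ord0 cmod0 mul0r.
    rewrite big_ord_recr /= (le_trans (cmodD _ _))// -natr1 mulrDl mul1r lerD ?FM//.
    by apply: IH => k kn; apply: FM; exact: ltnW.
  rewrite /laurent /bipoly -sumrB.
  have -> : K * e2 = N.+1%:R * (r ^+ N.+1 * e2 + r ^+ N.+1 * e2).
    by rewrite /K; ring.
  apply: (csum _ (fun k => lcoef h k%:Z + lcoef h (- k.+1%:Z) -
    (\sum_(l < L.+1) p k l * ((b * c) ^+ k * w ^+ l) +
     \sum_(l < L.+1) q k l * ((a * d) ^+ k.+1 * w ^+ l)))) => k kN.
  rewrite cpos cneg.
  have -> : \sum_(l < L.+1) p k l * ((b * c) ^+ k * w ^+ l) =
      (b * c) ^+ k * \sum_(l < L.+1) p k l * w ^+ l.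
    by rewrite mulr_sumr; apply: eq_bigr => l _; rewrite mulrCA.
  have -> : \sum_(l < L.+1) q k l * ((a * d) ^+ k.+1 * w ^+ l) =
      (a * d) ^+ k.+1 * \sum_(l < L.+1) q k l * w ^+ l.
    by rewrite mulr_sumr; apply: eq_bigr => l _; rewrite mulrCA.
  rewrite opprD addrACA (le_trans (cmodD _ _))// lerD// term//.
  - exact: ltnW.
  - exact: pP.
  - exact: qP.
move=> P1.
set l1 := laurent h N.+1 in P1 P2 *.
have -> : f a b c d - bipoly N.+1 L.+1 p q a b c d =
  (f a b c d - l1) + (l1 - bipoly N.+1 L.+1 p q a b c d) by ring.
rewrite (le_trans (cmodD _ _))//.
have pow2 n : 2 ^+ n <= 2 ^+ n.+1 :> R by rewrite ler_weXn2l ?ler1n.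
have h1 : 6 * B1 / 2 ^+ N.+1 <= e / 2.
  move: NP; rewrite ltr_pdivrMr// => NP.
  rewrite ler_pdivrMr ?exprn_gt0//.
  have := ler_wpM2r (ltW e0) (pow2 N); move: NP; lra.
have h2 : K * e2 <= e / 2.
  move: LP; rewrite ltr_pdivrMr// => LP.
  rewrite /e2 mulrA ler_pdivrMr ?exprn_gt0//.
  have := ler_wpM2r (ltW e0) (pow2 L); move: LP; lra.
by have := lerD (le_trans P1 h1) (le_trans P2 h2); rewrite -splitr.
Qed.

Let lin_cts (p q t : C) : {for t, continuous (fun s : C => p + q * s)}.
Proof. exact: continuous_affine. Qed.

Lemma near_cmod_le (p : C -> C) (r r' : R) : {for 0, continuous p} ->
  cmod (p 0) <= r -> r < r' -> \forall t \near (0 : C), cmod (p t) <= r'.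
Proof.
move=> cp pr rr'; have /cvgCP/(_ (r' - r)) := cp; rewrite subr_gt0 => /(_ rr').
apply: filterS => t tp; have := cmodD (p t - p 0) (p 0); rewrite subrK.
move: tp pr; lra.
Qed.

(** * Passage from generic points to all points of the quadric *)

Section Density.
Variables (g : C -> C -> C -> C -> C) (e : R).
Hypothesis g_cts : forall (T : topologicalType) (a b c d : T -> C) x,
  {for x, continuous a} -> {for x, continuous b} ->
  {for x, continuous c} -> {for x, continuous d} ->
  {for x, continuous (fun y => g (a y) (b y) (c y) (d y))}.

Let estimate r (P : C -> C -> C -> C -> bool) := forall a b c d, onQ a b c d ->
  in_box r a b c d -> P a b c d -> cmod (f a b c d - g a b c d) <= e.

Lemma onQ_neq0 a b c d : onQ a b c d -> ((a != 0) || (b != 0)) && ((c != 0) || (d != 0)).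
Proof.
rewrite /onQ -!negb_and -negb_or => Q; apply/negP => /orP[] /andP[/eqP E1 /eqP E2];
  by move/eqP: Q; rewrite E1 E2 ?(mul0r, mulr0, addr0) eq_sym oner_eq0.
Qed.

(** A point is approached along a line inside the quadric that meets the bad set at [t = 0] only,
    near 0. The larger box absorbs the motion of the products. *)
Lemma estimate_curve r r' (P : C -> C -> C -> C -> bool) a b c d (a1 b1 c1 d1 : C) :
  r < r' -> estimate r' P -> in_box r a b c d ->
  (forall t, onQ (a + a1 * t) (b + b1 * t) (c + c1 * t) (d + d1 * t)) ->
  (\forall t \near (0 : C), t != 0 -> P (a + a1 * t) (b + b1 * t) (c + c1 * t) (d + d1 * t)) ->
  cmod (f a b c d - g a b c d) <= e.
Proof.
move=> rr' E [ac ad bc bd] Q nP.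
pose G t := f (a + a1 * t) (b + b1 * t) (c + c1 * t) (d + d1 * t) -
  g (a + a1 * t) (b + b1 * t) (c + c1 * t) (d + d1 * t).
have cG : {for 0, continuous G}.
  apply: cts_sub.
    apply: f_cts; [exact: lin_cts|exact: lin_cts|exact: lin_cts|exact: lin_cts|].
    by apply: filterE => t; exact: Q.
  by apply: g_cts; exact: lin_cts.
have near2 (p p1 q q1 : C) : cmod (p * q) <= r ->
    \forall t \near (0 : C), cmod ((p + p1 * t) * (q + q1 * t)) <= r'.
  move=> pq; apply: (near_cmod_le _ _ rr').
    by apply: cts_mul; exact: lin_cts.
  by rewrite !mulr0 !addr0.
have -> : f a b c d - g a b c d = G 0 by rewrite /G !mulr0 !addr0.
apply: punctured_le => //.
near=> t => t0; apply: E; first exact: Q.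
  by split; near: t; exact: near2.
by move: t0; near: t.
Unshelve. all: by end_near. Qed.

Lemma estimate_dense_bc r r' : r < r' ->
  estimate r' (fun a b c d => b * c != 0) -> estimate r (fun _ _ _ _ => true).
Proof.
move=> rr' E a b c d Q box _.
have := onQ_neq0 Q; rewrite orbC => /andP[ab cd].
(* The changes of [a c] and of [nu b d] along this line cancel. By [onQ_neq0] neither [b + a t] nor
   [c - nu d t] vanishes identically. *)
apply: (estimate_curve (a1 := 0) (b1 := a) (c1 := - nu * d) (d1 := 0) rr' E box).
  by move=> t; rewrite /onQ -[RHS]Q; ring.
have cd' : (c != 0) || (- nu * d != 0).
  by rewrite mulf_eq0 negb_or oppr_eq0 nu_neq0.
near=> t => t0; rewrite mulf_neq0//; move: t0; near: t; exact: lin_neq0_near.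
Unshelve. all: by end_near. Qed.

Lemma estimate_dense_ad r r' : r < r' ->
  estimate r' (fun a b c d => (b * c != 0) && (a * d != 0)) ->
  estimate r (fun a b c d => b * c != 0).
Proof.
move=> rr' E a b c d Q box bc.
have [b0 c0] : b != 0 /\ c != 0 by move: bc; rewrite mulf_eq0 negb_or => /andP.
(* This line moves [a] and [d] but keeps [b] and [c], so [b c != 0] persists; it stays in the
   quadric because [nu * nu = 1]. *)
apply: (estimate_curve (a1 := b) (b1 := 0) (c1 := 0) (d1 := - nu * c) rr' E box).
  move=> t; rewrite /onQ -[RHS]Q.
  have -> : (a + b * t) * (c + 0 * t) + nu * ((b + 0 * t) * (d + - nu * c * t)) =
    (a * c + nu * (b * d)) + (1 - nu * nu) * (b * c * t) by ring.
  by rewrite nu2 subrr mul0r addr0.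
have ab' : (a != 0) || (b != 0) by rewrite b0 orbT.
have cd' : (d != 0) || (- nu * c != 0).
  by rewrite mulf_neq0 ?orbT// oppr_eq0.
near=> t => t0; rewrite !mul0r !addr0 bc /= mulf_neq0//; move: t0; near: t;
  exact: lin_neq0_near.
Unshelve. all: by end_near. Qed.

End Density.

Lemma bipoly_cts N L p q (T : topologicalType) (a b c d : T -> C) x :
  {for x, continuous a} -> {for x, continuous b} ->
  {for x, continuous c} -> {for x, continuous d} ->
  {for x, continuous (fun y => bipoly N L p q (a y) (b y) (c y) (d y))}.
Proof.
move=> ca cb cc cd.
have cw : {for x, continuous (fun y => nu * (b y * d y))}.
  by apply: cts_mul; [exact: cts_cst|exact: cts_mul cb cd].
apply: (@cts_sum T (fun k y => \sum_(l < L) p k l * ((b y * c y) ^+ k * (nu * (b y * d y)) ^+ l)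
  + \sum_(l < L) q k l * ((a y * d y) ^+ k.+1 * (nu * (b y * d y)) ^+ l)) N x) => k.
apply: cts_add.
  apply: (@cts_sum T (fun l y => p k l * ((b y * c y) ^+ k * (nu * (b y * d y)) ^+ l)) L x) => l.
  apply: cts_mul; first exact: cts_cst.
  exact: (@cts_mul _ (fun y => (b y * c y) ^+ k) _ x
    (@cts_exp _ _ k x (cts_mul cb cc)) (@cts_exp _ _ l x cw)).
apply: (@cts_sum T (fun l y => q k l * ((a y * d y) ^+ k.+1 * (nu * (b y * d y)) ^+ l)) L x) => l.
apply: cts_mul; first exact: cts_cst.
exact: (@cts_mul _ (fun y => (a y * d y) ^+ k.+1) _ x
  (@cts_exp _ _ k.+1 x (cts_mul ca cd)) (@cts_exp _ _ l x cw)).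
Qed.

Theorem quadric_approx (r e : R) : 0 < e -> exists N L p q,
  forall a b c d, onQ a b c d -> in_box r a b c d ->
  cmod (f a b c d - bipoly N L p q a b c d) <= e.
Proof.
(* The box grows twice, once for each density step; [generic_approx] asks for a size of at least
   1. *)
move=> e0; pose r2 := Num.max (r + 2) 1.
have [|N [L [p [q H]]]] := @generic_approx r2 e _ e0; first by rewrite le_max lexx orbT.
exists N, L, p, q => a b c d Q box.
have cts := @bipoly_cts N L p q.
have r12 : r + 1 < r2 by rewrite lt_max; apply/orP; left; lra.
have r01 : r < r + 1 by rewrite ltrDl.
have E2 : forall a b c d, onQ a b c d -> in_box r2 a b c d ->
    (b * c != 0) && (a * d != 0) -> cmod (f a b c d - bipoly N L p q a b c d) <= e.
  by move=> a' b' c' d' Q' box' /andP[]; exact: H.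
exact: (estimate_dense_bc cts r01 (estimate_dense_ad cts r12 E2) Q box isT).
Qed.

(** The points with [c = a^*], [d = b^*] form a totally real subset. It is large enough to force
    [phi] to vanish, first in [t] from a circle, then in [w] from zeros accumulating at 0. *)
Theorem quadric_unique (n : R) : nu = rc n ->
  (forall a b, a * a^* + nu * (b * b^*) = 1 -> f a b a^* b^* = 0) ->
  forall a b c d, onQ a b c d -> f a b c d = 0.
Proof.
move=> nE f0.
have n2 : n * n = 1 by apply: rc_inj; rewrite rcM -nE.
have n1 : n <= 1.
  rewrite leNgt; apply/negP => n1; have : 1 < n * n by rewrite mulr_egt1.
  by rewrite n2 ltxx.
have conj_rc (x : R) : (rc x)^* = rc x by apply: creimP; rewrite /= ?oppr0.
have phi0 (s : R) : 0 < s < 1 -> forall t, t != 0 -> phi t (rc (n * s)) = 0.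
  move=> /andP[s0 s1].
  have u0 : 0 < 1 - n * s.
    by rewrite subr_gt0 (le_lt_trans _ s1)// ler_piMl// ltW.
  pose x := Num.sqrt (1 - n * s).
  have x0 : 0 < x by rewrite sqrtr_gt0.
  have xx : x * x = 1 - n * s by rewrite -expr2 sqr_sqrtr// ltW.
  (* With [a] real and [b = t / a], the condition [cmod b = Num.sqrt s] puts the point on the real
     form exactly when [t] runs through the circle of radius [x * Num.sqrt s]; the gauge by [a]
     turns it into the normal form [phi]. *)
  pose a := rc x.
  have a0 : a != 0 by rewrite -cmod_gt0 cmod_rc gtr0_norm.
  apply: (@hol0_eq0_circle R (phi ^~ (rc (n * s))) (x * Num.sqrt s)).
  - exact: phi_hol0.
  - by rewrite mulr_gt0// sqrtr_gt0.
  move=> t tr.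
  have t0 : t != 0 by rewrite -cmod_gt0 tr mulr_gt0// sqrtr_gt0.
  pose b := t / a.
  have bs : cmod b = Num.sqrt s.
    by rewrite cmodM cmodV tr cmod_rc gtr0_norm// mulrC mulKf// gt_eqF.
  have bb : b * b^* = rc s.
    by rewrite -normCK normE -rcX bs sqr_sqrtr// ltW.
  have aa : a * a^* = rc (1 - n * s) by rewrite conj_rc -rcM xx.
  have Q : onQ a b a^* b^*.
    by rewrite /onQ aa bb nE -rcM -rcD subrK.
  have := f0 a b Q; rewrite -(@f_gauge a a b a^* b^*)// => <-.
  rewrite /phi; congr f.
  - by rewrite -[X in a * X]conj_rc aa rcB.
  - by rewrite /b mulrC divfK.
  - by rewrite conj_rc mulfV.
  - have b0 : b != 0 by rewrite mulf_neq0// invr_eq0.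
    rewrite nE -rcM mulrA n2 mul1r -bb.
    have -> : t = a * b by rewrite /b mulrC divfK.
    by field; rewrite a0 b0.
(* The values [w = n * s] accumulate at 0, where [entire_eq0] takes over. *)
have phi00 t w : t != 0 -> phi t w = 0.
  move=> t0; apply: (entire_eq0 (phi_entire t0)) => d d0.
  pose s := Num.min (1 / 2) (d / 2).
  have s0 : 0 < s by rewrite lt_min !divr_gt0.
  have s12 : s <= 1 / 2 by rewrite ge_min lexx.
  have sd : s <= d / 2 by rewrite ge_min lexx orbT.
  have ns : cmod (rc (n * s)) = s.
    by rewrite rcM cmodM -nE cnu mul1r cmod_rc gtr0_norm.
  exists (rc (n * s)); split.
  - by rewrite -cmod_gt0 ns.
  - by rewrite ns; move: sd d0; lra.
  - by apply: phi0 => //; rewrite s0 /=; move: s12; lra.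
move=> a b c d Q.
pose r := cmod (a * c) + cmod (a * d) + cmod (b * c) + cmod (b * d).
have box : in_box r a b c d.
  have := cmod_ge0 (a * c); have := cmod_ge0 (a * d).
  have := cmod_ge0 (b * c); have := cmod_ge0 (b * d).
  by rewrite /r => *; split; lra.
have E : forall a b c d, onQ a b c d -> in_box (r + 1) a b c d -> b * c != 0 ->
    cmod (f a b c d - 0) <= 0.
  move=> a' b' c' d' Q' _; rewrite mulf_eq0 negb_or => /andP[b0 c0].
  have := phiE Q' b0 c0 (oner_neq0 _); rewrite mul1r divr1 mulr1 => ->.
  by rewrite phi00 ?subrr ?cmod0// mulf_neq0.
have r01 : r < r + 1 by rewrite ltrDl.
have := @estimate_dense_bc (fun _ _ _ _ => 0) 0
  (fun T a b c d x _ _ _ _ => @cts_cst T 0 x) r (r + 1) r01 E a b c d Q box isT.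
rewrite subr0 => H; apply/eqP; rewrite -cmod_eq0 eq_le H; exact: cmod_ge0.
Qed.

End Quadric.

(** * Holomorphic functions on the reduced space *)

Section Coordinates.
Context {R : realType}.
Local Notation C := (Cplx R).
Local Notation V := 'rV[C]_2.
Local Notation i0 := (ord0 : 'I_2).
Local Notation i1 := (lift ord0 ord0 : 'I_2).

(** As a combination of fixed vectors, it lets continuity and differentiability follow from the
    rules for sums and scalings. *)
Definition mkV (a b : C) : V := a *: delta_mx 0 i0 + b *: delta_mx 0 i1.

Lemma mkV0 a b : mkV a b 0 i0 = a.
Proof. by rewrite !mxE /= mulr1 mulr0 addr0. Qed.
Lemma mkV1 a b : mkV a b 0 i1 = b.
Proof. by rewrite !mxE /= mulr1 mulr0 add0r. Qed.

Lemma ord2P (k : 'I_2) : k = i0 \/ k = i1.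
Proof. by case: k => -[|[|//]] ?; [left|right]; apply: val_inj. Qed.

Lemma mkV_eta (v : V) : v = mkV (v 0 i0) (v 0 i1).
Proof. by apply/rowP => k; have [->|->] := ord2P k; rewrite ?mkV0 ?mkV1. Qed.

Lemma scale_mkV t a b : t *: mkV a b = mkV (t * a) (t * b).
Proof. by rewrite scalerDr !scalerA. Qed.

Lemma conjV_mkV a b : conjV (mkV a b) = mkV a^* b^*.
Proof.
by apply/rowP => k; rewrite mxE; have [->|->] := ord2P k; rewrite ?mkV0 ?mkV1.
Qed.

Definition curve (a b c d : C) : V * V := (mkV a b, mkV c d).

Lemma curve_eta (z : V * V) : z = curve (z.1 0 i0) (z.1 0 i1) (z.2 0 i0) (z.2 0 i1).
Proof. by rewrite /curve -!mkV_eta; case: z. Qed.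

Lemma curve_cts (T : topologicalType) (a b c d : T -> C) x :
  {for x, continuous a} -> {for x, continuous b} ->
  {for x, continuous c} -> {for x, continuous d} ->
  {for x, continuous (fun y => curve (a y) (b y) (c y) (d y))}.
Proof.
move=> ca cb cc cd.
have mk (p q : T -> C) : {for x, continuous p} -> {for x, continuous q} ->
    mkV (p y) (q y) @[y --> x] --> mkV (p x) (q x).
  move=> cp cq; exact: (@cvgD _ _ _ (nbhs x) _ _ _ _ _
    (cvgZr_tmp (a := delta_mx 0 i0 : V) cp) (cvgZr_tmp (a := delta_mx 0 i1 : V) cq)).
exact: (@cvg_pair _ _ _ (nbhs x) (nbhs _) (nbhs _) _ _ _ _ _ (mk a b ca cb) (mk c d cc cd)).
Qed.

Lemma curve_diff (a b c d : C -> C) (t : C) :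
  differentiable a t -> differentiable b t -> differentiable c t -> differentiable d t ->
  differentiable (fun s => curve (a s) (b s) (c s) (d s)) t.
Proof.
move=> da db dc dd; apply: differentiable_pair;
  by apply: differentiableD; exact: differentiableZl.
Qed.

Section Functions.
Variable s : nat.
Hypothesis s1 : (0 < s)%N.
Local Notation n1 := (@nu R s i1).

Lemma Jhat_curve a b c d : Jhat s (curve a b c d) = a * c + n1 * (b * d).
Proof.
rewrite /Jhat big_ord_recl big_ord1 /= !mkV0 !mkV1; congr (_ + _).
by rewrite /nu /= s1 mul1r.
Qed.

Lemma n1_sqr : n1 * n1 = 1.
Proof. by rewrite /nu; case: ifP => _; rewrite ?mulrNN mul1r. Qed.

Lemma n1_real : n1 = rc (if (1 < s)%N then 1 else -1).
Proof. by rewrite /nu /=; case: (1 < s)%N => //; rewrite rcN. Qed.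

Lemma onQP a b c d : onQ n1 a b c d <-> Jhat s (curve a b c d) = 1.
Proof. by rewrite Jhat_curve. Qed.

Lemma onQ_mem a b c d : onQ n1 a b c d -> curve a b c d \in @Zhat R s.
Proof. by move=> /onQP Q; apply/mem_set. Qed.

Definition mkZ a b c d (Q : onQ n1 a b c d) : @Zhat R s := exist _ (curve a b c d) (onQ_mem Q).

(** The value 0 is a default: the hypotheses and conclusions on [f] in the study of the quadric
    concern points of the quadric only. *)
Definition coordf (g : Mhat R s -> C) (a b c d : C) : C :=
  if pselect (onQ n1 a b c d) is left Q then g (\pi_(Mhat R s) (mkZ Q)) else 0.

Lemma coordfE g a b c d (z : @Zhat R s) : val z = curve a b c d ->
  coordf g a b c d = g (\pi_(Mhat R s) z).
Proof.
move=> zE; rewrite /coordf; case: pselect => [Q|].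
  by congr (g (\pi _)); apply: val_inj.
case; apply/onQP; rewrite -zE; exact: (set_mem (valP z)).
Qed.

Lemma coordf_mkZ g a b c d (Q : onQ n1 a b c d) :
  coordf g a b c d = g (\pi_(Mhat R s) (mkZ Q)).
Proof. exact: coordfE. Qed.

Lemma coordfZ g (z : @Zhat R s) :
  coordf g ((val z).1 0 i0) ((val z).1 0 i1) ((val z).2 0 i0) ((val z).2 0 i1) =
  g (\pi_(Mhat R s) z).
Proof. by apply: coordfE; exact: curve_eta. Qed.

Lemma onQZ (z : @Zhat R s) :
  onQ n1 ((val z).1 0 i0) ((val z).1 0 i1) ((val z).2 0 i0) ((val z).2 0 i1).
Proof. apply/onQP; rewrite -curve_eta; exact: (set_mem (valP z)). Qed.

Lemma coordf_gauge g t a b c d : t != 0 -> onQ n1 a b c d ->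
  coordf g (t * a) (t * b) (c / t) (d / t) = coordf g a b c d.
Proof.
move=> t0 Q.
have Q' : onQ n1 (t * a) (t * b) (c / t) (d / t).
  by rewrite /onQ -[RHS]Q; field.
rewrite (coordf_mkZ g Q) (coordf_mkZ g Q').
congr g; apply/esym/pi_MhatP/asboolP; exists t => //=.
by rewrite /curve !scale_mkV ![t^-1 * _]mulrC.
Qed.

(** Locally [g] is the restriction of an ambient function [F]. The topology of [Zhat] is induced, so
    the points of a continuous family in the quadric eventually enter the open set where [F] and [g]
    agree. *)
Lemma coordf_local (T : topologicalType) g (a b c d : T -> C) x : holomorphic g ->
  {for x, continuous (fun y => curve (a y) (b y) (c y) (d y))} ->
  (\forall y \near x, onQ n1 (a y) (b y) (c y) (d y)) ->
  exists F : V * V -> C, differentiable F (curve (a x) (b x) (c x) (d x)) /\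
    \forall y \near x, F (curve (a y) (b y) (c y) (d y)) = coordf g (a y) (b y) (c y) (d y).
Proof.
move=> hg cts nQ; have Q := nbhs_singleton nQ.
have [F [dF eF]] := hg (mkZ Q); exists F; split; first exact: nbhs_singleton dF.
case: eF => _ [[B oB <-] /= Bx BF].
have nB : \forall y \near x, B (curve (a y) (b y) (c y) (d y)).
  by apply: cts; exact: open_nbhs_nbhs.
apply: filterS2 nQ nB => y Qy By; rewrite (coordf_mkZ g Qy).
exact: (BF (mkZ Qy) By).
Qed.

Lemma coordf_cts g : holomorphic g -> forall (T : topologicalType) (a b c d : T -> C) x,
  {for x, continuous a} -> {for x, continuous b} ->
  {for x, continuous c} -> {for x, continuous d} ->
  (\forall y \near x, onQ n1 (a y) (b y) (c y) (d y)) ->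
  {for x, continuous (fun y => coordf g (a y) (b y) (c y) (d y))}.
Proof.
move=> hg T a b c d x ca cb cc cd nQ.
have cts := curve_cts ca cb cc cd.
have [F [dF eF]] := coordf_local hg cts nQ.
have cF : {for x, continuous (fun y => F (curve (a y) (b y) (c y) (d y)))}.
  apply: (@continuous_comp _ _ _ (fun y => curve (a y) (b y) (c y) (d y)) F).
    exact: cts.
  exact: differentiable_continuous dF.
have Fx := nbhs_singleton eF.
apply/cvgCP => e e0.
by have /cvgCP/(_ e e0) := cF; apply: filterS2 eF => y <-; rewrite Fx.
Qed.

Lemma coordf_hol g : holomorphic g -> forall (a b c d : C -> C) (t : C),
  differentiable a t -> differentiable b t -> differentiable c t -> differentiable d t ->
  (\forall y \near t, onQ n1 (a y) (b y) (c y) (d y)) ->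
  differentiable (fun y => coordf g (a y) (b y) (c y) (d y)) t.
Proof.
move=> hg a b c d t da db dc dd nQ.
have dc' := curve_diff da db dc dd.
have [F [dF eF]] := coordf_local hg (differentiable_continuous dc') nQ.
have /diffCP[l lP] : differentiable (fun y => F (curve (a y) (b y) (c y) (d y))) t.
  exact: (@differentiable_comp _ _ _ _ (fun y => curve (a y) (b y) (c y) (d y)) F
    t dc' dF).
have Ft := nbhs_singleton eF.
by apply/diffCP; exists l => e /lP; apply: filterS2 eF => y <-; rewrite Ft.
Qed.

Lemma coordf_inj g h : (forall a b c d, onQ n1 a b c d -> coordf g a b c d = coordf h a b c d) ->
  g = h.
Proof.
move=> E; apply/funext => x; rewrite -[x]reprK.
by rewrite -!coordfZ; apply: E; exact: onQZ.
Qed.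

Lemma holomorphic_lin k g h : holomorphic g -> holomorphic h ->
  @holomorphic R s (fun x => k * g x + h x).
Proof.
move=> hg hh z; have [F [dF eF]] := hg z; have [G [dG eG]] := hh z.
exists (fun w => k *: F w + G w); split.
  by apply: filterS2 dF dG => w dF dG; exact: (differentiableD (differentiableZ k dF) dG).
by apply: filterS2 eF eG => w -> ->.
Qed.

(** The image of [antidiag] is the real form of the quadric, so [quadric_unique] applies to the
    difference. Hence extensions can be identified by exhibiting one. *)
Lemma extension_unique (g : Mred R s -> C) (g1 g2 : Mhat R s -> C) :
  extends g g1 -> extends g g2 -> g1 = g2.
Proof.
move=> [h1 e1] [h2 e2].
have h12 := holomorphic_lin (-1) h1 h2.
apply: coordf_inj => a b c d Q.
suff : coordf (fun x => -1 * g1 x + g2 x) a b c d = 0.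
  by rewrite !(coordf_mkZ _ Q) mulN1r addrC => /eqP; rewrite subr_eq0 => /eqP.
apply: (@quadric_unique R n1 n1_sqr (coordf (fun x => -1 * g1 x + g2 x))
  (@coordf_gauge _) (coordf_hol h12) (coordf_cts h12) _ n1_real _ a b c d Q) => {Q} a' b' Q'.
have Zab : mkV a' b' \in @Z R s.
  apply/mem_set; rewrite /Z /= /Jform big_ord_recl big_ord1 /= !mkV0 !mkV1.
  by rewrite [nu R s ord0]/nu s1 mul1r.
pose rho : @Z R s := exist _ (mkV a' b') Zab.
rewrite (@coordfE _ _ _ _ _ (antidiag rho)); last by rewrite /= conjV_mkV.
by rewrite -e1 -e2 mulN1r addNr.
Qed.

Lemma hol_continuous (g : Mhat R s -> C) : holomorphic g -> continuous g.
Proof.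
move=> hg; apply/quotient_continuous => z.
have vc : {for z, continuous (fun z : @Zhat R s => val z)} by exact: initial_continuous.
have c1 k : {for z, continuous (fun z : @Zhat R s => (val z).1 0 k : C)}.
  apply: (@continuous_comp _ _ _ (fun z : @Zhat R s => val z) (fun w : V * V => w.1 0 k : C)).
    exact: vc.
  apply: (@continuous_comp _ _ _ (fun w : V * V => w.1) (fun v : V => v 0 k : C)).
    exact: cvg_fst.
  exact: coord_continuous.
have c2 k : {for z, continuous (fun z : @Zhat R s => (val z).2 0 k : C)}.
  apply: (@continuous_comp _ _ _ (fun z : @Zhat R s => val z) (fun w : V * V => w.2 0 k : C)).
    exact: vc.
  apply: (@continuous_comp _ _ _ (fun w : V * V => w.2) (fun v : V => v 0 k : C)).
    exact: cvg_snd.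
  exact: coord_continuous.
have nQ : \forall z' \near z, onQ n1 ((val (z' : @Zhat R s)).1 0 i0) ((val z').1 0 i1)
    ((val z').2 0 i0) ((val z').2 0 i1).
  by apply: filterE => z'; exact: onQZ.
have := coordf_cts hg (c1 i0) (c1 i1) (c2 i0) (c2 i1) nQ.
have -> : (fun y : @Zhat R s => coordf g ((val y).1 0 i0) ((val y).1 0 i1)
    ((val y).2 0 i0) ((val y).2 0 i1)) = g \o \pi_(Mhat R s).
  by apply/funext => y; rewrite coordfZ.
exact.
Qed.

End Functions.
End Coordinates.

(** * Density of the polynomials *)

Section UniformTopology.
Context {R : realType}.
Local Notation C := (Cplx R).

Lemma cvg_uniform_cmodP (U : choiceType) (A : set U) (F : set_system (U -> C))
    (FF : Filter F) (f : U -> C) :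
  {uniform A, F --> f} <->
  forall e : R, 0 < e -> \forall g \near F, forall x, A x -> cmod (g x - f x) < e.
Proof.
split.
  move=> H e e0.
  have : nbhs (f : {uniform` A -> C}) [set g | forall x, A x -> cmod (g x - f x) < e].
    apply/uniform_nbhs; exists [set xy | cmod (xy.2 - xy.1) < e]; split; last by [].
    rewrite -entourage_ballE /=; exists (rc e) => /=; first by rewrite -rc0 rc_lt.
    by move=> [x y] /=; rewrite /ball /= normE rc_lt cmodBC.
  exact: H.
move=> H P /uniform_nbhs[E [entE EP]].
move: entE; rewrite -entourage_ballE => -[d /= /rc_gt0P[e e0 ->] dE].
rewrite /=; apply: filterS (H e e0) => g gf; apply: EP => x Ax; apply: dE => /=.
by rewrite /ball /= normE rc_lt cmodBC; exact: gf.
Qed.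

End UniformTopology.

Section Density.
Context {R : realType}.
Local Notation C := (Cplx R).
Local Notation V := 'rV[C]_2.
Local Notation i0 := (ord0 : 'I_2).
Local Notation i1 := (lift ord0 ord0 : 'I_2).
Variable s : nat.
Hypothesis s1 : (0 < s)%N.
Local Notation n1 := (@nu R s i1).
Local Notation A := (Ared R s).

Lemma extensionP (f : A) : extends f (extension f).
Proof. exact: projT2 (cid (asboolP _ (Ared_prop f))). Qed.

Lemma extensionE (f : A) g : extends f g -> extension f = g.
Proof. by move=> H; apply: (extension_unique s1 (extensionP f) H). Qed.

Lemma extension_lin k (f g : A) :
  extension (k *: f + g) = (fun x => k * extension f x + extension g x).
Proof.
have [hf ef] := extensionP f; have [hg eg] := extensionP g.
apply: extensionE; split; first exact: holomorphic_lin.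
by move=> rho; rewrite -ef -eg.
Qed.

Lemma extension0 : extension (0 : A) = (fun=> 0).
Proof.
have := extension_lin (-1) 0 0; rewrite scaler0 addr0 => E.
by apply/funext => x; have := congr1 (fun h => h x) E; rewrite mulN1r addNr.
Qed.

Lemma extension_bred P Q (e : mdeg P = mdeg Q) : extension (bred R s e) = bred_hat P Q.
Proof.
apply: extensionE; split; first exact: holomorphic_bred_hat.
by move=> rho; exact: bred_fun_bred_hat.
Qed.

(** All limits in the algebra go through this description; evaluation at a point is the case of a
    singleton [K]. *)
Lemma Ared_cvgP (T : Type) (F : set_system T) (FF : Filter F) (u : T -> A) (f : A) :
  u @ F --> f <-> forall (K : set (Mhat R s)) (e : R), compact K -> 0 < e ->
    \forall n \near F, forall x, K x -> cmod (extension (u n) x - extension f x) < e.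
Proof.
split=> [cu K e cK e0|H].
  have cE : extension (u n) @[n --> F] --> extension f.
    exact: (cvg_comp _ _ cu (@initial_continuous _ _ (@extension R s) f)).
  have cK' : {uniform K, extension (u n) @[n --> F] --> extension f}.
    by move: K cK; apply/fam_cvgP.
  move/cvg_uniform_cmodP : cK' => /(_ e e0). exact.
have cE : extension (u n) @[n --> F] --> extension f.
  apply/fam_cvgP => K cK; apply/cvg_uniform_cmodP => e e0; exact: H.
move=> U [_ [[B oB <-] Bf] BU].
have nB : nbhs (extension f) B by exact: open_nbhs_nbhs.
by apply: (@filterS _ F FF _ _ _ (cE _ nB)) => n; exact: BU.
Qed.

Lemma delta_cvg (T : Type) (F : set_system T) (FF : Filter F) (u : T -> A) (f : A)
    (p : Mred R s) : u @ F --> f -> delta p (u n) @[n --> F] --> delta p f.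
Proof.
move=> /Ared_cvgP H; apply/cvgCP => e e0.
have := H [set \pi_(Mhat R s) (antidiag (repr p))] e (@compact_set1 _ _) e0.
apply: filterS => n /(_ _ erefl).
have [_ <-] := extensionP (u n); have [_ <-] := extensionP f.
by rewrite reprK.
Qed.

Definition swapM (x : Mhat R s) : Mhat R s := \pi_(Mhat R s) (swap_conjZ (repr x)).

Lemma swapM_continuous : continuous swapM.
Proof.
apply/quotient_continuous.
have -> : swapM \o \pi_(Mhat R s) = \pi_(Mhat R s) \o @swap_conjZ R s.
  by apply/funext => z; apply: pi_swap_conjZ; rewrite reprK.
move=> z; apply: (@continuous_comp _ _ _ (@swap_conjZ R s) (\pi_(Mhat R s))).
  exact: swap_conjZ_continuous.
exact: pi_continuous.
Qed.

Lemma extension_conjA (f : A) : extension (conjA f) = (fun x => (extension f (swapM x))^*).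
Proof.
have [hf ef] := extensionP f; apply: extensionE; split; first exact: holomorphic_conj hf.
move=> rho; rewrite -[RHS]/(hat_conj _ _) hat_conjE antidiag_fixed.
by rewrite -ef.
Qed.

Lemma cmod_conj (z : C) : cmod z^* = cmod z.
Proof. by apply: rc_inj; rewrite -!normE norm_conjC. Qed.

Lemma conjA_cvg (T : Type) (F : set_system T) (FF : Filter F) (u : T -> A) (f : A) :
  u @ F --> f -> conjA (u n) @[n --> F] --> conjA f.
Proof.
move=> /Ared_cvgP H; apply/Ared_cvgP => K e cK e0.
have cS : compact (swapM @` K).
  by apply: continuous_compact => //; apply: continuous_subspaceT; exact: swapM_continuous.
apply: filterS (H _ e cS e0) => n Hn x Kx.
by rewrite !extension_conjA -rmorphB cmod_conj; apply: Hn; exists x.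
Qed.

(** Bundling the equality of degrees allows polynomials to be lists of coefficients and
    monomials. *)
Record mono := Mono { mP : 'I_2 -> nat; mQ : 'I_2 -> nat; mE : mdeg mP = mdeg mQ }.

Definition polelt (l : seq (C * mono)) : A := \sum_(t <- l) t.1 *: bred R s (mE t.2).

Definition polval (l : seq (C * mono)) (z : V * V) : C :=
  \sum_(t <- l) t.1 * monomial (mP t.2) (mQ t.2) z.

Lemma extension_polelt l (z : @Zhat R s) :
  extension (polelt l) (\pi_(Mhat R s) z) = polval l (val z).
Proof.
rewrite /polelt /polval; elim: l => [|t l IH]; first by rewrite !big_nil extension0.
by rewrite !big_cons extension_lin IH extension_bred bred_hat_pi// mE.
Qed.

Definition mi (i j : nat) : 'I_2 -> nat := fun k => if k == i0 then i else j.

Lemma mdeg_mi i j : mdeg (mi i j) = (i + j)%N.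
Proof. by rewrite /mdeg big_ord_recl big_ord1. Qed.

Lemma monomial_mi i j k l a b c d :
  monomial (mi i j) (mi k l) (curve a b c d) = (a ^+ i * b ^+ j) * (c ^+ k * d ^+ l) :> C.
Proof. by rewrite /monomial !big_ord_recl !big_ord0 /= !mkV0 !mkV1 !mulr1. Qed.

Definition is_pol (g : V * V -> C) := exists l, forall z, g z = polval l z.

Lemma is_polD g h : is_pol g -> is_pol h -> is_pol (fun z => g z + h z).
Proof.
move=> [l lE] [m mE']; exists (l ++ m) => z.
by rewrite lE mE' /polval big_cat.
Qed.

Lemma is_pol_sum (F : nat -> V * V -> C) n : (forall i, is_pol (F i)) ->
  is_pol (fun z => \sum_(i < n) F i z).
Proof.
move=> PF; elim: n => [|n [l lE]].
  by exists [::] => z; rewrite big_ord0 /polval big_nil.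
have [m mE'] := PF n; exists (l ++ m) => z.
by rewrite big_ord_recr /= lE mE' /polval big_cat.
Qed.

Lemma is_pol_mono k (m : mono) : is_pol (fun z => k * monomial (mP m) (mQ m) z).
Proof. by exists [:: (k, m)] => z; rewrite /polval big_seq1. Qed.

Definition qmono_e1 k l : mdeg (mi 0 (k + l)) = mdeg (mi k l).
Proof. by rewrite !mdeg_mi. Qed.
Definition qmono_e2 k l : mdeg (mi k l) = mdeg (mi 0 (k + l)).
Proof. by rewrite !mdeg_mi. Qed.

(** Each of [b c], [b d], [a d] pairs a coordinate of the first vector with one of the second, so
    degrees agree; the index pairs are [(0, k + l), (k, l)] and [(k + 1, l), (0, k + 1 + l)]. *)
Lemma is_pol_bipoly N L p q : is_pol (fun z => bipoly n1 N L p q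
  (z.1 0 i0) (z.1 0 i1) (z.2 0 i0) (z.2 0 i1)).
Proof.
pose w (z : V * V) := n1 * (z.1 0 i1 * z.2 0 i1).
pose f1 k l (z : V * V) := p k l * ((z.1 0 i1 * z.2 0 i0) ^+ k * w z ^+ l).
pose f2 k l (z : V * V) := q k l * ((z.1 0 i0 * z.2 0 i1) ^+ k.+1 * w z ^+ l).
apply: (@is_pol_sum (fun k z => \sum_(l < L) f1 k l z + \sum_(l < L) f2 k l z)) => k.
apply: is_polD; [apply: (is_pol_sum (F := f1 k)) => l|apply: (is_pol_sum (F := f2 k)) => l].
  have [m mE'] := is_pol_mono (p k l * n1 ^+ l) (Mono (qmono_e1 k l)).
  exists m => z; rewrite -mE' /= [in RHS](curve_eta z) monomial_mi.
  by rewrite /f1 /f2 /w expr0 mul1r !exprMn exprD; ring.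
have [m mE'] := is_pol_mono (q k l * n1 ^+ l) (Mono (qmono_e2 k.+1 l)).
exists m => z; rewrite -mE' /= [in RHS](curve_eta z) monomial_mi.
by rewrite /f1 /f2 /w expr0 mul1r !exprMn exprD; ring.
Qed.

Definition zbox (r : R) (z : @Zhat R s) : Prop :=
  in_box r ((val z).1 0 i0) ((val z).1 0 i1) ((val z).2 0 i0) ((val z).2 0 i1).

Lemma polelt_approx (f : A) (r e : R) : 0 < e -> exists l, forall z, zbox r z ->
  cmod (extension (polelt l) (\pi_(Mhat R s) z) - extension f (\pi_(Mhat R s) z)) <= e.
Proof.
move=> e0; have [hf _] := extensionP f.
have [N [L [p [q H]]]] := @quadric_approx R n1 (@n1_sqr R s) (coordf s1 (extension f))
  (@coordf_gauge R s s1 _) (@coordf_hol R s s1 _ hf) (@coordf_cts R s s1 _ hf) r e e0.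
have [l lE] := is_pol_bipoly N L p q; exists l => z zr.
rewrite extension_polelt -lE cmodBC -(coordfZ s1).
by apply: H => //; exact: onQZ.
Qed.

(** The four products are pullbacks of [bred_hat] functions, continuous on the reduced space and
    hence bounded on [K]. *)
Lemma compact_zbox (K : set (Mhat R s)) : compact K ->
  exists r : R, forall z, K (\pi_(Mhat R s) z) -> zbox r z.
Proof.
move=> cK.
have B i j k l (e : mdeg (mi i j) = mdeg (mi k l)) : exists2 B : R, 0 <= B &
    forall z, K (\pi_(Mhat R s) z) -> cmod (monomial (mi i j) (mi k l) (val z)) <= B.
  have c x : K x -> {for x, continuous (@bred_hat R s (mi i j) (mi k l))}.
    move=> _; exact: (@hol_continuous R s s1 _ (holomorphic_bred_hat e) x).
  have [B B0 HB] := compact_cmod_bounded cK c; exists B => // z Kz.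
  by rewrite -(bred_hat_pi z e); exact: HB.
have [B1 B10 H1] := B 1%N 0%N 1%N 0%N erefl.
have [B2 B20 H2] := B 1%N 0%N 0%N 1%N ltac:(by rewrite !mdeg_mi).
have [B3 B30 H3] := B 0%N 1%N 1%N 0%N ltac:(by rewrite !mdeg_mi).
have [B4 B40 H4] := B 0%N 1%N 0%N 1%N erefl.
exists (Num.max (Num.max B1 B2) (Num.max B3 B4)) => z Kz.
have := H1 z Kz; have := H2 z Kz; have := H3 z Kz; have := H4 z Kz.
rewrite (curve_eta (val z)) !monomial_mi !expr0 !expr1 !mul1r !mulr1 => h4 h3 h2 h1.
by split; rewrite !le_max ?h1 ?h2 ?h3 ?h4 ?orbT.
Qed.

(** A diagonal choice: [u n] is accurate to [n.+1%:R^-1] on the box of size [n], and every compact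
    set lies in some box. *)
Lemma polelt_dense (f : A) : exists u : nat -> seq (C * mono), polelt (u n) @[n --> \oo] --> f.
Proof.
have /choice[u uP] : forall n : nat, exists l, forall z, zbox n%:R z ->
    cmod (extension (polelt l) (\pi_(Mhat R s) z) - extension f (\pi_(Mhat R s) z)) <= n.+1%:R^-1.
  by move=> n; apply: polelt_approx; rewrite invr_gt0.
exists u; apply/Ared_cvgP => K e /compact_zbox[r rP] e0.
pose M := Num.bound (Num.max `|r| e^-1).
have Mr : r <= M%:R.
  rewrite (le_trans (ler_norm r))// (@le_trans _ _ (Num.max `|r| e^-1)) ?le_max ?lexx//.
  by rewrite ltW// archi_boundP// le_max normr_ge0.
have Me : e^-1 <= M%:R.
  rewrite (@le_trans _ _ (Num.max `|r| e^-1)) ?le_max ?lexx ?orbT//.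
  by rewrite ltW// archi_boundP// le_max normr_ge0.
exists M => // n /= Mn x Kx.
have MnR : (M%:R : R) <= n%:R by rewrite ler_nat.
rewrite -[x]reprK in Kx *.
apply: le_lt_trans (uP n _ _) _.
  have [h1 h2 h3 h4] := rP _ Kx; split; rewrite (le_trans _ (le_trans Mr MnR))//.
rewrite invf_plt ?posrE// (le_lt_trans (le_trans Me MnR))//.
by rewrite ltr_nat.
Qed.

End Density.

(** * Positivity of the point evaluation kernel *)

Section Kernel.
Variable F : numFieldType.
Implicit Types (x y : F) (m n i j k l t : nat).

Definition ffall x m : F := \prod_(j < m) (x - j%:R).

Lemma ffallS x m : ffall x m.+1 = ffall x m * (x - m%:R).
Proof. by rewrite /ffall big_ord_recr. Qed.

Lemma ffallD x m n : ffall x (m + n) = ffall x m * ffall (x - m%:R) n.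
Proof.
elim: n => [|n IH]; first by rewrite addn0 [ffall _ 0]big_ord0 mulr1.
by rewrite addnS !ffallS IH natrD -mulrA opprD addrA.
Qed.

(** Induction on [n]: the new factor [y - n] splits as [(y - (m + n - j)) + (m - j)]. The first
    summand lengthens the falling factorial, the second moves the term to index [j + 1]. *)
Lemma ffall_mul y m n :
  \sum_(j < m.+1) (j`! * 'C(m, j) * 'C(n, j))%:R * ffall y (m + n - j) = ffall y m * ffall y n.
Proof.
elim: n => [|n IH].
  rewrite big_ord_recl big1 => [|j _]; last by rewrite /= bin0n muln0 mul0r.
  by rewrite !bin0 addr0 mul1r addn0 subn0 [ffall y 0]big_ord0 mulr1.
rewrite ffallS mulrA -IH mulr_suml.
have step j : (j <= m)%N -> ffall y (m + n - j) * (y - n%:R) =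
    ffall y (m + n.+1 - j) + (m - j)%:R * ffall y (m + n - j).
  move=> jm; rewrite addnS subSn; last by rewrite (leq_trans jm)// leq_addr.
  rewrite ffallS -addnBAC// natrD; ring.
under [RHS]eq_bigr => j _.
  rewrite -mulrA step; last by rewrite -ltnS.
  rewrite mulrDr mulrA -natrM; over.
rewrite [RHS]big_split /= [X in _ = _ + X]big_ord_recr /= subnn muln0 mul0r addr0.
rewrite [LHS]big_ord_recl [X in _ = X + _]big_ord_recl /= -addrA; congr (_ + _).
  by rewrite !bin0.
rewrite -big_split; apply: eq_bigr => j _; rewrite /bump /= !add1n.
have -> : (m + n - j)%N = (m + n.+1 - j.+1)%N by rewrite addnS subSS.
rewrite -mulrDl -natrD; congr (_%:R * _).
have E : ('C(m, j) * (m - j) = j.+1 * 'C(m, j.+1))%N by rewrite mulnC mul_bin_left.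
rewrite binS factS.
have -> : (j`! * 'C(m, j) * 'C(n, j) * (m - j) = j`! * 'C(n, j) * ('C(m, j) * (m - j)))%N by ring.
by rewrite E; ring.
Qed.

Lemma triangle_sum D (g : nat -> nat -> F) :
  (forall i j, (D <= i + j)%N -> g i j = 0) ->
  \sum_(i < D) \sum_(j < D) g i j = \sum_(t < D) \sum_(j < t.+1) g (t - j)%N j.
Proof.
move=> g0.
have -> : \sum_(t < D) \sum_(j < t.+1) g (t - j)%N j =
    \sum_(t < D) \sum_(j < D | (j <= t)%N) g (t - j)%N j.
  apply: eq_bigr => t _; rewrite (big_ord_widen_cond D xpredT (fun j => g (t - j)%N j))//.
rewrite exchange_big [RHS](exchange_big_dep xpredT)//=; apply: eq_bigr => j _.
rewrite -(big_mkord xpredT (fun i => g i j)) -(big_mkord (fun t => (j <= t)%N) (fun t => g (t - j)%N j)).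
have Z1 : \sum_(D - j <= i < D) g i j = 0.
  rewrite big_nat_cond big1// => i /andP[/andP[Di _] _].
  by apply: g0; rewrite addnC -leq_subLR.
have Z2 : \sum_(0 <= t < j | (j <= t)%N) g (t - j)%N j = 0.
  by rewrite big_nat_cond big1// => t /andP[/andP[_ tj]]; rewrite leqNgt tj.
rewrite (big_cat_nat _ (n := (D - j)%N)) ?leq_subr//= Z1 addr0.
rewrite [RHS](big_cat_nat _ (n := j)) ?(ltnW (ltn_ord j))//= Z2 add0r.
rewrite -[X in _ = \sum_(X <= _ < _ | _) _]add0n big_addn [RHS]big_mkcond /=.
apply: eq_bigr => i _.
by rewrite leq_addl addnK.
Qed.

(** The binomial theorem for [(u + v) ^+ m], differentiated [i] times in [u] and [j] times in [v]
    and divided by [i! j!]. The proof compares factorials with the expansion of exponent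
    [m - (i + j)]. *)
Lemma bin_sum_shift m i j (u v : F) :
  \sum_(k < m.+1) ('C(m, k) * 'C(m - k, i) * 'C(k, j))%:R * (u ^+ (m - k - i) * v ^+ (k - j)) =
  ('C(m, i + j) * 'C(i + j, j))%:R * (u + v) ^+ (m - (i + j)).
Proof.
have [ijm|mij] := leqP (i + j) m; last first.
  rewrite bin_small// mul0n mul0r big1// => k _.
  have [kj|jk] := ltnP k j; first by rewrite [X in (_ * X)%N]bin_small// muln0 mul0r.
  rewrite [X in (_ * X * _)%N]bin_small ?muln0 ?mul0n ?mul0r//.
  by have := ltn_ord k; move: jk mij; lia.
have [e me] : exists e, m = (i + j + e)%N by exists (m - (i + j))%N; rewrite subnKC.
rewrite exprDn mulr_sumr.
pose G k : F := ('C(m, k) * 'C(m - k, i) * 'C(k, j))%:R * (u ^+ (m - k - i) * v ^+ (k - j)).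
rewrite -(big_mkord xpredT G).
have Z1 : \sum_(0 <= k < j) G k = 0.
  rewrite big_nat_cond big1// => k /andP[/andP[_ kj] _].
  by rewrite /G [X in (_ * X)%N]bin_small// muln0 mul0r.
have Z2 : \sum_((j + e).+1 <= k < m.+1) G k = 0.
  rewrite big_nat_cond big1// => k /andP[/andP[ek km] _].
  by rewrite /G [X in (_ * X * _)%N]bin_small ?muln0 ?mul0n ?mul0r//; lia.
rewrite (big_cat_nat _ (n := j)) /=; [|lia|lia].
rewrite Z1 add0r (big_cat_nat _ (n := (j + e).+1)) /=; [|lia|lia].
rewrite Z2 addr0 /G me {Z1 Z2 G}.
rewrite -{1}[j]add0n big_addn big_mkord.
have -> : ((j + e).+1 - j = e.+1)%N by lia.
have -> : (i + j + e - (i + j) = e)%N by lia.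
apply: eq_bigr => k _; have ke : (k <= e)%N by rewrite -ltnS.
have -> : (i + j + e - (k + j) - i = e - k)%N by lia.
rewrite addnK mulrnAr -mulrnAl -mulrnA; congr (_%:R * _).
have f0 q : (0 < q`!)%N by exact: fact_gt0.
have B p q : (q <= p)%N -> ('C(p, q) * (q`! * (p - q)`!) = p`!)%N by exact: bin_fact.
apply/eqP; rewrite -(eqn_pmul2r (_ : 0 < k`! * (e - k)`! * i`! * j`!)%N) ?muln_gt0 ?f0//.
have E1 := B (i + j + e)%N (k + j)%N ltac:(lia).
have E2 := B (i + j + e - (k + j))%N i ltac:(lia).
have E3 := B (k + j)%N j ltac:(lia).
have E4 := B (i + j + e)%N (i + j)%N ltac:(lia).
have E5 := B (i + j)%N j ltac:(lia).
have E6 := B e k ke.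
have e1 : (i + j + e - (k + j) - i = e - k)%N by lia.
have e2 : (k + j - j = k)%N by lia.
have e3 : (i + j + e - (i + j) = e)%N by lia.
have e4 : (i + j - j = i)%N by lia.
rewrite e1 in E2; rewrite e2 in E3; rewrite e3 in E4; rewrite e4 in E5.
apply/eqP.
transitivity ((i + j + e)`!).
  rewrite -E1 -E2 -E3; ring.
rewrite -E4 -E5 -E6; ring.
Qed.

Lemma bin_trinomial m s u : ('C(m, u + s) * 'C(u + s, s) = 'C(m, s) * 'C(m - s, u))%N.
Proof.
have [usm|mus] := leqP (u + s) m; last first.
  rewrite bin_small// mul0n; have [sm|ms] := leqP s m; last by rewrite bin_small.
  by rewrite ['C(m - s, u)]bin_small ?muln0// ltn_subLR// addnC.
apply/eqP; rewrite -(eqn_pmul2r (_ : 0 < s`! * u`! * (m - (u + s))`!)%N) ?muln_gt0 ?fact_gt0//.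
apply/eqP.
have E1 := @bin_fact m (u + s) usm; have E2 := @bin_fact (u + s) s (leq_addl _ _).
have E3 := @bin_fact m s ltac:(lia); have E4 := @bin_fact (m - s) u ltac:(lia).
rewrite addnK in E2; have e4 : (m - s - u = m - (u + s))%N by lia.
rewrite e4 in E4.
transitivity (m`!); first by rewrite -E1 -E2; ring.
by rewrite -E3 -E4; ring.
Qed.

Lemma sum_widen n D (G : nat -> F) : (n <= D)%N ->
  (forall i, (n <= i)%N -> G i = 0) -> \sum_(i < n) G i = \sum_(i < D) G i.
Proof.
move=> nD G0; rewrite (big_ord_widen _ G nD) big_mkcond /=; apply: eq_bigr => i _.
by case: ltnP => // /G0.
Qed.

Variables (x a b a' b' : F).
Hypothesis ab1 : a * a' - b * b' = 1.
Hypothesis x0 : forall n, ffall x n != 0.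

(** For [x = hbar^-1] and [a'], [b'] conjugate to [a], [b], the sum [kern] is the value of conj(f) *
    g at [(a, b)], stripped of outer monomials and normalising falling factorials. The exponents [p]
    and [r] are the holomorphic ones of f and g. *)
Definition kern_term (p0 p1 r0 r1 i j : nat) : F :=
  (-1) ^+ j * ffall x ((p0 + r0 - i) + (p1 + r1 - j)) *
  (i`! * j`! * ('C(p0, i) * 'C(p1, j)) * ('C(r0, i) * 'C(r1, j)))%:R *
  (a ^+ (r0 - i) * b ^+ (r1 - j) * (a' ^+ (p0 - i) * b' ^+ (p1 - j))).

Definition kern (p0 p1 r0 r1 : nat) : F :=
  \sum_(i < (minn p0 r0).+1) \sum_(j < (minn p1 r1).+1) kern_term p0 p1 r0 r1 i j.

Lemma kern_widen D p0 p1 r0 r1 : (p0 < D)%N -> (p1 < D)%N ->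
  kern p0 p1 r0 r1 = \sum_(i < D) \sum_(j < D) kern_term p0 p1 r0 r1 i j.
Proof.
move=> p0D p1D.
have z p r i : (minn p r < i)%N -> ('C(p, i) * 'C(r, i) = 0)%N.
  rewrite gtn_min => /orP[pi|ri]; first by rewrite bin_small.
  by rewrite ['C(r, i)]bin_small// muln0.
have t0 i j : ('C(p0, i) * 'C(r0, i) * ('C(p1, j) * 'C(r1, j)) = 0)%N ->
    kern_term p0 p1 r0 r1 i j = 0.
  move=> E; rewrite /kern_term.
  have -> : (i`! * j`! * ('C(p0, i) * 'C(p1, j)) * ('C(r0, i) * 'C(r1, j)) =
    i`! * j`! * ('C(p0, i) * 'C(r0, i) * ('C(p1, j) * 'C(r1, j))))%N by ring.
  by rewrite E muln0 mulr0 mul0r.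
rewrite /kern (@sum_widen _ D (fun i => \sum_(j < (minn p1 r1).+1) kern_term p0 p1 r0 r1 i j)).
- apply: eq_bigr => i _; apply: (@sum_widen _ D (kern_term p0 p1 r0 r1 i)).
    by rewrite (leq_ltn_trans _ p1D)// geq_min leqnn.
  by move=> j /z E; apply: t0; rewrite E muln0.
- by rewrite (leq_ltn_trans _ p0D)// geq_min leqnn.
- by move=> i /z E; rewrite big1// => j _; apply: t0; rewrite E mul0n.
Qed.

(** The dependence on [k] and on [l] separates, so that [bin_sum_shift] sums over each. Where a
    natural subtraction would truncate, a binomial makes both sides zero. *)
Lemma kern_term_split (be ga : F) m n k l i j : (k <= m)%N -> (l <= n)%N ->
  ('C(m, k) * 'C(n, l))%:R * (be ^+ k * ga ^+ l) * kern_term (m - k) k (n - l) l i j =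
  (-1) ^+ j * ffall x (m + n - (i + j)) * (i`! * j`!)%:R * (be * ga) ^+ j *
  ((('C(m, k) * 'C(m - k, i) * 'C(k, j))%:R * (a' ^+ (m - k - i) * (be * b') ^+ (k - j))) *
   (('C(n, l) * 'C(n - l, i) * 'C(l, j))%:R * (a ^+ (n - l - i) * (ga * b) ^+ (l - j)))).
Proof.
move=> km ln; rewrite /kern_term.
have [kj|jk] := ltnP k j; first by rewrite ['C(k, j)]bin_small// !(muln0, mul0n, mul0r, mulr0).
have [lj|jl] := ltnP l j; first by rewrite ['C(l, j)]bin_small// !(muln0, mul0n, mul0r, mulr0).
have [ki|ik] := ltnP (m - k) i.
  by rewrite ['C(m - k, i)]bin_small// !(muln0, mul0n, mul0r, mulr0).
have [li|il] := ltnP (n - l) i.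
  by rewrite ['C(n - l, i)]bin_small// !(muln0, mul0n, mul0r, mulr0).
have -> : (m - k + (n - l) - i + (k + l - j) = m + n - (i + j))%N by lia.
have -> : be ^+ k = be ^+ j * be ^+ (k - j) by rewrite -exprD subnKC.
have -> : ga ^+ l = ga ^+ j * ga ^+ (l - j) by rewrite -exprD subnKC.
rewrite !exprMn !natrM; ring.
Qed.

Let p (be : F) := a' + be * b'.
Let q (be : F) := b + be * a.
Let p' (ga : F) := a + ga * b.
Let q' (ga : F) := b' + ga * a'.

(** Summing over [k] and [l] leaves powers of [1 - be * ga]. Rewritten in the linear forms [p], [q],
    [p'], [q'] and expanded again, they leave one inner sum, which [ffall_mul] evaluates. *)
Lemma kern_gen (be ga : F) m n :
  \sum_(k < m.+1) \sum_(l < n.+1)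
    ('C(m, k) * 'C(n, l))%:R * (be ^+ k * ga ^+ l) * kern (m - k) k (n - l) l =
  ffall x m * ffall x n * \sum_(s < m.+1) ((-1) ^+ s * s`!%:R / ffall x s) *
    (('C(m, s)%:R * (p be ^+ (m - s) * q be ^+ s)) *
     ('C(n, s)%:R * (p' ga ^+ (n - s) * q' ga ^+ s))).
Proof.
set D := m.+1.
transitivity (\sum_(i < D) \sum_(j < D)
    (-1) ^+ j * ffall x (m + n - (i + j)) * (i`! * j`!)%:R * (be * ga) ^+ j *
    ((('C(m, i + j) * 'C(i + j, j))%:R * p be ^+ (m - (i + j))) *
     (('C(n, i + j) * 'C(i + j, j))%:R * p' ga ^+ (n - (i + j))))).
  under eq_bigr => k _.
    under eq_bigr => l _.
      rewrite (@kern_widen D); [|by rewrite ltnS leq_subr|by []].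
      rewrite mulr_sumr; under eq_bigr => i _.
        rewrite mulr_sumr; under eq_bigr => j _ do
          rewrite kern_term_split -1?ltnS//.
        over.
      over.
    rewrite exchange_big /=; under eq_bigr do rewrite exchange_big /=.
    over.
  rewrite exchange_big /=; apply: eq_bigr => i _.
  rewrite exchange_big /=; apply: eq_bigr => j _.
  under eq_bigr do rewrite -mulr_sumr.
  rewrite -mulr_sumr; congr (_ * _).
  rewrite -!bin_sum_shift mulr_suml; apply: eq_bigr => k _.
  by rewrite mulr_sumr.
pose g1 i j := (-1) ^+ j * ffall x (m + n - (i + j)) * (i`! * j`!)%:R * (be * ga) ^+ j *
    ((('C(m, i + j) * 'C(i + j, j))%:R * p be ^+ (m - (i + j))) *
     (('C(n, i + j) * 'C(i + j, j))%:R * p' ga ^+ (n - (i + j)))).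
rewrite (@triangle_sum D g1); last first.
  by move=> i j mij; rewrite /g1 ['C(m, _)]bin_small// mul0n !mul0r mulr0.
pose h u s := ffall x (m + n - (u + s)) * ((u + s)`! * 'C(m, u + s) * 'C(n, u + s) * 'C(u + s, s))%:R *
   (p be ^+ (m - (u + s)) * p' ga ^+ (n - (u + s)) *
    ((p be * p' ga) ^+ u * (- (q be * q' ga)) ^+ s)).
transitivity (\sum_(t < D) \sum_(s < t.+1) h (t - s)%N s).
  apply: eq_bigr => t _.
  (* By [ab1] the indefinite form is preserved by the change of linear forms; its minus sign is the
     origin of the weights [(-1) ^+ s]. *)
  have one : 1 + - (be * ga) = p be * p' ga + - (q be * q' ga).
    rewrite -ab1 /p /p' /q /q'.
    have : be * ga = be * ga * (a * a' - b * b') by rewrite ab1 mulr1.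
    move=> ->; ring.
  have lhs : \sum_(j < t.+1) g1 (t - j)%N j = ffall x (m + n - t) *
      (t`! * 'C(m, t) * 'C(n, t))%:R * (p be ^+ (m - t) * p' ga ^+ (n - t)) * (1 + - (be * ga)) ^+ t.
    rewrite [(1 + _) ^+ t]exprDn mulr_sumr; apply: eq_bigr => j _.
    have jt : (j <= t)%N by rewrite -ltnS.
    rewrite /g1 subnK// expr1n mul1r -[_ ^+ _ *+ _]mulr_natr -[- (be * ga)]mulN1r !exprMn.
    by rewrite -(bin_fact jt) !natrM; ring.
  rewrite lhs one [(p be * p' ga + _) ^+ t]exprDn mulr_sumr; apply: eq_bigr => s _.
  have st : (s <= t)%N by rewrite -ltnS.
  by rewrite /h subnK// -[_ * _ *+ _]mulr_natr !natrM; ring.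
rewrite -(@triangle_sum D h); last first.
  by move=> u s mus; rewrite /h ['C(m, _)]bin_small// muln0 !mul0n mulr0 mul0r.
rewrite exchange_big /= mulr_sumr; apply: eq_bigr => s _.
have sm : (s <= m)%N by rewrite -ltnS.
have [ns|sn] := ltnP n s.
  rewrite ['C(n, s)]bin_small// mul0r !mulr0 big1// => u _.
  by rewrite /h ['C(n, u + s)]bin_small ?muln0 ?mul0n ?mulr0 ?mul0r// ltn_addl.
(* [bin_trinomial] and [ffallD] split off all that depends on [s]; what remains is the product
   formula at [x - s%:R]. *)
transitivity (\sum_(u < D) ffall x s * (s`! * 'C(m, s) * 'C(n, s))%:R *
    (p be ^+ (m - s) * p' ga ^+ (n - s) * (- (q be * q' ga)) ^+ s) *
    ((u`! * 'C(m - s, u) * 'C(n - s, u))%:R * ffall (x - s%:R) (m - s + (n - s) - u))).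
  apply: eq_bigr => u _; rewrite /h.
  have -> : ((u + s)`! * 'C(m, u + s) * 'C(n, u + s) * 'C(u + s, s) =
      s`! * 'C(m, s) * 'C(n, s) * (u`! * 'C(m - s, u) * 'C(n - s, u)))%N.
    rewrite -(bin_fact (leq_addl u s)) addnK.
    transitivity (('C(m, u + s) * 'C(u + s, s)) * ('C(n, u + s) * 'C(u + s, s)) * (s`! * u`!))%N.
      by ring.
    by rewrite !bin_trinomial; ring.
  have [mu|um] := ltnP (m - s) u; first
    by rewrite ['C(m - s, u)]bin_small// !(muln0, mul0n, mul0r, mulr0).
  have [nu|un] := ltnP (n - s) u; first
    by rewrite ['C(n - s, u)]bin_small// !(muln0, mul0n, mul0r, mulr0).
  have -> : (m + n - (u + s) = s + (m - s + (n - s) - u))%N by lia.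
  rewrite ffallD.
  have -> : p be ^+ (m - s) = p be ^+ (m - (u + s)) * p be ^+ u.
    by rewrite -exprD; congr (_ ^+ _); lia.
  have -> : p' ga ^+ (n - s) = p' ga ^+ (n - (u + s)) * p' ga ^+ u.
    by rewrite -exprD; congr (_ ^+ _); lia.
  by rewrite exprMn !natrM; ring.
rewrite -mulr_sumr.
pose G u := (u`! * 'C(m - s, u) * 'C(n - s, u))%:R * ffall (x - s%:R) (m - s + (n - s) - u).
rewrite -(@sum_widen (m - s).+1 D G); last 2 first.
- by rewrite ltnS leq_subr.
- by move=> u mu; rewrite /G ['C(m - s, u)]bin_small// muln0 mul0n mul0r.
rewrite ffall_mul.
have -> : ffall x m = ffall x s * ffall (x - s%:R) (m - s) by rewrite -ffallD subnKC.
have -> : ffall x n = ffall x s * ffall (x - s%:R) (n - s) by rewrite -ffallD subnKC.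
rewrite -[- (q be * q' ga)]mulN1r !exprMn !natrM; field.
exact: x0.
Qed.

End Kernel.

(** * Comparison of polynomial coefficients *)

Section Coefficients.
Variable F : numFieldType.

Lemma poly_eq0_horner (p : {poly F}) : (forall x, p.[x] = 0) -> p = 0.
Proof.
move=> p0; apply/eqP; apply: contraT => pn0.
have := @max_poly_roots _ p [seq i%:R | i <- iota 0 (size p)] pn0.
rewrite size_map size_iota ltnn => H; apply: H.
  by apply/allP => y _; rewrite /root p0.
rewrite map_inj_uniq ?iota_uniq// => i j /eqP.
by rewrite eqr_nat => /eqP.
Qed.

Lemma poly_coef_eq (M : nat) (d : nat -> F) (p : {poly F}) :
  (forall x, \sum_(k < M) d k * x ^+ k = p.[x]) -> forall k, (k < M)%N -> d k = p`_k.
Proof.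
move=> E k kM; have : \poly_(i < M) d i - p = 0.
  by apply: poly_eq0_horner => x; rewrite hornerD hornerN horner_poly E subrr.
by move/eqP; rewrite subr_eq0 => /eqP <-; rewrite coef_poly kM.
Qed.

Lemma poly_coef2_eq (M N S : nat) (d : nat -> nat -> F) (e : nat -> F) (P Q : nat -> {poly F}) :
  (forall x y, \sum_(k < M) \sum_(l < N) d k l * (x ^+ k * y ^+ l) =
     \sum_(s < S) e s * ((P s).[x] * (Q s).[y])) ->
  forall k l, (k < M)%N -> (l < N)%N -> d k l = \sum_(s < S) e s * ((P s)`_k * (Q s)`_l).
Proof.
move=> E k l kM lN.
have E1 y : \sum_(l < N) d k l * y ^+ l = (\sum_(s < S) (e s * (P s)`_k) *: Q s).[y].
  have := @poly_coef_eq M (fun k => \sum_(l < N) d k l * y ^+ l)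
    (\sum_(s < S) (e s * (Q s).[y]) *: P s).
  move=> -> //; last first.
    move=> x; rewrite horner_sum; under [RHS]eq_bigr do rewrite hornerZ.
    have <- : \sum_(s < S) e s * ((P s).[x] * (Q s).[y]) = \sum_(i < S) e i * (Q i).[y] * (P i).[x].
      by apply: eq_bigr => s _; ring.
    rewrite -E; apply: eq_bigr => k' _; rewrite mulr_suml; apply: eq_bigr => l' _; ring.
  rewrite coef_sum horner_sum; apply: eq_bigr => s _.
  by rewrite coefZ hornerZ; ring.
rewrite (poly_coef_eq E1 lN) coef_sum; apply: eq_bigr => s _.
by rewrite coefZ mulrA.
Qed.

End Coefficients.

(** * Diagonalisation of the kernel *)

Section PSD.
Variable F : numClosedFieldType.
Variables (x a b : F).
Hypothesis ab1 : a * a^* - b * b^* = 1.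
Hypothesis x0 : forall n, ffall x n != 0.

(* The values of kern at p, r are the coefficients of a generating function, by
   kern_gen a combination of products whose factors depend on p only
   and on r only. *)
Definition kvec_poly (n s : nat) : {poly F} :=
  'C(n, s)%:R *: ((a%:P + b *: 'X) ^+ (n - s) * (b^*%:P + a^* *: 'X) ^+ s).

Definition kvec (s p0 p1 : nat) : F := (kvec_poly (p0 + p1) s)`_p1 / 'C(p0 + p1, p1)%:R.

(** The binomials that weight the kernel in [kern_gen] are divided out in [kvec]. Terms with [s]
    above the degree vanish, so one bound [M] can serve all pairs of a finite family. *)
Lemma kern_psd (M p0 p1 r0 r1 : nat) : (p0 + p1 < M)%N ->
  kern x a b a^* b^* p0 p1 r0 r1 = ffall x (p0 + p1) * ffall x (r0 + r1) *
    \sum_(s < M) ((-1) ^+ s * s`!%:R / ffall x s) * ((kvec s p0 p1)^* * kvec s r0 r1).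
Proof.
move=> pM; set m := (p0 + p1)%N; set n := (r0 + r1)%N.
have Hp s y : (kvec_poly n s).[y] = 'C(n, s)%:R * ((a + y * b) ^+ (n - s) * (b^* + y * a^*) ^+ s).
  by rewrite hornerZ hornerM !horner_exp !hornerD !hornerZ !hornerC hornerX ![y * _]mulrC.
have Hc s y : (map_poly Num.conj (kvec_poly m s)).[y] =
    'C(m, s)%:R * ((a^* + y * b^*) ^+ (m - s) * (b + y * a) ^+ s).
  rewrite /kvec_poly map_polyZ /= rmorphM /= !rmorphXn !rmorphD /= !map_polyZ /= !map_polyC /= map_polyX.
  rewrite hornerZ hornerM !horner_exp !hornerD !hornerZ !hornerC hornerX ![y * _]mulrC.
  by rewrite rmorph_nat !conjCK.
have := @poly_coef2_eq F m.+1 n.+1 m.+1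
  (fun k l => ('C(m, k) * 'C(n, l))%:R * kern x a b a^* b^* (m - k) k (n - l) l)
  (fun s => ffall x m * ffall x n * ((-1) ^+ s * s`!%:R / ffall x s))
  (fun s => map_poly Num.conj (kvec_poly m s)) (fun s => kvec_poly n s).
move=> /(_ _ p1 r1) H.
have {}H : ('C(m, p1) * 'C(n, r1))%:R * kern x a b a^* b^* (m - p1) p1 (n - r1) r1 =
  \sum_(s < m.+1) ffall x m * ffall x n * ((-1) ^+ s * s`!%:R / ffall x s) *
     ((map_poly Num.conj (kvec_poly m s))`_p1 * (kvec_poly n s)`_r1).
  apply: H; rewrite ?ltnS ?leq_addl// => be ga.
  under [RHS]eq_bigr do rewrite Hp Hc -mulrA.
  rewrite -mulr_sumr -(kern_gen ab1 x0); apply: eq_bigr => k _; apply: eq_bigr => l _.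
  by rewrite mulrAC.
rewrite /m /n !addnK -/m -/n in H.
have cm : ('C(m, p1))%:R != 0 :> F by rewrite pnatr_eq0 -lt0n bin_gt0 leq_addl.
have cn : ('C(n, r1))%:R != 0 :> F by rewrite pnatr_eq0 -lt0n bin_gt0 leq_addl.
have cmn : ('C(m, p1) * 'C(n, r1))%:R != 0 :> F by rewrite natrM mulf_neq0.
apply: (mulfI cmn); rewrite H mulrA mulr_sumr.
rewrite -(@sum_widen F m.+1 M (fun s => ('C(m, p1) * 'C(n, r1))%:R * (ffall x m * ffall x n) *
  ((-1) ^+ s * s`!%:R / ffall x s * ((kvec s p0 p1)^* * kvec s r0 r1))))//; last first.
  move=> s ms; rewrite /kvec /kvec_poly -/m ['C(m, s)]bin_small// scale0r coef0 mul0r rmorph0.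
  by rewrite mul0r !mulr0.
apply: eq_bigr => s _; rewrite coef_map /= /kvec -/m -/n.
have -> (u : F) k : (u / k%:R)^* = u^* / k%:R by rewrite -[LHS]/(Num.conj _) fmorph_div rmorph_nat.
rewrite natrM.
by field; rewrite x0 cm cn.
Qed.

Lemma kern_psd_ge0 (I : finType) (p0 p1 : I -> nat) (y : I -> F) :
  (forall s, 0 <= (-1) ^+ s / ffall x s) ->
  0 <= \sum_t \sum_u (y t)^* * y u *
    (kern x a b a^* b^* (p0 t) (p1 t) (p0 u) (p1 u) /
     (ffall x (p0 t + p1 t) * ffall x (p0 u + p1 u))).
Proof.
move=> k0; pose M := (\max_t (p0 t + p1 t)).+1.
pose e s : F := (-1) ^+ s * s`!%:R / ffall x s.
pose v s := \sum_t y t * kvec s (p0 t) (p1 t).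
suff -> : \sum_t \sum_u (y t)^* * y u *
    (kern x a b a^* b^* (p0 t) (p1 t) (p0 u) (p1 u) /
     (ffall x (p0 t + p1 t) * ffall x (p0 u + p1 u))) = \sum_(s < M) e s * ((v s)^* * v s).
  apply: sumr_ge0 => s _; apply: mulr_ge0; first by rewrite /e mulrAC mulr_ge0// ler0n.
  by rewrite mulrC mul_conjC_ge0.
have vv s : (v s)^* * v s = \sum_t \sum_u (y t)^* * y u *
    ((kvec s (p0 t) (p1 t))^* * kvec s (p0 u) (p1 u)).
  rewrite {1}/v rmorph_sum mulr_suml; apply: eq_bigr => t _.
  rewrite /v mulr_sumr; apply: eq_bigr => u _; rewrite rmorphM /=; ring.
under [RHS]eq_bigr do rewrite vv mulr_sumr.
rewrite [RHS]exchange_big; apply: eq_bigr => t _ /=.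
under [RHS]eq_bigr do rewrite mulr_sumr.
rewrite [RHS]exchange_big; apply: eq_bigr => u _ /=.
have tM : (p0 t + p1 t < M)%N by rewrite ltnS (leq_bigmax (F := fun t => p0 t + p1 t)%N).
rewrite (kern_psd _ _ tM) [X in _ * X]mulrC mulKf ?mulf_neq0// mulr_sumr.
by apply: eq_bigr => s _; rewrite mulrCA.
Qed.

End PSD.

(** * The star product *)

Section StarValues.
Context {R : realType}.
Local Notation C := (Cplx R).
Local Notation V := 'rV[C]_2.
Local Notation i0 := (ord0 : 'I_2).
Local Notation i1 := (lift ord0 ord0 : 'I_2).

Lemma mi_eta (P : 'I_2 -> nat) : P = mi (P i0) (P i1).
Proof. by apply/funext => k; have [->|->] := ord2P k. Qed.

Lemma mdegE (P : 'I_2 -> nat) : mdeg P = (P i0 + P i1)%N.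
Proof. by rewrite {1}[P]mi_eta mdeg_mi. Qed.

Lemma dffun_sum (n : 'I_2 -> nat) (G : ('I_2 -> nat) -> C) :
  \sum_(T : {dffun forall k : 'I_2, 'I_(n k).+1}) G (fun k => T k) =
  \sum_(i < (n i0).+1) \sum_(j < (n i1).+1) G (mi i j).
Proof.
rewrite pair_bigA /=.
pose h (ij : 'I_(n i0).+1 * 'I_(n i1).+1) : {dffun forall k : 'I_2, 'I_(n k).+1} :=
  finfun (fun k => inord (mi ij.1 ij.2 k)).
have h0 ij : h ij i0 = ij.1 by apply: val_inj; rewrite ffunE /mi /= inordK ?ltn_ord.
have h1 ij : h ij i1 = ij.2 by apply: val_inj; rewrite ffunE /mi /= inordK ?ltn_ord.
rewrite (reindex h) /=; last first.
  exists (fun T => (T i0, T i1)) => [ij _|T _]; first by rewrite h0 h1; case: ij.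
  by apply/ffunP => k; have [->|->] := ord2P k; rewrite ?h0 ?h1.
apply: eq_bigr => ij _; congr G.
by rewrite [LHS]mi_eta h0 h1.
Qed.

Section AnySignature.
Variable s : nat.
Hypothesis s1 : (0 < s)%N.
Local Notation n1 := (@nu R s i1).
Local Notation A := (Ared R s).

Lemma sgn_mi i j : sgn R s (mi i j) = n1 ^+ j.
Proof. by rewrite /sgn big_ord_recl big_ord1 /= [nu R s ord0]/nu s1 expr1n mul1r. Qed.

Lemma mfact_mi i j : mfact (mi i j) = (i`! * j`!)%N.
Proof. by rewrite /mfact big_ord_recl big_ord1. Qed.

Lemma mbin_mi Q i j : mbin Q (mi i j) = ('C(Q i0, i) * 'C(Q i1, j))%N.
Proof. by rewrite /mbin big_ord_recl big_ord1. Qed.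

Lemma bred_fun_eval P Q (rho : @Z R s) : mdeg P = mdeg Q ->
  bred_fun P Q (\pi_(Mred R s) rho) =
  (val rho 0 i0 ^+ P i0 * val rho 0 i1 ^+ P i1) *
  ((val rho 0 i0)^* ^+ Q i0 * (val rho 0 i1)^* ^+ Q i1).
Proof.
move=> e; rewrite bred_fun_pi// {1}[val rho]mkV_eta [conjV _]mkV_eta.
by rewrite [P]mi_eta [Q]mi_eta monomial_mi !mxE.
Qed.

(** Pulling out the outer monomials [P] and [S] leaves a sum that depends on [Q] and [R'] only; this
    is the kernel to be diagonalised. *)
Lemma star_eval (h : C) (star : A -> A -> A) (P Q R' S : 'I_2 -> nat)
    (eP : mdeg P = mdeg Q) (eR : mdeg R' = mdeg S) (rho : @Z R s) :
  is_star h star ->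
  let a := val rho 0 i0 in let b := val rho 0 i1 in
  star (bred R s eP) (bred R s eR) (\pi_(Mred R s) rho) =
  (a ^+ P i0 * b ^+ P i1) * (a^* ^+ S i0 * b^* ^+ S i1) *
  \sum_(i < (minn (Q i0) (R' i0)).+1) \sum_(j < (minn (Q i1) (R' i1)).+1)
    n1 ^+ j * (falling h^-1 ((Q i0 + R' i0 - i) + (Q i1 + R' i1 - j)) /
      (falling h^-1 (Q i0 + Q i1) * falling h^-1 (R' i0 + R' i1))) *
    (i`! * j`! * ('C(Q i0, i) * 'C(Q i1, j)) * ('C(R' i0, i) * 'C(R' i1, j)))%:R *
    (a ^+ (R' i0 - i) * b ^+ (R' i1 - j) * (a^* ^+ (Q i0 - i) * b^* ^+ (Q i1 - j))).
Proof.
move=> [_ _ _ starE] a b; rewrite starE.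
rewrite (dffun_sum (fun k => minn (Q k) (R' k))
 (fun T => star_coef s h Q R' T * bred_fun (fun k => P k + R' k - T k)%N
    (fun k => Q k + S k - T k)%N (\pi_(Mred R s) rho))).
rewrite mulr_sumr; apply: eq_bigr => i _; rewrite mulr_sumr; apply: eq_bigr => j _.
have := ltn_ord i; rewrite ltnS leq_min => /andP[iQ iR].
have := ltn_ord j; rewrite ltnS leq_min => /andP[jQ jR].
rewrite bred_fun_eval; last first.
  by move: eP eR; rewrite !mdegE /mi /=; lia.
rewrite -/a -/b /star_coef sgn_mi mfact_mi !mbin_mi !mdegE /mi /=.
have e k t : (t <= R' k)%N -> (P k + R' k - t = P k + (R' k - t))%N by lia.
have e' k t : (t <= Q k)%N -> (Q k + S k - t = Q k - t + S k)%N by lia.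
rewrite !e// !e'// !exprD; ring.
Qed.

Lemma conjA_bred P Q (e : mdeg P = mdeg Q) : conjA (bred R s e) = bred R s (esym e).
Proof.
apply: val_inj; apply/funext => x; rewrite -[x]reprK.
rewrite -[LHS]/((bred_fun _ _ _)^*) -[RHS]/(bred_fun _ _ _).
rewrite (bred_fun_eval _ e) (bred_fun_eval _ (esym e)).
by rewrite !rmorphM !rmorphXn /= !conjCK mulrC.
Qed.

Definition oneA : A := bred R s (erefl (mdeg (mi 0 0))).

Lemma oneAE x : oneA x = 1.
Proof.
by rewrite -[x]reprK -[LHS]/(bred_fun _ _ _) bred_fun_eval// !expr0 !mulr1.
Qed.

Lemma conjA_one : conjA oneA = oneA.
Proof.
apply: val_inj; apply/funext => x; rewrite -[LHS]/((oneA x)^*) -[RHS]/(oneA x).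
by rewrite !oneAE rmorph1.
Qed.

Lemma linear_sumZ (f : A -> A) (I : Type) (l : seq I) (c : I -> C) (g : I -> A) :
  linear f -> f (\sum_(t <- l) c t *: g t) = \sum_(t <- l) c t *: f (g t).
Proof.
move=> lf; pose L := GRing.isLinear.Build _ _ _ _ f lf.
pose F : {linear A -> A} := HB.pack f L.
rewrite -[f]/(F : A -> A) linear_sum; apply: eq_bigr => t _; exact: linearZ.
Qed.

(** On monomials the quotient of falling factorials is 1. Density and continuity extend this, the
    limits being compared after evaluation at a point, where they are unique. *)
Lemma star_one (h : C) (star : A -> A -> A) g : is_star h star ->
  (forall m, falling h^-1 m != 0) -> star oneA g = g.
Proof.
move=> st x0; have [lin _ cts _] := st.
have mono1 P Q (e : mdeg P = mdeg Q) : star oneA (bred R s e) = bred R s e.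
  apply: val_inj; apply/funext => x; rewrite -[x]reprK.
  rewrite [LHS](star_eval _ _ _ st) [RHS]bred_fun_eval//.
  rewrite /= !min0n !big_ord1 !subn0 !bin0 /=.
  rewrite !add0n !expr0 [falling _ 0]big_ord0 !mul1r !mulr1 divff// mul1r.
  by rewrite mulrC.
have poly1 l : star oneA (polelt s l) = polelt s l.
  by rewrite /polelt (linear_sumZ _ _ _ (lin _)); apply: eq_bigr => t _; rewrite mono1.
have [u ug] := polelt_dense s1 g.
apply: val_inj; apply/funext => x; rewrite -[LHS]/(delta x _) -[RHS]/(delta x _).
have c1 : (oneA, polelt s (u n)) @[n --> \oo] --> ((oneA, g) : A * A).
  exact: (@cvg_pair _ _ _ \oo (nbhs oneA) (nbhs g) _ _ _ _ _ (cvg_cst oneA) ug).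
have c2 : star oneA (polelt s (u n)) @[n --> \oo] --> star oneA g.
  exact: (@cvg_comp _ _ _ _ (fun p : A * A => star p.1 p.2) _ _ _ c1 (cts (oneA, g))).
have d2 : delta x (star oneA (polelt s (u n))) @[n --> \oo] --> delta x (star oneA g).
  exact: delta_cvg c2.
have d1 : delta x (polelt s (u n)) @[n --> \oo] --> delta x g by exact: delta_cvg ug.
have E : (fun n => delta x (star oneA (polelt s (u n)))) = (fun n => delta x (polelt s (u n))).
  by apply/funext => n; rewrite poly1.
rewrite E in d2.
exact: (@cvg_unique C (@norm_hausdorff C C) _ _ _ _ d2 d1).
Qed.

End AnySignature.

Lemma Cge0P (z : C) : (0 <= z) <-> (cim z = 0 /\ 0 <= cre z).
Proof.
by rewrite lecE; split=> [/andP[/eqP h1 h2]|[h1 h2]]; [split|rewrite h2 andbT; apply/eqP].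
Qed.

Lemma ge0_lim (u : nat -> C) (l : C) : (forall n, 0 <= u n) -> u n @[n --> \oo] --> l -> 0 <= l.
Proof.
move=> u0 ul.
have u0' n : cim (u n) = 0 /\ 0 <= cre (u n) by apply/Cge0P.
have cr : cre (u n) @[n --> \oo] --> cre l by exact: cre_cvg ul.
have ci : cim (u n) @[n --> \oo] --> cim l by exact: cim_cvg ul.
apply/Cge0P; split.
  have E : (fun n => cim (u n)) = (fun=> 0) by apply/funext => n; case: (u0' n).
  rewrite E in ci.
  exact: (@cvg_unique R (@norm_hausdorff R R) _ _ _ _ ci (cvg_cst 0)).
by apply: (cvgr_to_ge cr); apply: nearW => n; case: (u0' n).
Qed.

Lemma ge0_line (c z : C) : (forall t : R, 0 <= c + rc t * z) -> z = 0.
Proof.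
move=> H.
have H1 t : (cim c + t * cim z = 0) /\ (0 <= cre c + t * cre z).
  have /Cge0P := H t; rewrite cimD creD ![rc t * z]mulrC cimMrc creMrc.
  by rewrite ![_ * t]mulrC.
have [a0 _] := H1 0; have [a1 _] := H1 1.
have iz : cim z = 0 by lra.
have rz : cre z = 0.
  apply/eqP; apply/negPn/negP => z0.
  (* At this [t] the real part would be [-1]. *)
  have [_] := H1 (- (cre c + 1) / cre z).
  rewrite mulfVK// => h; lra.
exact: creimP.
Qed.

(** * Signs of the falling factorials *)

Section Nonvanishing.
Variable hbar : R.
Hypothesis hbar_lt : hbar < -1.
Local Notation X := ((hbar%:C)%C^-1 : C).

Lemma inv_hbar : -1 < hbar^-1 < 0.
Proof.
have h0 : hbar < 0 by apply: lt_trans hbar_lt _; rewrite oppr_lt0 ltr01.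
by rewrite invr_lt0 h0 andbT -[ltLHS]invrN1 ltf_nV2 ?negrE ?oppr_lt0.
Qed.

(** Each sign goes to one factor, which becomes [j%:R - X] and is positive because [X < 0]. *)
Lemma sign_falling_gt0 m : 0 < (-1) ^+ m * falling X m.
Proof.
have E : X = rc hbar^-1 by rewrite rcV.
elim: m => [|m IH]; first by rewrite expr0 [falling _ _]big_ord0 mulr1 ltr01.
have -> : (-1) ^+ m.+1 * falling X m.+1 = ((-1) ^+ m * falling X m) * (m%:R - X).
  by rewrite /falling big_ord_recr /= exprS; ring.
rewrite mulr_gt0// E -rc_nat -rcB -rc0 rc_lt subr_gt0.
by have /andP[_ h] := inv_hbar; rewrite (lt_le_trans h).
Qed.

Lemma falling_neq0 m : falling X m != 0.
Proof.
by have := sign_falling_gt0 m; rewrite lt0r mulf_eq0 => /andP[/norP[]].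
Qed.

Lemma sign_div_falling_ge0 m : 0 <= (-1) ^+ m / falling X m.
Proof.
have -> : (-1) ^+ m / falling X m = ((-1) ^+ m * falling X m)^-1.
  by rewrite invfM invr_sign.
by rewrite invr_ge0 ltW// sign_falling_gt0.
Qed.

End Nonvanishing.
End StarValues.

(** * Positive functionals *)

Section Positivity.
Context {R : realType}.
Local Notation C := (Cplx R).
Local Notation i0 := (ord0 : 'I_2).
Local Notation i1 := (lift ord0 ord0 : 'I_2).
Variable hbar : R.
Hypothesis hbar_lt : hbar < -1.
Local Notation H := ((hbar%:C)%C : C).

Lemma conjC_rc (t : R) : (rc t)^* = rc t.
Proof. exact: conjc_real. Qed.

Lemma conjA_lin s k (f g : Ared R s) : conjA (k *: f + g) = k^* *: conjA f + conjA g.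
Proof.
apply: val_inj; apply/funext => x.
by rewrite -[LHS]/((k * f x + g x)^*) -[RHS]/(k^* * (f x)^* + (g x)^*) rmorphD rmorphM.
Qed.

Lemma conjA0 s : conjA (0 : Ared R s) = 0.
Proof. by apply: val_inj; apply/funext => x; rewrite -[LHS]/(0^*) rmorph0. Qed.

Definition conj_mono (m : mono) : mono := Mono (esym (mE m)).

Lemma conjA_polelt s l :
  conjA (polelt s l) = \sum_(t <- l) t.1^* *: bred R s (mE (conj_mono t.2)).
Proof.
rewrite /polelt; elim: l => [|t l IH]; first by rewrite !big_nil conjA0.
by rewrite !big_cons conjA_lin IH conjA_bred.
Qed.

Lemma delta_scalar s (p : Mred R s) : scalar (delta p).
Proof. by []. Qed.

Lemma scalar_sum s (phi : Ared R s -> C) (I : Type) (l : seq I) (c : I -> C) (f : I -> Ared R s) :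
  scalar phi -> phi (\sum_(t <- l) c t *: f t) = \sum_(t <- l) c t * phi (f t).
Proof.
move=> lf; pose L := GRing.isLinear.Build _ _ _ _ phi lf.
pose F : {scalar Ared R s} := HB.pack phi L.
rewrite -[phi]/(F : Ared R s -> C) linear_sum; apply: eq_bigr => t _; exact: linearZ.
Qed.

Section Disc.
Variable star : Ared R 1 -> Ared R 1 -> Ared R 1.
Hypothesis starP : is_star H star.

Lemma delta_star_mono (t u : mono) (rho : @Z R 1) :
  let a := val rho 0 i0 in let b := val rho 0 i1 in
  let y (m : mono) := a^* ^+ mQ m i0 * b^* ^+ mQ m i1 in
  delta (\pi_(Mred R 1) rho) (star (bred R 1 (mE (conj_mono t))) (bred R 1 (mE u))) =
  (y t)^* * y u *
    (kern H^-1 a b a^* b^* (mP t i0) (mP t i1) (mP u i0) (mP u i1) /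
     (ffall H^-1 (mP t i0 + mP t i1) * ffall H^-1 (mP u i0 + mP u i1))).
Proof.
move=> a b y; rewrite [LHS](star_eval _ _ _ _ starP)//=.
rewrite -/a -/b /y rmorphM !rmorphXn /= !conjCK; congr (_ * _).
rewrite /kern mulr_suml; apply: eq_bigr => i _; rewrite mulr_suml; apply: eq_bigr => j _.
rewrite /kern_term -![falling _ _]/(ffall _ _) [nu R 1 i1]/nu /=; ring.
Qed.

Lemma delta_polelt_ge0 (p : Mred R 1) l :
  0 <= delta p (star (conjA (polelt 1 l)) (polelt 1 l)).
Proof.
have [lin linl _ _] := starP.
rewrite -[p]reprK; set rho := repr p; rewrite conjA_polelt.
rewrite (linear_sumZ _ _ _ (linl _)) (scalar_sum _ _ _ (@delta_scalar _ _)).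
under eq_bigr => t _.
  rewrite (linear_sumZ _ _ _ (lin _)) (scalar_sum _ _ _ (@delta_scalar _ _)) mulr_sumr.
  under eq_bigr do rewrite delta_star_mono.
  over.
set a := val rho 0 i0; set b := val rho 0 i1.
have ab : a * a^* - b * b^* = 1.
  have := set_mem (valP rho); rewrite /Z /= /Jform big_ord_recl big_ord1 /= /nu /= => <-.
  by rewrite mul1r mulN1r.
(* Lists are turned into families over a finite type, as [kern_psd_ge0] expects. *)
rewrite big_tnth; under eq_bigr do rewrite big_tnth.
have := kern_psd_ge0 ab (falling_neq0 hbar_lt)
  (fun t : 'I_(size l) => mP (tnth (in_tuple l) t).2 i0)
  (fun t : 'I_(size l) => mP (tnth (in_tuple l) t).2 i1)
  (fun t : 'I_(size l) => let m := (tnth (in_tuple l) t) in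
     m.1 * (a^* ^+ mQ m.2 i0 * b^* ^+ mQ m.2 i1)) (sign_div_falling_ge0 hbar_lt).
congr (0 <= _); apply: eq_bigr => t _; apply: eq_bigr => u _.
by rewrite /= rmorphM /=; ring.
Qed.

Lemma delta_positive (p : Mred R 1) : is_positive star (delta p).
Proof.
move=> f; have [u uf] := @polelt_dense R 1 isT f.
have [_ _ cts _] := starP.
have cuf : conjA (polelt 1 (u n)) @[n --> \oo] --> conjA f by exact: conjA_cvg uf.
have c1 : (conjA (polelt 1 (u n)), polelt 1 (u n)) @[n --> \oo] -->
    ((conjA f, f) : Ared R 1 * Ared R 1).
  exact: (@cvg_pair _ _ _ \oo (nbhs (conjA f)) (nbhs f) _ _ _ _ _ cuf uf).
have c2 : star (conjA (polelt 1 (u n))) (polelt 1 (u n)) @[n --> \oo] --> star (conjA f) f.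
  exact: (@cvg_comp _ _ _ _ (fun p : Ared R 1 * Ared R 1 => star p.1 p.2) _ _ _ c1
    (cts (conjA f, f))).
apply: (@ge0_lim R _ _ (fun n => delta_polelt_ge0 p (u n))).
exact: delta_cvg c2.
Qed.

End Disc.

(** * Signature 2: vanishing of positive functionals *)

Section Sphere.
Variable star : Ared R 2 -> Ared R 2 -> Ared R 2.
Hypothesis starP : is_star H star.

Local Notation e0 := (mi 1 0).
Local Notation e1 := (mi 0 1).

Lemma mdeg_e01 : mdeg e0 = mdeg e1. Proof. by rewrite !mdeg_mi. Qed.

Lemma hbarC_neq0 : H != 0.
Proof. by have := falling_neq0 hbar_lt 1; rewrite /falling big_ord1 subr0 invr_eq0. Qed.

(** Only [T = 0] and [T = e0] contribute. With [x = H^-1] their weights are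
    [x (x - 1) / x ^ 2 = 1 - H] and [x / x ^ 2 = H]. *)
Lemma star_col0 P (e : mdeg P = mdeg e0) (e' : mdeg e0 = mdeg P) (rho : @Z R 2) :
  let a := val rho 0 i0 in let b := val rho 0 i1 in
  star (bred R 2 e) (bred R 2 e') (\pi_(Mred R 2) rho) =
  (a ^+ P i0 * b ^+ P i1) * (a^* ^+ P i0 * b^* ^+ P i1) * ((1 - H) * (a * a^*) + H).
Proof.
move=> a b; rewrite (star_eval _ _ _ _ starP)// -/a -/b; congr (_ * _).
rewrite /mi /= !minnn !big_ord_recl !big_ord0 /= !binn !bin0 /= /falling !big_ord_recl !big_ord0 /=.
rewrite -[bump 0 0]/1%N -[1`!]/1%N -[0`!]/1%N !muln1 !(subn0, subnn) !(expr0, expr1).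
field; exact: hbarC_neq0.
Qed.

Lemma star_col1 P (e : mdeg P = mdeg e1) (e' : mdeg e1 = mdeg P) (rho : @Z R 2) :
  let a := val rho 0 i0 in let b := val rho 0 i1 in
  star (bred R 2 e) (bred R 2 e') (\pi_(Mred R 2) rho) =
  (a ^+ P i0 * b ^+ P i1) * (a^* ^+ P i0 * b^* ^+ P i1) * ((1 - H) * (b * b^*) + H).
Proof.
move=> a b; rewrite (star_eval _ _ _ _ starP)// -/a -/b; congr (_ * _).
rewrite /mi /= !minnn !big_ord_recl !big_ord0 /= !binn !bin0 /= /falling !big_ord_recl !big_ord0 /=.
rewrite -[bump 0 0]/1%N -[1`!]/1%N -[0`!]/1%N !muln1 !(subn0, subnn) !(expr0, expr1).
rewrite -[nu R 2 _]/1; field; exact: hbarC_neq0.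
Qed.

Local Notation sq f := (star (conjA f) f).

(** The coefficients [1] give the sum the shape on which linearity of a functional is stated. *)
Lemma sum_sq :
  1 *: sq (bred R 2 (erefl (mdeg e0))) + (1 *: sq (bred R 2 mdeg_e01) +
  (1 *: sq (bred R 2 (esym mdeg_e01)) + sq (bred R 2 (erefl (mdeg e1))))) = (1 + H) *: @oneA R 2.
Proof.
apply: val_inj; apply/funext => x; rewrite -[x]reprK; set rho := repr x.
rewrite !conjA_bred -[RHS]/((1 + H) * @oneA R 2 (\pi rho)) oneAE//.
rewrite -[LHS]/(1 * star _ _ (\pi rho) + (1 * star _ _ (\pi rho) +
  (1 * star _ _ (\pi rho) + star _ _ (\pi rho)))).
rewrite !star_col0 !star_col1 /mi /=.
have : val rho 0 i0 * (val rho 0 i0)^* + val rho 0 i1 * (val rho 0 i1)^* = 1.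
  by rewrite -[RHS](set_mem (valP rho)) /Jform big_ord_recl big_ord1 /= /nu /= !mul1r.
move: (val rho 0 i0) (val rho 0 i1) => a b E.
set t := a * a^* + b * b^* in E.
(* The outer factors of each column add up to [t], and the inner ones of the two columns to
   [(1 - H) * t + 2 * H]; at [t = 1] this leaves [1 + H]. *)
transitivity (t * ((1 - H) * t + 2 * H)); last by rewrite E; ring.
rewrite !expr0 !expr1 /t; ring.
Qed.

Section Functional.
Variable phi : Ared R 2 -> C.
Hypothesis phi_lin : scalar phi.
Hypothesis phi_pos : is_positive star phi.

Lemma phi_one : phi (@oneA R 2) = 0.
Proof.
have one1 : star (@oneA R 2) (@oneA R 2) = @oneA R 2.
  by apply: (star_one _ _ starP) => //; exact: falling_neq0.
have p1 : 0 <= phi (@oneA R 2).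
  by have := phi_pos (@oneA R 2); rewrite conjA_one// one1.
have : 0 <= (1 + H) * phi (@oneA R 2).
  have <- : phi ((1 + H) *: @oneA R 2) = (1 + H) * phi (@oneA R 2).
    have := phi_lin (1 + H) (@oneA R 2) 0.
    have := phi_lin (-1) 0 0; rewrite scaler0 addr0 mulN1r addNr => ->.
    by rewrite !addr0.
  by rewrite -sum_sq !phi_lin !mul1r !addr_ge0// phi_pos.
have h1 : 1 + H < 0 by rewrite -rc1 -[H]/(rc hbar) -rcD -rc0 rc_lt -ltrBrDl sub0r.
by rewrite nmulr_rge0// => p2; apply/eqP; rewrite eq_le p1 p2.
Qed.

(** As [phi] kills the unit, positivity at [k *: oneA + g] has no quadratic term in [k]. Real [k]
    then force [phi g + w = 0], imaginary ones [w = phi g]. *)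
Lemma phi_eq0 g : phi g = 0.
Proof.
have [lin linl _ _] := starP.
have og f : star (@oneA R 2) f = f.
  by apply: (star_one _ _ starP) => //; exact: falling_neq0.
pose w := phi (star (conjA g) (@oneA R 2)); pose c := phi (star (conjA g) g).
have key (k : C) : 0 <= k^* * phi g + k * w + c.
  have := phi_pos (k *: @oneA R 2 + g); rewrite conjA_lin conjA_one// lin !(linl _) !og.
  by rewrite !phi_lin phi_one mulr0 add0r addrA [_ * w + _]addrC.
have s1 : phi g + w = 0.
  apply: (@ge0_line R c) => t; have := key (rc t).
  rewrite conjC_rc; congr (0 <= _); ring.
have s2 : 'i * (w - phi g) = 0.
  apply: (@ge0_line R c) => t; have := key ('i * rc t).
  rewrite rmorphM /= conjC_rc conjCi; congr (0 <= _); ring.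
move/eqP: s2; rewrite mulf_eq0 (negbTE (neq0Ci _)) /= subr_eq0 => /eqP s2.
by move: s1; rewrite s2 -mulr2n => /eqP; rewrite mulrn_eq0 /= => /eqP.
Qed.

End Functional.
End Sphere.
End Positivity.

Unset Implicit Arguments.

Theorem proposition6p10 (R : realType) (hbar : R) (hbar_lt : hbar < -1)
    (star1 : Ared R 1 -> Ared R 1 -> Ared R 1)
    (star2 : Ared R 2 -> Ared R 2 -> Ared R 2)
    (star1P : is_star (hbar%:C)%C star1) (star2P : is_star (hbar%:C)%C star2) :
  [/\ forall phi : Ared R 2 -> Cplx R,
        (scalar phi /\ is_positive star2 phi) <-> phi = (fun=> 0),
      forall p : Mred R 1,
        [/\ scalar (delta p), is_positive star1 (delta p) &
            exists f : Ared R 1, delta p f != 0] &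
      ~ star_isomorphic star1 star2].
Proof.
have delta_one p : delta p (@oneA R 1) = 1 by exact: oneAE.
split=> [phi|p|[Phi [lin [Psi PhiK PsiK] mor conj]]].
- split=> [[lin pos]|->]; last first.
    by split=> [k f g|f]; rewrite ?mulr0 ?addr0.
  by apply/funext => g; exact: (phi_eq0 hbar_lt star2P lin pos).
- split; [exact: delta_scalar|exact: (delta_positive hbar_lt star1P)|].
  by exists (@oneA R 1); rewrite delta_one oner_neq0.
- have PsiD k f g : Psi (k *: f + g) = k *: Psi f + Psi g.
    by apply: (can_inj PhiK); rewrite lin !PsiK.
  have Z1 : mkV 1 0 \in @Z R 1.
    apply/mem_set; rewrite /Z /= /Jform big_ord_recl big_ord1 /= !mkV0 !mkV1 /nu /=.
    by rewrite mul0r mulr0 addr0 mul1r mul1r rmorph1.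
  (* The centre of the disc. *)
  pose p := \pi_(Mred R 1)%qT (exist _ (mkV 1 0) Z1 : @Z R 1).
  (* The inverse [Psi] intertwines products and conjugations, so it pulls the positive evaluation
     back to signature 2. *)
  have pos : is_positive star2 (delta p \o Psi).
    move=> f /=; have -> : Psi (star2 (conjA f) f) = star1 (conjA (Psi f)) (Psi f).
      by apply: (can_inj PhiK); rewrite mor conj !PsiK.
    exact: (delta_positive hbar_lt star1P).
  have lin' : scalar (delta p \o Psi) by move=> k f g; rewrite /= PsiD.
  have := phi_eq0 hbar_lt star2P lin' pos (Phi (@oneA R 1)).
  by rewrite /= PhiK delta_one => /eqP; rewrite oner_eq0.
Qed.
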